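(* Let $A$ be a separable $C^*$-algebra and let $J \lhd A$ be a (closed, two-sided) ideal. Then $\operatorname{hr} J \le \operatorname{hr} A$.
   Context: ''c.p.'' means completely positive, ''c.p.c.'' means completely positive contractive. A c.p. approximation $(F,\psi,\varphi)$ for a $C^*$-algebra $A$ consists of a finite-dimensional $C^*$-algebra $F$ and c.p.c. maps $\psi:A\to F$, $\varphi:F\to A$. Strict order: let $F$ be a finite-dimensional $C^*$-algebra. A set $\{e_0,\dots,e_n\}\subset F$ is elementary if the $e_i$ are mutually orthogonal minimal projections of $F$ ($n+1$ distinct elements). A c.p. map $\varphi:F\to A$ has strict order not exceeding $n$, $\operatorname{ord}\varphi\le n$ ($n\in\{0,1,2,\dots\}$), if for every elementary set $\{e_0,\dots,e_{n+1}\}\subset F$ there are distinct $i,j\in\{0,\dots,n+1\}$ with $\varphi(e_i)\varphi(e_j)=0$. $\operatorname{ord}\varphi$ is the least such $n$. Piecewise homogeneous maps: let $F=\bigoplus_{i=1}^s M_{r_i}$, let $\varphi:F\to A$ be c.p.c., $\varphi_i:=\varphi|_{M_{r_i}}$, and let $\iota:\mathbb{C}^s\to F$ be the canonical unital embedding (onto the center of $F$). $\varphi$ is piecewise homogeneous (p.h.) if $\operatorname{ord}\varphi_i=0$ for all $i$; it is p.h. of strict order $n$ if it is p.h. and $\operatorname{ord}(\varphi\circ\iota)=n$. Homogeneous rank: $\operatorname{hr}A\le n$ if there is a net $(F_\lambda,\psi_\lambda,\varphi_\lambda)_\Lambda$ of c.p. approximations for $A$ such that $\varphi_\lambda\circ\psi_\lambda\to\mathrm{id}_A$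 pointwise in norm and each $\varphi_\lambda$ is p.h. of strict order not exceeding $n$. $\operatorname{hr}A$ is the least such $n$ ($\infty$ if there is none). *)

(* Defs.v *)
From HB Require Import structures.
From mathcomp Require Import all_boot all_order all_algebra.
From mathcomp Require Import complex.
From mathcomp Require Import all_classical all_reals all_analysis.
From mathcomp Require Import ring.

Set Implicit Arguments.
Unset Strict Implicit.
Unset Printing Implicit Defensive.

Import Order.TTheory GRing.Theory Num.Theory.
Import numFieldNormedType.Exports.

Local Open Scope classical_set_scope.
Local Open Scope ring_scope.

Reserved Notation "x ** y" (at level 40, left associativity).

(* Involutive rings, not assumed to be unital. *)
HB.mixin Record isStarRing T of GRing.Zmodule T := {
  starmul : T -> T -> T;
  star : T -> T;
  starmulA : associative starmul;
  starmulDl : left_distributive starmul +%R;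
  starmulDr : right_distributive starmul +%R;
  starK : involutive star;
  starD : {morph star : x y / x + y};
  starM : forall x y, star (starmul x y) = starmul (star y) (star x)
}.

#[short(type="starRingType")]
HB.structure Definition StarRing := {T of isStarRing T & GRing.Zmodule T}.

Notation "x ** y" := (starmul x y) : ring_scope.

HB.mixin Record isCStarAlgebra (R : realType) T
    of StarRing T & CompleteNormedModule R[i] T := {
  starmulZl : forall (k : R[i]) (x y : T), (k *: x) ** y = k *: (x ** y);
  starmulZr : forall (k : R[i]) (x y : T), x ** (k *: y) = k *: (x ** y);
  starZ : forall (k : R[i]) (x : T), star (k *: x) = k^* *: star x;
  ler_norm_starmul : forall x y : T, `|x ** y| <= `|x| * `|y|;
  cstar_identity : forall x : T, `|star x ** x| = `|x| ^+ 2
}.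

#[short(type="cstarAlgType")]
HB.structure Definition CStarAlgebra (R : realType) :=
  {T of isCStarAlgebra R T & StarRing T & CompleteNormedModule R[i] T}.

Section ComplexStarRing.
Variable R : realType.
Let C : numClosedFieldType := R[i].

Fact complex_starmulA : associative (fun x y : C => x * y).
Proof. exact: mulrA. Qed.
Fact complex_starmulDl : left_distributive (fun x y : C => x * y) +%R.
Proof. exact: mulrDl. Qed.
Fact complex_starmulDr : right_distributive (fun x y : C => x * y) +%R.
Proof. exact: mulrDr. Qed.
Fact complex_starK : involutive (fun x : C => x^*).
Proof. exact: conjCK. Qed.
Fact complex_starD : {morph (fun x : C => x^*) : x y / x + y}.
Proof. by move=> x y; rewrite rmorphD. Qed.
Fact complex_starM (x y : C) : (x * y)^* = y^* * x^*.
Proof. by rewrite rmorphM mulrC. Qed.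

HB.instance Definition _ := isStarRing.Build R[i] complex_starmulA
  complex_starmulDl complex_starmulDr complex_starK complex_starD
  complex_starM.
End ComplexStarRing.

Section StarRingTheory.
Variable A : starRingType.
Implicit Types x y : A.

Lemma starmul0l x : 0 ** x = 0.
Proof. by apply: (addrI (0 ** x)); rewrite -starmulDl !addr0. Qed.
Lemma starmul0r x : x ** 0 = 0.
Proof. by apply: (addrI (x ** 0)); rewrite -starmulDr !addr0. Qed.
Lemma star0 : star (0 : A) = 0.
Proof. by apply: (addrI (star 0)); rewrite -starD !addr0. Qed.
Lemma starmul_suml I (r : seq I) (P : pred I) (F : I -> A) y :
  (\sum_(i <- r | P i) F i) ** y = \sum_(i <- r | P i) F i ** y.
Proof.
exact: (big_morph (fun x => x ** y) (fun a b => starmulDl a b y) (starmul0l y)).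
Qed.
Lemma starmul_sumr I (r : seq I) (P : pred I) (F : I -> A) y :
  y ** (\sum_(i <- r | P i) F i) = \sum_(i <- r | P i) y ** F i.
Proof. exact: (big_morph _ (starmulDr y) (starmul0r y)). Qed.
Lemma star_sum I (r : seq I) (P : pred I) (F : I -> A) :
  star (\sum_(i <- r | P i) F i) = \sum_(i <- r | P i) star (F i).
Proof. exact: (big_morph _ (@starD A) star0). Qed.

End StarRingTheory.

(* M_k(A), with the row-by-column product and the transposed entrywise star. *)
Section MatrixStarRing.
Variables (A : starRingType) (k : nat).
Implicit Types x y z : 'M[A]_k.

Definition mx_starmul x y : 'M[A]_k :=
  \matrix_(i, j) \sum_l x i l ** y l j.
Definition mx_star x : 'M[A]_k := \matrix_(i, j) star (x j i).

Fact mx_starmulA : associative mx_starmul.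
Proof.
move=> x y z; apply/matrixP => i j; rewrite !mxE.
under eq_bigr do rewrite mxE starmul_sumr.
under [RHS]eq_bigr do rewrite mxE starmul_suml.
rewrite exchange_big; apply: eq_bigr => l _.
by apply: eq_bigr => m _; rewrite starmulA.
Qed.
Fact mx_starmulDl : left_distributive mx_starmul +%R.
Proof.
move=> x y z; apply/matrixP => i j; rewrite !mxE -big_split.
by apply: eq_bigr => l _; rewrite mxE starmulDl.
Qed.
Fact mx_starmulDr : right_distributive mx_starmul +%R.
Proof.
move=> x y z; apply/matrixP => i j; rewrite !mxE -big_split.
by apply: eq_bigr => l _; rewrite mxE starmulDr.
Qed.
Fact mx_starK : involutive mx_star.
Proof. by move=> x; apply/matrixP => i j; rewrite !mxE starK. Qed.
Fact mx_starD : {morph mx_star : x y / x + y}.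
Proof. by move=> x y; apply/matrixP => i j; rewrite !mxE starD. Qed.
Fact mx_starM x y :
  mx_star (mx_starmul x y) = mx_starmul (mx_star y) (mx_star x).
Proof.
apply/matrixP => i j; rewrite !mxE star_sum.
by apply: eq_bigr => l _; rewrite !mxE starM.
Qed.

HB.instance Definition _ := isStarRing.Build 'M[A]_k mx_starmulA
  mx_starmulDl mx_starmulDr mx_starK mx_starD mx_starM.
End MatrixStarRing.

Lemma mx_starmulE (R : realType) k (x y : 'M[R[i]]_k) : x ** y = x *m y.
Proof. by apply/matrixP => i j; rewrite !mxE. Qed.

Section FfunStarRing.
Variables (I : finType) (A : starRingType).
Implicit Types x y z : {ffun I -> A}.

Definition ffun_starmul x y : {ffun I -> A} := [ffun i => x i ** y i].
Definition ffun_star x : {ffun I -> A} := [ffun i => star (x i)].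

Fact ffun_starmulA : associative ffun_starmul.
Proof. by move=> x y z; apply/ffunP => i; rewrite !ffunE starmulA. Qed.
Fact ffun_starmulDl : left_distributive ffun_starmul +%R.
Proof. by move=> x y z; apply/ffunP => i; rewrite !ffunE starmulDl. Qed.
Fact ffun_starmulDr : right_distributive ffun_starmul +%R.
Proof. by move=> x y z; apply/ffunP => i; rewrite !ffunE starmulDr. Qed.
Fact ffun_starK : involutive ffun_star.
Proof. by move=> x; apply/ffunP => i; rewrite !ffunE starK. Qed.
Fact ffun_starD : {morph ffun_star : x y / x + y}.
Proof. by move=> x y; apply/ffunP => i; rewrite !ffunE starD. Qed.
Fact ffun_starM x y :
  ffun_star (ffun_starmul x y) = ffun_starmul (ffun_star y) (ffun_star x).
Proof. by apply/ffunP => i; rewrite !ffunE starM. Qed.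

HB.instance Definition _ := isStarRing.Build {ffun I -> A} ffun_starmulA
  ffun_starmulDl ffun_starmulDr ffun_starK ffun_starD ffun_starM.
End FfunStarRing.

(* Positivity; for k : nat and A a C*-algebra this applies to 'M[A]_k, whose
   positive elements are those of the form b^* b. *)
Definition positive (U : starRingType) (x : U) := exists b : U, x = star b ** b.

Section CompletelyPositive.
Variables (R : realType) (A B : cstarAlgType R).

Definition completely_positive (f : A -> B) :=
  linear f /\
  forall (k : nat) (x : 'M[A]_k), positive x -> positive (map_mx f x).

Definition contractive (f : A -> B) := forall x, `|f x| <= `|x|.

Definition cpc (f : A -> B) := completely_positive f /\ contractive f.

End CompletelyPositive.

Section StrictOrder.
Variables U V : starRingType.

Definition projection (p : U) := star p = p /\ p ** p = p.

Definition minimal_projection (p : U) :=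
  [/\ projection p, p <> 0 &
      forall q, projection q -> p ** q = q -> q = 0 \/ q = p].

(* The e i are distinct because they are nonzero and mutually orthogonal. *)
Definition elementary m (e : 'I_m -> U) :=
  (forall i, minimal_projection (e i)) /\
  (forall i j, i != j -> e i ** e j = 0).

(* ord f <= n: elementary sets have n + 2 elements e_0, ..., e_(n+1). *)
Definition strict_order_le (f : U -> V) (n : nat) :=
  forall e : 'I_n.+2 -> U, elementary e ->
  exists i j, i != j /\ f (e i) ** f (e j) = 0.

End StrictOrder.

Section FiniteDimensional.
Variables (R : realType) (F : cstarAlgType R).

Definition finite_dimensional := exists (n : nat) (b : 'I_n -> F),
  forall x, exists c : 'I_n -> R[i], x = \sum_i c i *: b i.

(* j exhibits F as the direct sum of the M_(r i), i < s: the summands are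
   carried *-homomorphically onto mutually orthogonal parts of F, and summing
   is a bijection from the product of the M_(r i) to F. *)
Record matrix_decomposition (s : nat) (r : 'I_s -> nat)
    (j : forall i, 'M[R[i]]_(r i) -> F) : Prop := MatrixDecomposition {
  decomp_gt0 : forall i, (0 < r i)%N;
  decomp_linear : forall i, linear (j i);
  decompM : forall i x y, j i (x ** y) = j i x ** j i y;
  decomp_star : forall i x, j i (star x) = star (j i x);
  decomp_orth : forall i l x y, i != l -> j i x ** j l y = 0;
  decomp_bij :
    bijective (fun x : forall i, 'M[R[i]]_(r i) => \sum_i j i (x i))
}.

Definition center_embedding (s : nat) (r : 'I_s -> nat)
    (j : forall i, 'M[R[i]]_(r i) -> F) (c : {ffun 'I_s -> R[i]}) : F :=
  \sum_i j i (c i)%:M.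

End FiniteDimensional.

Section PiecewiseHomogeneous.
Variables (R : realType) (F A : cstarAlgType R).

(* phi is p.h. of strict order at most n. *)
Definition ph_strict_order_le (phi : F -> A) (n : nat) :=
  exists (s : nat) (r : 'I_s -> nat) (j : forall i, 'M[R[i]]_(r i) -> F),
  [/\ matrix_decomposition j,
      cpc phi,
      forall i, strict_order_le (phi \o j i) 0 &
      strict_order_le (phi \o center_embedding j) n].

End PiecewiseHomogeneous.

Definition cp_approximation (R : realType) (A F : cstarAlgType R)
    (psi : A -> F) (phi : F -> A) :=
  [/\ finite_dimensional F, cpc psi & cpc phi].

Record directed (L : Type) (le : L -> L -> Prop) : Prop := Directed {
  directed_inh : inhabited L;
  directed_refl : forall l, le l l;
  directed_trans : forall l m n, le l m -> le m n -> le l n;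
  directed_ub : forall l m, exists n, le l n /\ le m n
}.

(* The filter of sets containing all sufficiently large indices; convergence
   of a net is convergence along it. *)
Definition net_filter (L : Type) (le : L -> L -> Prop) : set_system L :=
  [set S | exists l0, forall l, le l0 l -> S l].

Section HomogeneousRank.
Variables (R : realType) (A : cstarAlgType R).

Definition hr_le (n : nat) :=
  exists (L : Type) (le : L -> L -> Prop) (F : L -> cstarAlgType R)
         (psi : forall l, A -> F l) (phi : forall l, F l -> A),
  [/\ directed le,
      forall l, cp_approximation (psi l) (phi l),
      forall l, ph_strict_order_le (phi l) n &
      forall a : A, phi l (psi l a) @[l --> net_filter le] --> a].

(* An infimum of a set of naturals: the least element, or +oo if empty. *)
Definition hr : \bar R := ereal_inf [set n%:R%:E | n in hr_le].

End HomogeneousRank.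

Definition separable_space (T : topologicalType) :=
  exists2 D : set T, countable D & dense D.

Section ClosedStarSubalgebra.
Variables (R : realType) (A : cstarAlgType R).

Record closedStarSubalgebra := ClosedStarSubalgebra {
  subalg_set :> set A;
  subalg_closed : closed subalg_set;
  subalg0 : subalg_set 0;
  subalg_linear : forall (k : R[i]) x y,
    subalg_set x -> subalg_set y -> subalg_set (k *: x + y);
  subalgM : forall x y, subalg_set x -> subalg_set y -> subalg_set (x ** y);
  subalg_star : forall x, subalg_set x -> subalg_set (star x)
}.

Variable B : closedStarSubalgebra.

Definition subalg_type := {x : A | x \in subalg_set B}.

HB.instance Definition _ := [isSub of subalg_type for @sval _ _].
HB.instance Definition _ := [Choice of subalg_type by <:].

Fact subalg_zmod_closed : zmod_closed (fun x : A => x \in subalg_set B).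
Proof.
split=> [|x y]; first exact/mem_set/subalg0.
move=> /set_mem Bx /set_mem By; apply: mem_set.
by rewrite addrC -scaleN1r; apply: subalg_linear.
Qed.
HB.instance Definition _ :=
  GRing.SubChoice_isSubZmodule.Build A _ subalg_type subalg_zmod_closed.

Fact subalg_subsemimod_closed :
  GRing.subsemimod_closed (fun x : A => x \in subalg_set B).
Proof.
split; first split.
- exact/mem_set/subalg0.
- move=> x y /set_mem Bx /set_mem By; apply: mem_set.
  by rewrite -[x]scale1r; apply: subalg_linear.
- move=> k x /set_mem Bx; apply: mem_set.
  by rewrite -[_ *: _]addr0; apply: subalg_linear => //; exact: subalg0.
Qed.
HB.instance Definition _ := GRing.SubZmodule_isSubLmodule.Build R[i] A _
  subalg_type subalg_subsemimod_closed.

Fact subalg_memM (x y : subalg_type) : (val x ** val y) \in subalg_set B.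
Proof.
by apply: mem_set; apply: subalgM; apply: set_mem; [exact: valP x|exact: valP y].
Qed.
Fact subalg_mem_star (x : subalg_type) : star (val x) \in subalg_set B.
Proof. by apply: mem_set; apply: subalg_star; apply: set_mem; exact: valP x. Qed.

Definition subalg_mul (x y : subalg_type) : subalg_type :=
  exist _ (val x ** val y) (subalg_memM x y).
Definition subalg_adj (x : subalg_type) : subalg_type :=
  exist _ (star (val x)) (subalg_mem_star x).

Fact subalg_mulA : associative subalg_mul.
Proof. by move=> x y z; apply: val_inj => /=; rewrite starmulA. Qed.
Fact subalg_mulDl : left_distributive subalg_mul +%R.
Proof. by move=> x y z; apply: val_inj; rewrite /= starmulDl. Qed.
Fact subalg_mulDr : right_distributive subalg_mul +%R.
Proof. by move=> x y z; apply: val_inj; rewrite /= starmulDr. Qed.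
Fact subalg_adjK : involutive subalg_adj.
Proof. by move=> x; apply: val_inj; rewrite /= starK. Qed.
Fact subalg_adjD : {morph subalg_adj : x y / x + y}.
Proof. by move=> x y; apply: val_inj; rewrite /= starD. Qed.
Fact subalg_adjM x y :
  subalg_adj (subalg_mul x y) = subalg_mul (subalg_adj y) (subalg_adj x).
Proof. by apply: val_inj; rewrite /= starM. Qed.

HB.instance Definition _ := isStarRing.Build subalg_type subalg_mulA
  subalg_mulDl subalg_mulDr subalg_adjK subalg_adjD subalg_adjM.

Definition subalg_norm (x : subalg_type) : R[i] := `|val x|.
Fact subalg_normD x y : subalg_norm (x + y) <= subalg_norm x + subalg_norm y.
Proof. exact: ler_normD. Qed.
Fact subalg_normZ (k : R[i]) x : subalg_norm (k *: x) = `|k| * subalg_norm x.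
Proof. exact: normrZ. Qed.
Fact subalg_norm0_eq0 x : subalg_norm x = 0 -> x = 0.
Proof. by move=> /normr0_eq0 x0; apply: val_inj. Qed.

HB.instance Definition _ := Lmodule_isNormed.Build R[i] subalg_type
  subalg_normD subalg_normZ subalg_norm0_eq0.

Fact subalg_complete (G : set_system subalg_type) :
  ProperFilter G -> cauchy G -> cvg G.
Proof.
move=> GG Gc.
have vc : cauchy (val @ G : set_system A).
  apply/cauchyP => e e0; have /cauchyP/(_ e e0)[x Gx] := Gc.
  exists (val x); suff -> : ball (val x) e = [set a | `|val x - a| < e].
    by move: Gx; rewrite -ball_normE.
  by rewrite -ball_normE.
have /cvg_ex[a ca] : cvg (val @ G : set_system A) by exact: cauchy_cvg.
have Ba : subalg_set B a.
  apply: (closed_cvg _ (@subalg_closed B) _ _ ca).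
  by apply: nearW => x; apply: set_mem; exact: valP x.
apply/cvg_ex; exists (exist _ a (mem_set Ba) : subalg_type).
apply/cvgrPdist_lt => e e0.
by move/cvgrPdist_lt: ca => /(_ e e0).
Qed.

HB.instance Definition _ := Uniform_isComplete.Build subalg_type
  subalg_complete.

Fact subalg_mulZl (k : R[i]) (x y : subalg_type) :
  (k *: x) ** y = k *: (x ** y).
Proof. by apply: val_inj; rewrite /= starmulZl. Qed.
Fact subalg_mulZr (k : R[i]) (x y : subalg_type) :
  x ** (k *: y) = k *: (x ** y).
Proof. by apply: val_inj; rewrite /= starmulZr. Qed.
Fact subalg_adjZ (k : R[i]) (x : subalg_type) : star (k *: x) = k^* *: star x.
Proof. by apply: val_inj; rewrite /= starZ. Qed.
Fact subalg_norm_mul (x y : subalg_type) : `|x ** y| <= `|x| * `|y|.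
Proof. exact: ler_norm_starmul. Qed.
Fact subalg_cstar (x : subalg_type) : `|star x ** x| = `|x| ^+ 2.
Proof. exact: cstar_identity. Qed.

HB.instance Definition _ := isCStarAlgebra.Build R subalg_type
  subalg_mulZl subalg_mulZr subalg_adjZ subalg_norm_mul subalg_cstar.

End ClosedStarSubalgebra.

Section ClosedIdeal.
Variables (R : realType) (A : cstarAlgType R).

Record closed_ideal (J : set A) : Prop := ClosedIdeal {
  ideal_closed : closed J;
  ideal0 : J 0;
  ideal_linear : forall (k : R[i]) x y, J x -> J y -> J (k *: x + y);
  ideal_mull : forall a x, J x -> J (a ** x);
  ideal_mulr : forall a x, J x -> J (x ** a)
}.

Lemma norm_star (x : A) : `|star x| = `|x|.
Proof.
suff le y : `|y : A| <= `|star y|.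
  by apply/le_anti; rewrite -{2}[x]starK !le.
have [->|y0] := eqVneq y 0; first by rewrite normr0.
rewrite -(@ler_pM2r _ `|y|) ?normr_gt0// -expr2 -cstar_identity.
exact: ler_norm_starmul.
Qed.

(* Closed ideals are self-adjoint.  For x in J let k = x^* x and let c be
   purely imaginary.  The iterates of L : y |-> y + c k y stay bounded for
   about |c|^(-2) steps, so the average z of the first m iterates of x^* is
   small for suitable c and m, while x^* - z belongs to J because k does. *)
Section Step.
Variables (k : A) (k_sa : star k = k).

Let L (c : R[i]) (y : A) : A := y + c *: (k ** y).

Lemma step_mulr c n y w : iter n (L c) y ** w = iter n (L c) (y ** w).
Proof.
elim: n => //= n <-.
by rewrite /L starmulDl starmulZl starmulA.
Qed.

Lemma step_star c n y : c^* = - c ->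
  star (iter n (L c) k) ** y = k ** iter n (L (- c)) y.
Proof.
move=> cN; elim: n y => [|n IH] y; first by rewrite /= k_sa.
rewrite [in RHS]iterSr -IH /= {1 3}/L starD starZ starM k_sa cN.
by rewrite starmulDl starmulDr starmulZl starmulZr starmulA.
Qed.

Lemma step_norm (c : R[i]) y : c^* = - c ->
  `|L c y| ^+ 2 <= (1 + (`|c| * `|k|) ^+ 2) * `|y| ^+ 2.
Proof.
move=> cN; rewrite -cstar_identity /L starD starZ starM k_sa cN.
rewrite starmulDl !starmulDr starmulZl !starmulZr starmulZl scalerA.
rewrite -starmulA scaleNr.
rewrite -addrA [X in _ + X]addrA subrr add0r.
rewrite (le_trans (ler_normD _ _))// mulrDl mul1r cstar_identity lerD2l.
rewrite normrZ normrM normrN -expr2 exprMn -[leRHS]mulrA ler_wpM2l ?exprn_ge0//.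
rewrite -exprMn expr2 (le_trans (ler_norm_starmul _ _))//.
apply: ler_pM => //; last exact: ler_norm_starmul.
by rewrite mulrC (le_trans (ler_norm_starmul _ _))// norm_star.
Qed.

Lemma step_iter_norm (c : R[i]) m n y : c^* = - c -> (n <= m)%N ->
  m%:R * (`|c| * `|k|) ^+ 2 <= 2^-1 -> `|iter n (L c) y| <= 2 * `|y|.
Proof.
move=> cN nm; set d := (_ ^+ 2) => md.
have d0 : 0 <= d by rewrite exprn_ge0// mulr_ge0.
have m0 : (0 : R[i]) < 2 by [].
have nd : n%:R * d <= 2^-1 by rewrite (le_trans _ md)// ler_wpM2r// ler_nat.
have IH j : (j <= n)%N ->
    (1 - j%:R * d) * `|iter j (L c) y| ^+ 2 <= `|y| ^+ 2.
  elim: j => [_|j IHj jn]; first by rewrite mul0r subr0 mul1r.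
  have jd : 0 <= 1 - j.+1%:R * d.
    rewrite subr_ge0 (@le_trans _ _ (n%:R * d)) ?ler_wpM2r ?ler_nat//.
    by rewrite (le_trans nd)// invf_le1// ler1n.
  apply: le_trans (IHj (ltnW jn)) => /=.
  apply: (@le_trans _ _ ((1 - j.+1%:R * d) *
     ((1 + d) * `|iter j (L c) y| ^+ 2))).
    by rewrite ler_wpM2l// step_norm.
  rewrite mulrA ler_wpM2r ?exprn_ge0//.
  have -> : (1 - j.+1%:R * d) * (1 + d) = 1 - j%:R * d - j.+1%:R * d ^+ 2.
    by rewrite -natr1; ring.
  by rewrite gerBl mulr_ge0// exprn_ge0.
rewrite -(@ler_pXn2r _ 2)// ?nnegrE ?mulr_ge0// exprMn.
have h : (2^-1 : R[i]) * `|iter n (L c) y| ^+ 2 <= `|y| ^+ 2.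
  apply: le_trans (IH n (leqnn n)); rewrite ler_wpM2r ?exprn_ge0//.
  rewrite lerBrDr (le_trans (lerD (lexx _) nd))//.
  by rewrite -[X in X + X]mulr1 -mulrDr mulVf// ?pnatr_eq0.
rewrite mulrC ler_pdivrMr// in h; apply: (le_trans h).
by rewrite mulrC ler_wpM2r ?exprn_ge0// -natrX ler_nat.
Qed.

Lemma step_sum c m y :
  c *: (k ** \sum_(j < m) iter j (L c) y) = iter m (L c) y - y.
Proof.
elim: m => [|m IH]; first by rewrite big_ord0 starmul0r scaler0 subrr.
by rewrite big_ord_recr starmulDr scalerDr IH /= {3}/L addrAC.
Qed.

Lemma step_ideal (J : set A) c n y : closed_ideal J -> J k ->
  J (iter n (L c) y - y).
Proof.
move=> hJ Jk; elim: n => [|n IH]; first by rewrite subrr; exact: ideal0 hJ.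
rewrite /= {1}/L addrAC addrC.
by apply: (ideal_linear hJ) IH; apply: (ideal_mulr hJ).
Qed.

Definition step_avg c m y := m%:R^-1 *: \sum_(j < m) iter j (L c) y.

Lemma step_avg_norm c m y : c^* = - c -> (0 < m)%N ->
  m%:R * (`|c| * `|k|) ^+ 2 <= 2^-1 -> `|step_avg c m y| <= 2 * `|y|.
Proof.
move=> cN m0 md; rewrite normrZ ger0_norm ?invr_ge0// mulrC.
rewrite ler_pdivrMr ?ltr0n// (le_trans (ler_norm_sum _ _ _))//.
rewrite mulr_natr -[X in _ *+ X]card_ord -sumr_const ler_sum// => j _.
by apply: (@step_iter_norm c m j) => //; exact: ltnW.
Qed.

Lemma step_avg_mul c m y : c^* = - c -> c != 0 -> (0 < m)%N ->
  m%:R * (`|c| * `|k|) ^+ 2 <= 2^-1 ->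
  `|k ** step_avg c m y| <= 3 / (m%:R * `|c|) * `|y|.
Proof.
move=> cN c0 m0 md; rewrite mulrAC ler_pdivlMr ?mulr_gt0 ?ltr0n ?normr_gt0//.
rewrite starmulZr normrZ ger0_norm ?invr_ge0// mulrACA.
rewrite mulVf ?pnatr_eq0 -?lt0n// mul1r mulrC.
rewrite -normrZ step_sum (le_trans (ler_normB _ _))//.
by rewrite -natr1 mulrDl mul1r lerD2r (@step_iter_norm c m m).
Qed.

Lemma step_avg_mulr c m y w : step_avg c m y ** w = step_avg c m (y ** w).
Proof.
rewrite /step_avg starmulZl starmul_suml; congr (_ *: _).
by apply: eq_bigr => j _; rewrite step_mulr.
Qed.

Lemma step_avg_star c m y : c^* = - c ->
  star (step_avg c m k) ** y = k ** step_avg (- c) m y.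
Proof.
move=> cN; rewrite /step_avg starZ starmulZl starmulZr star_sum.
rewrite geC0_conj ?invr_ge0// starmul_suml starmul_sumr; congr (_ *: _).
by apply: eq_bigr => j _; rewrite step_star.
Qed.

Lemma step_avg_ideal (J : set A) c m y : closed_ideal J -> J k ->
  (0 < m)%N -> J (step_avg c m y - y).
Proof.
move=> hJ Jk m0.
have -> : step_avg c m y - y =
    m%:R^-1 *: (\sum_(j < m) (iter j (L c) y - y)) + 0.
  rewrite addr0 sumrB scalerBr; congr (_ - _).
  rewrite sumr_const card_ord -[y *+ m]scaler_nat scalerA mulVf ?scale1r//.
  by rewrite pnatr_eq0 -lt0n.
apply: (ideal_linear hJ); last exact: ideal0 hJ.
apply: big_ind; first exact: ideal0 hJ.
  by move=> u v Ju Jv; rewrite -[u]scale1r; apply: (ideal_linear hJ).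
by move=> j _; apply: step_ideal.
Qed.

End Step.

Lemma complex_bound (M : R[i]) : 0 <= M -> exists p : nat, M < p%:R.
Proof.
case: M => a b; rewrite lecE /= => /andP[/eqP -> a0].
exists (Num.bound a); rewrite -[_%:R](rmorph_nat (real_complex R)).
by rewrite ltcE /= eqxx /= archi_boundP.
Qed.

Lemma closed_ideal_approx (J : set A) x (e : R[i]) : closed_ideal J -> J x ->
  0 < e -> exists2 z, J (star x - z) & `|z| < e.
Proof.
move=> hJ Jx e0; pose k := star x ** x.
have k_sa : star k = k by rewrite starM starK.
have Jk : J k by apply: (ideal_mull hJ).
pose s : R[i] := (2 * (`|k| + 1))^-1.
have k1 : 0 < `|k| + 1 by rewrite ltr_wpDl.
have s0 : 0 < s by rewrite invr_gt0 mulr_gt0.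
have [|p pM] := complex_bound (M := 6 / (s * e ^+ 2)).
  by rewrite divr_ge0// mulr_ge0 ?exprn_ge0// ltW.
have p0 : 0 < p%:R :> R[i].
  by apply: le_lt_trans pM; rewrite divr_ge0// mulr_ge0 ?exprn_ge0// ltW.
have pN0 : (p%:R : R[i]) != 0 by rewrite gt_eqF.
have p0n : (0 < p)%N by rewrite -(ltr0n R[i]).
pose m := (p ^ 2)%N.
have m0 : (0 < m)%N by rewrite expn_gt0 p0n.
pose c : R[i] := 'i * (s / p%:R).
have t0 : 0 < s / p%:R by rewrite divr_gt0.
have cN : c^* = - c by rewrite rmorphM /= conjCi geC0_conj ?mulNr// ltW.
have nc : `|c| = s / p%:R by rewrite normrM normCi mul1r gtr0_norm.
have c0 : c != 0 by rewrite -normr_gt0 nc.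
have md : m%:R * (`|c| * `|k|) ^+ 2 <= 2^-1.
  rewrite nc /m natrX -exprMn mulrA mulrCA mulfV// mulr1.
  have : s * `|k| <= 2^-1.
    rewrite /s invfM -mulrA -[leRHS]mulr1 ler_wpM2l// ler_pdivrMl// mulr1.
    by rewrite lerDl.
  have sk0 : 0 <= s * `|k| by rewrite mulr_ge0// ltW.
  move=> h; rewrite expr2 -[leRHS]mulr1 ler_pM//.
  by rewrite (le_trans h)// invf_le1// ler1n.
have mc : m%:R * `|c| = s * p%:R.
  by rewrite nc /m natrX; field.
pose z := step_avg k c m (star x).
exists z.
  rewrite -[_ - _]opprB -scaleN1r -[_ *: _]addr0.
  by apply: (ideal_linear hJ); [exact: step_avg_ideal|exact: ideal0 hJ].
have cN' : (- c)^* = - - c by rewrite rmorphN /= cN.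
have zz y : `|(z ** star z) ** y| <= 6 / (s * p%:R) * `|y|.
  have -> : (z ** star z) ** y = step_avg k c m (k ** step_avg k (- c) m y).
    rewrite {1}/z [step_avg _ _ _ _ ** star z]step_avg_mulr. rewrite -starM.
    by rewrite /z [step_avg _ _ _ _ ** x]step_avg_mulr step_avg_mulr step_avg_star.
  rewrite (le_trans (step_avg_norm _ _ _ _ md))//.
  apply: (@le_trans _ _ (2 * (3 / (s * p%:R) * `|y|))).
    rewrite ler_wpM2l// -mc -[`|c|]normrN.
    by apply: step_avg_mul; rewrite ?oppr_eq0 ?normrN.
  by rewrite !mulrA -natrM.
have z2 : `|z| ^+ 2 <= 6 / (s * p%:R).
  rewrite -norm_star -cstar_identity starK.
  have [->|zz0] := eqVneq (z ** star z) 0.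
    by rewrite normr0 divr_ge0// mulr_ge0// ltW.
  rewrite -(@ler_pM2r _ `|z ** star z|) ?normr_gt0//.
  by apply: le_trans (zz _); rewrite -expr2 -cstar_identity starM starK.
have : `|z| ^+ 2 < e ^+ 2.
  rewrite (le_lt_trans z2)// ltr_pdivrMr ?mulr_gt0//.
  move: pM; rewrite ltr_pdivrMr ?mulr_gt0 ?exprn_gt0//.
  by congr (is_true (_ < _)); ring.
by rewrite ltr_pXn2r// nnegrE ?normr_ge0 ?(ltW e0).
Qed.

Lemma closed_ideal_star (J : set A) x : closed_ideal J -> J x -> J (star x).
Proof.
move=> hJ Jx; have := ideal_closed hJ; apply => U /nbhs_normP[e /= e0 eU].
have [z Jz ze] := closed_ideal_approx hJ Jx e0.
exists (star x - z); split => //; apply: eU => /=.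
by rewrite opprB addrC subrK.
Qed.

Definition ideal_subalg (J : set A) (hJ : closed_ideal J) :
    closedStarSubalgebra A :=
  {| subalg_set := J;
     subalg_closed := ideal_closed hJ;
     subalg0 := ideal0 hJ;
     subalg_linear := ideal_linear hJ;
     subalgM := fun x y _ Jy => ideal_mull hJ x Jy;
     subalg_star := fun x Jx => closed_ideal_star hJ Jx |}.

End ClosedIdeal.

(* Main.v *)
Require Import Defs.
From HB Require Import structures.
From mathcomp Require Import all_boot ssrAC all_order all_algebra.
From mathcomp Require Import complex.
From mathcomp Require Import all_classical all_reals all_analysis.
From mathcomp Require Import ring lra.
From Stdlib Require Ncring Ncring_tac.

Set Implicit Arguments.
Unset Strict Implicit.
Unset Printing Implicit Defensive.

Import Order.TTheory GRing.Theory Num.Theory.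
Import numFieldNormedType.Exports.

Local Open Scope classical_set_scope.
Local Open Scope ring_scope.

(* Let phi : F -> A be piecewise homogeneous, with phi_i of order zero on the
   summand M_(r_i) and h_i = phi_i(1).  By the structure of order zero maps, the
   elements t_(i,a) = h_i^(-1/2) phi_i(e_(a,1)) (approximated within A) satisfy
   t_(i,a) t_(i,b)^* = phi_i(e_(a,b)), the t_(i,a)^* t_(i,b) vanish for a <> b and
   do not depend on a for a = b, and t_(i,a)^* t_(l,b) = 0 if h_i h_l = 0.  Hence
   for every v in J the map
     phi'(x) = sum_i sum_(a,b) (x_i)_(a,b) t_(i,a) v v^* t_(i,b)^*
   into J is completely positive, and it inherits both order conditions exactly:
   no quasi-central approximate unit and no perturbation argument are needed.

   With T the row of the t_(i,a), we have T x T^* = phi(x) and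
   phi'(x) = T (x (x) v v^* ) T^*.  If x = psi(b^* b) = y^* y with b in J, the row
   T y^* satisfies (T y^* )(T y^* )^* = phi (psi (b^* b)), which is close to J;
   therefore T y^* is close to a row over J and phi'(x) is close to phi(x) as soon
   as v v^* is a sufficiently good unit for the finitely many entries of that row.

   The required facts on C*-algebras (x^* x has nonnegative spectrum,
   Cauchy-Schwarz, sums of squares in M_m(A) are squares, approximate units) all
   come from the existence of square roots: V = X + V^2 is solved by iteration in
   the (matrices over the) unitization, acting on A^m. *)

(** The order conditions are equations, which a perturbation in norm would destroy. Taking [t_(i,a)]
    as [h_i^(1/2) p(h_i)] times the image of a matrix unit, with [p] a polynomial approximating
    [1/h], keeps every relation among the products [t^* t] exact. Only
    [t_(i,a) t_(i,b)^* = phi_i(e_(a,b))] becomes approximate, and norm estimates absorb that. The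
    bound [2/(n+1)] for [h (1 - h)^n] takes the place of functional calculus in these estimates. The
    order of choices matters. For [b] in J and a final error [d], the tolerance [e] of [cut_error]
    depends on nothing else. Then come the index of the net, the roots [t] with an error adapted to
    the coordinates of [psi(b^* b)], and last [v], since the entries that it must almost fix involve
    [t]. The comparison is made only at elements [b^* b], because it reads [phi'(y^* y)] as an inner
    product. As J need not have a unit, a general [a] is first replaced by [a u] with [u] from an
    approximate unit, and [a u] is a combination of four squares by polarization. *)

(** * Real-valued norms and limits with explicit rates *)

Section RealNorm.
Variables (R : realType) (A : cstarAlgType R).
Implicit Types (x y : A) (k : R[i]).

(* The norms of [A] and of [R[i]] take values in [R[i]]; [rn] and [cabs] are their
   versions with values in the ordered field [R]. *)
Definition cabs k : R := complex.Re `|k|.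
Definition rn x : R := complex.Re `|x|.

Lemma cabsE k : `|k| = (cabs k)%:C%C.
Proof. by rewrite /cabs RRe_real// ger0_real. Qed.

Lemma rnE x : `|x| = (rn x)%:C%C.
Proof. by rewrite /rn RRe_real// ger0_real. Qed.

Lemma cabs_ge0 k : 0 <= cabs k.
Proof. by rewrite -ler0c -cabsE. Qed.

Lemma cabsD k l : cabs (k + l) <= cabs k + cabs l.
Proof. by rewrite -lecR rmorphD /= -!cabsE ler_normD. Qed.

Lemma cabsM k l : cabs (k * l) = cabs k * cabs l.
Proof. by apply: complexI; rewrite rmorphM /= -!cabsE normrM. Qed.

Lemma cabsN k : cabs (- k) = cabs k.
Proof. by rewrite /cabs normrN. Qed.

Lemma cabs0 : cabs 0 = 0.
Proof. by rewrite /cabs normr0. Qed.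

Lemma cabs_eq0 k : cabs k = 0 -> k = 0.
Proof. by move=> k0; apply/normr0_eq0; rewrite cabsE k0. Qed.

Lemma cabs_conj k : cabs k^* = cabs k.
Proof. by rewrite /cabs norm_conjC. Qed.

Lemma cabs_real (r : R) : cabs r%:C%C = `|r|.
Proof. by rewrite /cabs normc_def /= expr0n /= addr0 sqrtr_sqr. Qed.

Lemma rn_ge0 x : 0 <= rn x.
Proof. by rewrite -ler0c -rnE. Qed.

Lemma rn0 : rn 0 = 0.
Proof. by rewrite /rn normr0. Qed.

Lemma rnD x y : rn (x + y) <= rn x + rn y.
Proof. by rewrite -lecR rmorphD /= -!rnE ler_normD. Qed.

Lemma rnN x : rn (- x) = rn x.
Proof. by rewrite /rn normrN. Qed.

Lemma rnB x y : rn (x - y) <= rn x + rn y.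
Proof. by rewrite -(rnN y) rnD. Qed.

Lemma rnM x y : rn (x ** y) <= rn x * rn y.
Proof. by rewrite -lecR rmorphM /= -!rnE ler_norm_starmul. Qed.

Lemma rnZ k x : rn (k *: x) = cabs k * rn x.
Proof. by apply: complexI; rewrite rmorphM /= -!rnE -cabsE normrZ. Qed.

Lemma rn_star x : rn (star x) = rn x.
Proof. by rewrite /rn norm_star. Qed.

Lemma rn_cstar x : rn (star x ** x) = rn x ^+ 2.
Proof. by apply: complexI; rewrite rmorphXn /= -!rnE cstar_identity. Qed.

Lemma rn_eq0 x : rn x = 0 -> x = 0.
Proof. by move=> x0; apply/normr0_eq0; rewrite rnE x0. Qed.

Lemma rn_sum I (r : seq I) (P : pred I) (F : I -> A) :
  rn (\sum_(i <- r | P i) F i) <= \sum_(i <- r | P i) rn (F i).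
Proof.
elim/big_ind2: _ => [|x a y b xa yb|//]; first by rewrite rn0.
by rewrite (le_trans (rnD _ _))// lerD.
Qed.

End RealNorm.

(* Limits are handled by explicit rates: [e] bounds the distance of the tail of
   the sequence from its [n]-th term. *)
Lemma complete_rate (K : numFieldType) (V : completeNormedModType K)
    (u : nat -> V) (e : nat -> K) :
  (forall n m, (n <= m)%N -> `|u m - u n| <= e n) ->
  (forall d, 0 < d -> exists n, e n < d) ->
  exists l, forall n, `|l - u n| <= e n.
Proof.
move=> ue e0; have /cvg_ex[l ul] : cvg (u @ \oo).
  apply: cauchy_cvg; apply/cauchyP => d /e0[n en].
  exists (u n); exists n => // m nm.
  by rewrite -ball_normE /= distrC (le_lt_trans (ue _ _ nm)).
exists l => n; apply/ler_addgt0Pl => d d0.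
move/cvgrPdist_lt : ul => /(_ d d0)[m _ /= um].
pose p := maxn n m.
have -> : l - u n = (l - u p) + (u p - u n) by rewrite addrA subrK.
rewrite (le_trans (ler_normD _ _))// lerD//; last by rewrite ue// leq_maxl.
by rewrite ltW// um//= leq_maxr.
Qed.

Lemma rn_complete (R : realType) (A : cstarAlgType R) (u : nat -> A)
    (e : nat -> R) :
  (forall n m, (n <= m)%N -> rn (u m - u n) <= e n) ->
  (forall d, 0 < d -> exists n, e n < d) ->
  exists l, forall n, rn (l - u n) <= e n.
Proof.
move=> ue e0.
have [n m nm|d d0|l lu] := complete_rate (u := u) (e := fun n => (e n)%:C%C).
- by rewrite rnE lecR ue.
- have dR : d \is Num.real by apply: gtr0_real.
  have [|n en] := e0 (complex.Re d); first by rewrite -ltcR RRe_real.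
  by exists n; rewrite -(RRe_real dR) ltcR.
- by exists l => n; rewrite -lecR -rnE.
Qed.

Lemma Re_le_cabs (R : realType) (z : R[i]) : `|complex.Re z| <= cabs z.
Proof.
rewrite /cabs normc_def /= -sqrtr_sqr ler_wsqrtr// lerDl.
exact: sqr_ge0.
Qed.

Lemma Im_le_cabs (R : realType) (z : R[i]) : `|complex.Im z| <= cabs z.
Proof.
rewrite /cabs normc_def /= -sqrtr_sqr ler_wsqrtr// lerDr.
exact: sqr_ge0.
Qed.

Lemma cabs_le (R : realType) (z : R[i]) :
  cabs z <= `|complex.Re z| + `|complex.Im z|.
Proof.
rewrite /cabs normc_def /= -(ger0_norm (addr_ge0 (normr_ge0 _) (normr_ge0 _))).
rewrite -[leRHS]sqrtr_sqr ler_wsqrtr// sqrrD !real_normK ?num_real//.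
by rewrite -addrA lerD2l lerDr mulrn_wge0// mulr_ge0.
Qed.

(** Real and imaginary parts converge separately, each within [e n]; hence the factor 2. *)
Lemma cabs_complete (R : realType) (u : nat -> R[i]) (e : nat -> R) :
  (forall n m, (n <= m)%N -> cabs (u m - u n) <= e n) ->
  (forall d, 0 < d -> exists n, e n < d) ->
  exists l, forall n, cabs (l - u n) <= 2 * e n.
Proof.
move=> ue e0.
have [n m nm|//|a au] := @complete_rate R R (fun n => complex.Re (u n)) e.
  by rewrite (le_trans _ (ue _ _ nm))// -raddfB Re_le_cabs.
have [n m nm|//|b bu] := @complete_rate R R (fun n => complex.Im (u n)) e.
  by rewrite (le_trans _ (ue _ _ nm))// -raddfB Im_le_cabs.
exists (a +i* b)%C => n; rewrite (le_trans (cabs_le _))// mulr2n mulrDl mul1r.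
by have := au n; have := bu n; case: (u n) => p q /= *; exact: lerD.
Qed.

Section StarRingSigns.
Variable V : starRingType.
Implicit Types x y z : V.

Lemma starmulNl x y : (- x) ** y = - (x ** y).
Proof. by apply: (addrI (x ** y)); rewrite -starmulDl !subrr starmul0l. Qed.
Lemma starmulNr x y : x ** (- y) = - (x ** y).
Proof. by apply: (addrI (x ** y)); rewrite -starmulDr !subrr starmul0r. Qed.
Lemma starmulBl x y z : (x - y) ** z = x ** z - y ** z.
Proof. by rewrite starmulDl starmulNl. Qed.
Lemma starmulBr x y z : x ** (y - z) = x ** y - x ** z.
Proof. by rewrite starmulDr starmulNr. Qed.
Lemma starN x : star (- x) = - star x.
Proof. by apply: (addrI (star x)); rewrite -starD !subrr star0. Qed.
Lemma starB x y : star (x - y) = star x - star y.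
Proof. by rewrite starD starN. Qed.

End StarRingSigns.

(** * Unitization *)

Definition unitz (R : realType) (A : cstarAlgType R) : Type := (R[i] * A)%type.

Section Unitization.
Variables (R : realType) (A : cstarAlgType R).
Local Notation U := (unitz A).
HB.instance Definition _ := GRing.Zmodule.copy U (R[i] * A)%type.

Definition umul (u v : U) : U :=
  (u.1 * v.1, u.1 *: v.2 + v.1 *: u.2 + u.2 ** v.2).
Definition ustar (u : U) : U := (u.1^*, star u.2).

Lemma unitzP (u v : U) : u.1 = v.1 -> u.2 = v.2 -> u = v.
Proof. by case: u v => [? ?] [? ?] /= -> ->. Qed.

Lemma unitzD1 (u v : U) : (u + v).1 = u.1 + v.1. Proof. by []. Qed.
Fact umulA : associative umul.
Proof.
move=> u v w; apply: unitzP; rewrite /= ?mulrA//.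
rewrite !scalerDr !starmulDr !starmulDl !scalerA !starmulZr !starmulZl starmulA.
rewrite !addrA; rewrite [w.1 * u.1]mulrC [w.1 * v.1]mulrC.
by congr (_ + _); rewrite [LHS](ACl (1*2*4*6*3*5)%AC).
Qed.
Fact umulDl : left_distributive umul +%R.
Proof.
move=> u v w; apply: unitzP; rewrite /= ?mulrDl//.
rewrite !scalerDr !scalerDl starmulDl.
by rewrite [LHS](AC (2*2*2)%AC ((1*3*5)*(2*4*6))%AC).
Qed.
Fact umulDr : right_distributive umul +%R.
Proof.
move=> u v w; apply: unitzP; rewrite /= ?mulrDr//.
rewrite !scalerDr !scalerDl starmulDr.
by rewrite [LHS](AC (2*2*2)%AC ((1*3*5)*(2*4*6))%AC).
Qed.
Fact ustarK : involutive ustar.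
Proof. by move=> u; apply: unitzP; rewrite /= ?conjCK ?starK. Qed.
Fact ustarD : {morph ustar : u v / u + v}.
Proof. by move=> u v; apply: unitzP; rewrite /= ?rmorphD ?starD. Qed.
Fact ustarM u v : ustar (umul u v) = umul (ustar v) (ustar u).
Proof.
apply: unitzP; rewrite /=; first by rewrite rmorphM mulrC.
by rewrite !starD !starZ starM (addrC (_ *: _)).
Qed.

HB.instance Definition _ := isStarRing.Build U umulA umulDl umulDr
  ustarK ustarD ustarM.

Definition sc (r : R) : U := (r%:C%C, 0).
Definition uin (a : A) : U := (0, a).

Lemma sc1l u : sc 1 ** u = u.
Proof. by apply: unitzP => /=; rewrite ?mul1r// scaler0 addr0 starmul0l addr0 scale1r. Qed.
Lemma sc1r u : u ** sc 1 = u.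
Proof. by apply: unitzP => /=; rewrite ?mulr1// scaler0 add0r starmul0r addr0 scale1r. Qed.

End Unitization.

(** These instances let the noncommutative ring tactic [ncr] prove polynomial identities. It needs a
    unit, so identities in [A] are first moved to the unitization by [uin_inj]. *)
#[global] Instance unitz_ops (R : realType) (A : cstarAlgType R) :
  @Ncring.Ring_ops (unitz A) 0 (sc A 1) +%R (@starmul _) (fun x y => x - y) -%R eq := {}.
#[global] Instance unitz_ring (R : realType) (A : cstarAlgType R) :
  @Ncring.Ring (unitz A) _ _ _ _ _ _ _ (unitz_ops A).
Proof.
split; try exact _; try (by move=> ? ? -> ? ? ->); try (by move=> ? ? ->).
- exact: add0r.
- exact: addrC.
- exact: addrA.
- exact: sc1l.
- exact: sc1r.
- exact: starmulA.
- exact: starmulDl.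
- by move=> x y z; exact: starmulDr.
- by [].
- exact: subrr.
Qed.

Lemma le0_small (R : realType) (x K : R) :
  (forall e, 0 < e -> x <= K * e) -> x <= 0.
Proof.
move=> h; apply/ler_addgt0Pl => e e0; rewrite addr0.
have K0 : 0 < `|K| + 1 by rewrite ltr_wpDl.
rewrite (le_trans (h (e / (`|K| + 1)) _)) ?divr_gt0// mulrCA ler_piMr ?(ltW e0)//.
by rewrite ler_pdivrMr// mul1r (le_trans (ler_norm _))// lerDl.
Qed.

Section UnitzAction.
Variables (R : realType) (A : cstarAlgType R).
Local Notation U := (unitz A).
Implicit Types (u v : U) (x y z : A).

Definition act u y : A := u.1 *: y + u.2 ** y.
(* [un] is equivalent to the norm of the unitization, but not a C*-norm; it only
   serves to pass to limits. *)
Definition un u : R := cabs u.1 + rn u.2.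

Lemma act_uin x y : act (uin x) y = x ** y.
Proof. by rewrite /act scale0r add0r. Qed.

Lemma act_sc r y : act (sc A r) y = r%:C%C *: y.
Proof. by rewrite /act starmul0l addr0. Qed.

Lemma actM u v y : act (u ** v) y = act u (act v y).
Proof.
rewrite /act /= !starmulDl scalerDr starmulDr !starmulZl starmulZr.
by rewrite scalerA starmulA !addrA.
Qed.

Lemma actDl u v y : act (u + v) y = act u y + act v y.
Proof. by rewrite /act /= scalerDl starmulDl addrACA. Qed.

Lemma actNl u y : act (- u) y = - act u y.
Proof.
by apply: (addrI (act u y)); rewrite -actDl !subrr /act /= scale0r starmul0l addr0.
Qed.

Lemma actDr u y z : act u (y + z) = act u y + act u z.
Proof. by rewrite /act scalerDr starmulDr addrACA. Qed.

Lemma act0r u : act u 0 = 0.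
Proof. by rewrite /act scaler0 starmul0r addr0. Qed.

Lemma act_adj u y z : star (act u y) ** z = star y ** act (star u) z.
Proof.
by rewrite /act /= starD starZ starM starmulDl starmulDr starmulZl starmulZr starmulA.
Qed.

Lemma act_sum I (r : seq I) (P : pred I) (F : I -> A) u :
  act u (\sum_(i <- r | P i) F i) = \sum_(i <- r | P i) act u (F i).
Proof. exact: (big_morph _ (actDr u) (act0r u)). Qed.

Lemma act_suml I (r : seq I) (P : pred I) (F : I -> U) y :
  act (\sum_(i <- r | P i) F i) y = \sum_(i <- r | P i) act (F i) y.
Proof.
apply: (big_morph (fun u => act u y)) => [u v|]; first exact: actDl.
by rewrite /act scale0r starmul0l addr0.
Qed.

Lemma unitz_sum1 I (r : seq I) (P : pred I) (F : I -> U) :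
  (\sum_(i <- r | P i) F i).1 = \sum_(i <- r | P i) (F i).1.
Proof. by elim/big_rec2: _ => // i a b _ <-. Qed.

Lemma un_ge0 u : 0 <= un u.
Proof. by rewrite addr_ge0// ?cabs_ge0 ?rn_ge0. Qed.

Lemma un0 : un 0 = 0.
Proof. by rewrite /un cabs0 rn0 addr0. Qed.

Lemma unD u v : un (u + v) <= un u + un v.
Proof. by rewrite /un addrACA lerD// ?cabsD ?rnD. Qed.

Lemma unN u : un (- u) = un u.
Proof. by rewrite /un cabsN rnN. Qed.

Lemma un_star u : un (star u) = un u.
Proof. by rewrite /un /= cabs_conj rn_star. Qed.

Lemma unM u v : un (u ** v) <= un u * un v.
Proof.
rewrite /un /= cabsM mulrDl !mulrDr -!addrA lerD2l.
rewrite addrA [leRHS]addrA (le_trans (rnD _ _))// lerD ?rnM//.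
by rewrite (le_trans (rnD _ _))// !rnZ [rn _ * _]mulrC.
Qed.

Lemma un_eq0 u : un u = 0 -> u = 0.
Proof.
move=> /eqP; rewrite paddr_eq0 ?cabs_ge0 ?rn_ge0// => /andP[/eqP u1 /eqP u2].
by apply: unitzP; [exact: cabs_eq0|exact: rn_eq0].
Qed.

Lemma rn_act u y : rn (act u y) <= un u * rn y.
Proof.
by rewrite /act mulrDl (le_trans (rnD _ _))// lerD ?rnM// rnZ.
Qed.

(** Testing on [y = star x] and using the C*-identity recovers the norm of [x] from its action. *)
Lemma rn_le_mul x c : 0 <= c -> (forall y, rn (x ** y) <= c * rn y) -> rn x <= c.
Proof.
move=> c0 h; have [->//|x0] := eqVneq (rn x) 0.
have xp : 0 < rn x by rewrite lt_def x0 rn_ge0.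
have := h (star x); rewrite -{1}[x]starK rn_cstar rn_star expr2.
by rewrite ler_pM2r.
Qed.

End UnitzAction.

(** * The Hilbert module [A^m] and matrices over the unitization *)

Section HilbertModule.
Variables (R : realType) (A : cstarAlgType R) (I : finType).
Implicit Types x y : I -> A.

Definition ip x y : A := \sum_i star (x i) ** y i.
(** The norm of the Hilbert module. Its triangle inequality must wait for Cauchy-Schwarz, which
    itself depends on square roots in the case of one coordinate. *)
Definition hn x : R := Num.sqrt (rn (ip x x)).

Lemma hn_ge0 x : 0 <= hn x. Proof. exact: sqrtr_ge0. Qed.

Lemma hnE x : rn (ip x x) = hn x ^+ 2.
Proof. by rewrite sqr_sqrtr// rn_ge0. Qed.

End HilbertModule.

Section MatrixAction.
Variables (R : realType) (A : cstarAlgType R) (m : nat).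
Local Notation U := (unitz A).
Local Notation M := ('M[unitz A]_m).
Implicit Types (P Q : M) (x y : 'I_m -> A).

Definition mact P x : 'I_m -> A := fun i => \sum_j act (P i j) (x j).
(** A crude entrywise norm, submultiplicative and complete, used only to pass to limits; the sharp
    bounds are carried by [opn]. *)
Definition mn P : R := \sum_i \sum_j un (P i j).

Lemma mactM P Q x : mact (P ** Q) x = mact P (mact Q x).
Proof.
apply: funext => i; rewrite /mact.
under eq_bigr do rewrite mxE act_suml.
under [RHS]eq_bigr do rewrite act_sum.
rewrite exchange_big; apply: eq_bigr => l _; apply: eq_bigr => j _.
by rewrite actM.
Qed.

Lemma mactDl P Q x : mact (P + Q) x = (fun i => mact P x i + mact Q x i).
Proof.
apply: funext => i; rewrite /mact -big_split; apply: eq_bigr => j _.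
by rewrite mxE actDl.
Qed.

Lemma mn_ge0 P : 0 <= mn P.
Proof. by apply: sumr_ge0 => i _; apply: sumr_ge0 => j _; exact: un_ge0. Qed.

Lemma mnD P Q : mn (P + Q) <= mn P + mn Q.
Proof.
rewrite /mn -big_split ler_sum// => i _; rewrite -big_split ler_sum// => j _.
by rewrite mxE unD.
Qed.

Lemma mnN P : mn (- P) = mn P.
Proof. by apply: eq_bigr => i _; apply: eq_bigr => j _; rewrite mxE unN. Qed.

Lemma mn_star P : mn (star P) = mn P.
Proof.
rewrite /mn exchange_big; apply: eq_bigr => i _; apply: eq_bigr => j _.
by rewrite mxE un_star.
Qed.

Lemma un_sum I (r : seq I) (F : I -> U) :
  un (\sum_(i <- r) F i) <= \sum_(i <- r) un (F i).
Proof.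
elim/big_ind2: _ => [|u a v b ua vb|//]; first by rewrite un0.
by rewrite (le_trans (unD _ _))// lerD.
Qed.

Lemma un_le_mn P i j : un (P i j) <= mn P.
Proof.
rewrite /mn (bigD1 i)//= (bigD1 j)//= -addrA lerDl addr_ge0//.
  by apply: sumr_ge0 => ? _; exact: un_ge0.
by apply: sumr_ge0 => ? _; apply: sumr_ge0 => ? _; exact: un_ge0.
Qed.

Lemma mnM P Q : mn (P ** Q) <= mn P * mn Q.
Proof.
rewrite /mn mulr_suml ler_sum// => i _.
apply: (@le_trans _ _ (\sum_j \sum_l un (P i l) * un (Q l j))).
  rewrite ler_sum// => j _; rewrite mxE (le_trans (un_sum _ _))// ler_sum// => l _.
  exact: unM.
rewrite exchange_big mulr_suml ler_sum// => l _; rewrite -mulr_sumr ler_wpM2l ?un_ge0//.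
rewrite [leRHS](bigD1 l)//= lerDl; apply: sumr_ge0 => ? _.
by apply: sumr_ge0 => ? _; exact: un_ge0.
Qed.

Lemma mn_eq0 P : mn P = 0 -> P = 0.
Proof.
move=> P0; apply/matrixP => i j; rewrite mxE; apply: un_eq0.
by apply/eqP; rewrite eq_le un_ge0 -P0 un_le_mn.
Qed.

Lemma mn_small0 P K : (forall e, 0 < e -> mn P <= K * e) -> P = 0.
Proof.
by move=> h; apply: mn_eq0; apply/eqP; rewrite eq_le mn_ge0 (le0_small h).
Qed.

Lemma hn_le_sum x : hn x <= \sum_i rn (x i).
Proof.
have s0 : 0 <= \sum_i rn (x i) by apply: sumr_ge0 => i _; exact: rn_ge0.
rewrite -(ger0_norm s0) -sqrtr_sqr ler_wsqrtr// (le_trans (rn_sum _ _ _))//.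
rewrite expr2 mulr_suml ler_sum// => i _; rewrite rn_cstar expr2.
rewrite ler_wpM2l ?rn_ge0// [leRHS](bigD1 i)//= lerDl.
by apply: sumr_ge0 => ? _; exact: rn_ge0.
Qed.

Lemma hn_mact_le P x : hn (mact P x) <= mn P * \sum_i rn (x i).
Proof.
rewrite (le_trans (hn_le_sum _))// /mn mulr_suml ler_sum// => i _.
rewrite (le_trans (rn_sum _ _ _))// mulr_suml ler_sum// => j _.
rewrite (le_trans (rn_act _ _))// ler_wpM2l ?un_ge0// [leRHS](bigD1 j)//= lerDl.
by apply: sumr_ge0 => ? _; exact: rn_ge0.
Qed.

(** The constant counts [m * m] entries, each costing 2 for the complex part and 1 for the part in
    [A]. *)
Lemma mn_complete (u : nat -> M) (e : nat -> R) :
  (forall n k, (n <= k)%N -> mn (u k - u n) <= e n) ->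
  (forall d, 0 < d -> exists n, e n < d) ->
  exists l, forall n, mn (l - u n) <= (m * m * 3)%:R * e n.
Proof.
move=> ue e0.
have h i j : exists l : U, forall n, un (l - u n i j) <= 3 * e n.
  have ij n k : (n <= k)%N -> un (u k i j - u n i j) <= e n.
    move=> nk; rewrite (le_trans _ (ue _ _ nk))//.
    by have := un_le_mn (u k - u n) i j; rewrite !mxE.
  have [n k nk|//|a ha] := @cabs_complete R (fun n => (u n i j).1) e.
    by rewrite (le_trans _ (ij _ _ nk))// lerDl rn_ge0.
  have [n k nk|//|b hb] := @rn_complete R A (fun n => (u n i j).2) e.
    by rewrite (le_trans _ (ij _ _ nk))// lerDr cabs_ge0.
  exists (a, b) => n; rewrite /un/=.
  have -> : 3 * e n = 2 * e n + e n by rewrite -[X in _ + X]mul1r -mulrDl natr1.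
  by rewrite lerD.
pose l : M := \matrix_(i, j) projT1 (cid (h i j)).
exists l => n.
have lE i j : un ((l - u n) i j) <= 3 * e n.
  by rewrite !mxE; exact: (projT2 (cid (h i j))).
rewrite /mn (le_trans (ler_sum _ (fun i _ => ler_sum _ (fun j _ => lE i j))))//.
by rewrite !sumr_const !card_ord -mulrnA -[leLHS]mulr_natl mulrA -natrM.
Qed.

End MatrixAction.

(** * Square roots *)

Section MatrixSqrt.
Variables (R : realType) (A : cstarAlgType R) (m : nat).
Local Notation U := (unitz A).
Local Notation M := ('M[unitz A]_m).
Implicit Types (P Q : M) (x y : 'I_m -> A).
(* These two facts are obvious for [m = 1], which is the case that yields the
   order structure of [A]; the general case follows from the latter. *)
Hypothesis hn_tri : forall x y, hn (fun i => x i + y i) <= hn x + hn y.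
Hypothesis hn_coord : forall x i, rn (x i) <= hn x.

(* A bound on the operator norm.  The scalar part is recorded separately, since
   the action on [A] does not determine it when [A] is unital. *)
Definition opn P (c : R) :=
  (exists2 l : R[i], cabs l <= c & forall i j, (P i j).1 = if i == j then l else 0) /\
  forall x, hn (mact P x) <= c * hn x.

Lemma opn0 : opn 0 0.
Proof.
split; first by exists 0; [rewrite cabs0|move=> i j; rewrite mxE if_same].
move=> x; rewrite mul0r (le_trans (hn_mact_le _ _))//.
by rewrite /mn big1 ?mul0r// => i _; rewrite big1// => j _; rewrite mxE un0.
Qed.

Lemma opnD P Q c d : opn P c -> opn Q d -> opn (P + Q) (c + d).
Proof.
move=> [[l lc Pl] Pc] [[k kd Qk] Qd]; split.
  exists (l + k); first by rewrite (le_trans (cabsD _ _))// lerD.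
  by move=> i j; rewrite mxE unitzD1 Pl Qk; case: eqP; rewrite ?addr0.
move=> x; rewrite mactDl (le_trans (hn_tri _ _))// mulrDl lerD//.
Qed.

Lemma opnM P Q c d : 0 <= c -> opn P c -> opn Q d -> opn (P ** Q) (c * d).
Proof.
move=> c0 [[l lc Pl] Pc] [[k kd Qk] Qd]; split.
  exists (l * k); first by rewrite cabsM ler_pM// cabs_ge0.
  move=> i j; rewrite mxE.
  rewrite unitz_sum1.
  rewrite (bigD1 i)//= Pl Qk eqxx big1 ?addr0; last first.
    by move=> h hi; rewrite Pl eq_sym (negPf hi) mul0r.
  by case: eqP; rewrite ?mulr0.
move=> x; rewrite mactM (le_trans (Pc _))// -mulrA ler_wpM2l//.
Qed.

(** Vectors with a single nonzero entry isolate the entries of [P]. The [A]-part of an entry is its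
    action minus its scalar part, which costs [2 * c]; the scalar part adds another [c]. *)
Lemma opn_mn P c : 0 <= c -> opn P c -> mn P <= (m * m * 3)%:R * c.
Proof.
move=> c0 [[l lc Pl] Pc].
have P1 i j : cabs (P i j).1 <= c by rewrite Pl; case: eqP; rewrite ?cabs0.
have P2 i j : rn (P i j).2 <= 2 * c.
  apply: rn_le_mul => [|y]; first by rewrite mulr_ge0.
  pose x k := if k == j then y else 0.
  have xy : hn x = rn y.
    rewrite /hn /ip (bigD1 j)//= big1 ?addr0; last first.
      by move=> k /negPf kj; rewrite /x kj starmul0r.
    by rewrite /x eqxx rn_cstar sqrtr_sqr ger0_norm ?rn_ge0.
  have Px : mact P x i = act (P i j) y.
    rewrite /mact (bigD1 j)//= big1 ?addr0 /x ?eqxx//.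
    by move=> k /negPf ->; rewrite act0r.
  have -> : (P i j).2 ** y = mact P x i - (P i j).1 *: y.
    by rewrite Px /act addrAC subrr add0r.
  rewrite (le_trans (rnB _ _))// mulrDl mul1r mulrDl lerD//.
    by rewrite (le_trans (hn_coord _ _))// -xy.
  by rewrite rnZ ler_wpM2r ?rn_ge0.
have lE i j : un (P i j) <= 3 * c.
  by rewrite /un -natr1 addrC mulrDl mul1r lerD.
rewrite /mn (le_trans (ler_sum _ (fun i _ => ler_sum _ (fun j _ => lE i j))))//.
by rewrite !sumr_const !card_ord -mulrnA -[leLHS]mulr_natl mulrA -natrM.
Qed.

(* A solution of [V = X + V^2] is a square root [1 - 2 V] of [1 - 4 X].  The
   iterates and their differences are dominated by those of [a = 1/4 + a^2]. *)
Variable X : M.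
Hypothesis X_opn : opn X 4^-1.

Fixpoint sq_iter n : M := if n is n'.+1 then X + sq_iter n' ** sq_iter n' else 0.
Fixpoint sq_bound n : R :=
  if n is n'.+1 then 4^-1 + sq_bound n' ^+ 2 else 0.
Let v := sq_iter.
Let a := sq_bound.

Lemma sq_bound_itv n : 0 <= a n <= 2^-1.
Proof. by elim: n => [|n /andP[IH1 IH2]]; apply/andP; split => //=; nra. Qed.

Lemma sq_bound_le n : a n <= a n.+1.
Proof. by rewrite /=; have := sqr_ge0 (a n - 2^-1); rewrite -/a; nra. Qed.

Lemma sq_bound_homo n k : (n <= k)%N -> a n <= a k.
Proof.
elim: k => [|k IH]; first by rewrite leqn0 => /eqP ->.
rewrite leq_eqVlt => /orP[/eqP ->//|/IH nk].
by rewrite (le_trans nk)// sq_bound_le.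
Qed.

(** The deficit [d = 1/2 - a n] evolves by [d (1 - d)], so convergence is only of order [1/n]. This
    slow critical case cannot be avoided by shrinking the bound [1/4], since roots of non-invertible
    elements [1 - 4 X] are wanted. *)
Lemma sq_bound_rate n : 2^-1 - a n <= n.+2%:R^-1.
Proof.
elim: n => [|n IH]; first by rewrite subr0.
have /andP[a0 a1] := sq_bound_itv n; rewrite [a n.+1]/= -/(a n).
have n2 : 0 < n.+2%:R :> R by []. have n3 : 0 < n.+3%:R :> R by [].
set d := 2^-1 - a n in IH *.
have -> : 2^-1 - (4^-1 + a n ^+ 2) = d * (1 - d) by rewrite /d; field.
have d2 : 0 <= d <= 2^-1 by rewrite /d; apply/andP; split; lra.
have i2 : n.+2%:R^-1 <= 2^-1 :> R by rewrite lef_pV2 ?posrE// ler_nat.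
(* The function [d (1 - d)] increases on [[0, 1/2]], and for [N = n + 2] one has
   [(N - 1) / N^2 <= 1 / (N + 1)]. *)
apply: (@le_trans _ _ (n.+2%:R^-1 * (1 - n.+2%:R^-1))).
  by move: IH d2 i2; set q := n.+2%:R^-1 => IH /andP[? ?] ?; nra.
rewrite -[n.+3%:R]natr1.
have : n.+2%:R * n.+2%:R^-1 = 1 :> R by rewrite mulfV// gt_eqF.
have : n.+2%:R^-1 > 0 :> R by rewrite invr_gt0.
move: i2; set q := n.+2%:R^-1; set N := n.+2%:R => i2 q0 Nq.
have N1 : 0 < N + 1 by rewrite addr_gt0.
rewrite -[leRHS]mul1r ler_pdivlMr//; nra.
Qed.

Lemma sq_iter_opn n : opn (v n) (a n).
Proof.
elim: n => [|n IH]; first exact: opn0.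
by apply: opnD => //; rewrite expr2; apply: opnM => //; case/andP: (sq_bound_itv n).
Qed.

(** The identity [p^2 - q^2 = p (p - q) + (p - q) q] needs no commutation, so applying it to the
    matrices and to the scalar bounds alike propagates the domination of increments. *)
Lemma sq_iter_step n : opn (v n.+1 - v n) (a n.+1 - a n).
Proof.
elim: n => [|n IH].
  by rewrite subr0 subr0 /=; rewrite -/(v 0) starmul0r addr0 expr0n addr0.
have /andP[a0 _] := sq_bound_itv n; have /andP[a1 _] := sq_bound_itv n.+1.
have -> : v n.+2 - v n.+1 = v n.+1 ** (v n.+1 - v n) + (v n.+1 - v n) ** v n.
  rewrite [v n.+2]/= {2}[v n.+1]/= -/v opprD addrACA subrr add0r.
  by rewrite starmulBr starmulBl addrA subrK.
have -> : a n.+2 - a n.+1 = a n.+1 * (a n.+1 - a n) + (a n.+1 - a n) * a n.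
  have E1 : a n.+1 = 4^-1 + a n ^+ 2 by [].
  have -> : a n.+2 = 4^-1 + a n.+1 ^+ 2 by [].
  by move: E1; move: (a n.+1) (a n) => p q E1; rewrite [X in _ - X = _]E1; ring.
apply: opnD; first by apply: opnM => //; exact: sq_iter_opn.
by apply: opnM => //; [rewrite subr_ge0 sq_bound_le|exact: sq_iter_opn].
Qed.

Lemma sq_iter_diff n k : (n <= k)%N -> opn (v k - v n) (a k - a n).
Proof.
elim: k => [|k IH]; first by rewrite leqn0 => /eqP ->; rewrite !subrr; exact: opn0.
rewrite leq_eqVlt => /orP[/eqP ->|nk]; first by rewrite !subrr; exact: opn0.
have -> : v k.+1 - v n = (v k.+1 - v k) + (v k - v n) by rewrite addrA subrK.
have -> : a k.+1 - a n = (a k.+1 - a k) + (a k - a n) by rewrite addrA subrK.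
by apply: opnD; [exact: sq_iter_step|exact: IH].
Qed.

Lemma invS_small (d : R) : 0 < d -> exists n, n.+2%:R^-1 < d.
Proof.
move=> d0; have di : 0 <= d^-1 by rewrite invr_ge0 ltW.
have := archi_boundP di; set n := Num.bound _ => dn.
exists n; rewrite invf_plt ?posrE// (lt_trans dn)// ltr_nat.
by rewrite ltnS leqnSn.
Qed.

(** The increments of the iterates are dominated by those of [a], whose tail after [n] is at most
    [1/2 - a n]. The last clause says that [V] commutes with whatever commutes with [X]; later it
    replaces functional calculus. *)
Lemma matrix_quadratic_root : star X = X ->
  exists V : M, [/\ V = X + V ** V, star V = V, opn V 2^-1 &
    forall C : M, C ** X = X ** C -> C ** V = V ** C].
Proof.
move=> X_sa; pose K : R := (m * m * 3)%:R.
have K0 : 0 <= K by [].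
have vv n k : (n <= k)%N -> mn (v k - v n) <= K * n.+2%:R^-1.
  move=> nk; have /andP[_ ak] := sq_bound_itv k.
  rewrite (le_trans (opn_mn _ (sq_iter_diff nk))) ?subr_ge0//.
    exact: sq_bound_homo.
  by rewrite ler_wpM2l// (le_trans _ (sq_bound_rate n))// lerD2r.
have [|V VE] := mn_complete vv.
  move=> d d0; have Kp : 0 < K + 1 by rewrite ltr_wpDl.
  have [|n nd] := @invS_small (d / (K + 1)); first by rewrite divr_gt0.
  exists n; rewrite (@le_lt_trans _ _ ((K + 1) * n.+2%:R^-1))//.
    by rewrite ler_wpM2r// lerDl.
  by rewrite mulrC -ltr_pdivlMr.
(* One factor [K] comes from [opn_mn], the other from [mn_complete]. Two consecutive iterates are
   controlled because the recursion links [v n.+1] to [v n]. *)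
have {}VE e : 0 < e -> exists n, mn (V - v n) <= K * K * e /\ mn (V - v n.+1) <= K * K * e.
  move=> e0; have [n ne] := invS_small e0; exists n; split.
    by rewrite (le_trans (VE n))// mulrA ler_wpM2l ?mulr_ge0// ltW.
  rewrite (le_trans (VE n.+1))// mulrA ler_wpM2l ?mulr_ge0// (le_trans _ (ltW ne))//.
  by rewrite lef_pV2 ?posrE// ler_nat.
have vC C : C ** X = X ** C -> forall n, C ** v n = v n ** C.
  move=> CX; elim=> [|n IH]; first by rewrite starmul0l starmul0r.
  by rewrite /= -/(v n) starmulDr starmulDl CX starmulA IH -starmulA IH starmulA.
have vS n : star (v n) = v n.
  by elim: n => [|n IH]; rewrite /= ?star0// starD starM X_sa -/(v n) IH.
exists V; split.
- apply/eqP; rewrite -subr_eq0; apply/eqP.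
  apply: (@mn_small0 _ _ _ _ (K * K * (1 + mn V + K))) => e /VE[n [Vn Vn1]].
  (* The three terms on the right account for the summands [1], [mn V] and [K] of the constant
     above. *)
  have -> : V - (X + V ** V) =
      (V - v n.+1) - (V ** (V - v n) + (V - v n) ** v n).
    rewrite [v n.+1]/= -/v starmulBr starmulBl addrA subrK opprB !opprD addrA.
    by rewrite [RHS](AC (1*2*2)%AC ((1*2*5)*(3*4))%AC) /= addNr addr0.
  have vK : mn (v n) <= K.
    have /andP[a0 a1] := sq_bound_itv n.
    rewrite (le_trans (opn_mn a0 (sq_iter_opn n)))// ler_piMr// (le_trans a1)//.
    by rewrite invf_le1// ler1n.
  rewrite (le_trans (mnD _ _))// mnN mulrAC mulrDr mulrDr mulr1 -addrA lerD//.
  rewrite (le_trans (mnD _ _))// lerD// (le_trans (mnM _ _))//.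
    by rewrite mulrC ler_wpM2r ?mn_ge0.
  by rewrite ler_pM ?mn_ge0.
- apply/eqP; rewrite -subr_eq0; apply/eqP.
  apply: (@mn_small0 _ _ _ _ (K * K * 2)) => e /VE[n [Vn _]].
  have -> : star V - V = star (V - v n) - (V - v n).
    by rewrite starB vS opprB addrA subrK.
  rewrite (le_trans (mnD _ _))// mnN mn_star mulrAC mulr_natr mulr2n lerD//.
- have nV n x : hn (mact V x) <= hn (mact (V - v n) x) + hn (mact (v n) x).
    by rewrite -{1}[V](subrK (v n)) mactDl; exact: hn_tri.
  split; last first.
    move=> x; rewrite -subr_le0.
    apply: (@le0_small _ _ (K * K * \sum_i rn (x i))) => e /VE[n [Vn _]].
    rewrite lerBlDr (le_trans (nV n x))// lerD//.
      rewrite (le_trans (hn_mact_le _ _))// mulrAC ler_wpM2r//.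
      by apply: sumr_ge0 => ? _; exact: rn_ge0.
    rewrite (le_trans ((sq_iter_opn n).2 x))// ler_wpM2r ?hn_ge0//.
    by case/andP: (sq_bound_itv n).
  have Vl n i j : cabs ((V i j).1 - (v n i j).1) <= mn (V - v n).
    rewrite (le_trans _ (un_le_mn _ i j))// !mxE /un /= lerDl rn_ge0//.
  have z0 (z : R[i]) L : (forall e, 0 < e -> cabs z <= L * e) -> z = 0.
    move=> /le0_small z0; apply: cabs_eq0; apply/eqP.
    by rewrite eq_le z0 cabs_ge0.
  (* For [m = 0] there is no diagonal entry to provide the scalar, and 0 serves. *)
  have [i0|no] := pselect (exists i : 'I_m, True); last first.
    by exists 0; [rewrite cabs0|move=> i; exfalso; apply: no; exists i].
  case: i0 => i0 _; exists (V i0 i0).1.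
    rewrite -subr_le0; apply: (@le0_small _ _ (K * K)) => e /VE[n [Vn _]].
    rewrite lerBlDr -[(V i0 i0).1](subrK (v n i0 i0).1) (le_trans (cabsD _ _))//.
    rewrite lerD ?(le_trans (Vl _ _ _))//.
    have [[l lc ->] _] := sq_iter_opn n; rewrite eqxx (le_trans lc)//.
    by case/andP: (sq_bound_itv n).
  move=> i j; case: eqP => [->|ij].
    apply/eqP; rewrite -subr_eq0; apply/eqP.
    apply: (z0 _ (K * K * 2)) => e /VE[n [Vn _]].
    have [[l lc lE] _] := sq_iter_opn n.
    have -> : (V j j).1 - (V i0 i0).1 =
        ((V j j).1 - (v n j j).1) - ((V i0 i0).1 - (v n i0 i0).1).
      by rewrite !lE !eqxx opprB addrA subrK.
    rewrite (le_trans (cabsD _ _))// cabsN mulrAC mulr_natr mulr2n.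
    by rewrite lerD// (le_trans (Vl _ _ _)).
  apply: (z0 _ (K * K)) => e /VE[n [Vn _]].
  rewrite -[(V i j).1]subr0 (le_trans _ Vn)// (le_trans _ (Vl n i j))//.
  by have [[l lc ->] _] := sq_iter_opn n; case: eqP.
- move=> C CX; apply/eqP; rewrite -subr_eq0; apply/eqP.
  apply: (@mn_small0 _ _ _ _ (K * K * (2 * mn C))) => e /VE[n [Vn _]].
  have -> : C ** V - V ** C = C ** (V - v n) - (V - v n) ** C.
    by rewrite starmulBr starmulBl vC// opprB addrA subrK.
  rewrite (le_trans (mnD _ _))// mnN.
  rewrite (le_trans (lerD (mnM _ _) (mnM _ _)))//.
  by have := ler_wpM2r (mn_ge0 C) Vn; lra.
Qed.

End MatrixSqrt.

Ltac ncr := Ncring_tac.non_commutative_ring.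

Section UnitzScalars.
Variables (R : realType) (A : cstarAlgType R).
Local Notation U := (unitz A).
Local Notation sc := (sc A).
Implicit Types (u v : U) (x y z : A) (r s : R).

Lemma scC r u : sc r ** u = u ** sc r.
Proof.
by apply: unitzP; rewrite /= ?scaler0 ?starmul0l ?starmul0r ?addr0 ?add0r// mulrC.
Qed.
Lemma scM r s : sc (r * s) = sc r ** sc s.
Proof.
by apply: unitzP; rewrite /= ?rmorphM// !scaler0 starmul0l !addr0.
Qed.
Lemma scD r s : sc (r + s) = sc r + sc s.
Proof. by apply: unitzP; rewrite /= ?rmorphD// addr0. Qed.
Lemma sc_star r : star (sc r) = sc r.
Proof. by apply: unitzP; rewrite /= ?star0// conj_Creal// complex_real. Qed.

Lemma uinD x y : uin (x + y) = uin x + uin y.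
Proof. by apply: unitzP; rewrite //= addr0. Qed.
Lemma uinN x : uin (- x) = - uin x.
Proof. by apply: unitzP; rewrite //= oppr0. Qed.
Lemma uinM x y : uin (x ** y) = uin x ** uin y.
Proof. by apply: unitzP; rewrite /= ?mulr0// !scale0r !add0r. Qed.
Lemma uin_star x : uin (star x) = star (uin x).
Proof. by apply: unitzP; rewrite //= conjC0. Qed.
Lemma uinZ r x : uin (r%:C%C *: x) = sc r ** uin x.
Proof.
by apply: unitzP; rewrite /= ?mulr0// starmul0l scaler0 !addr0.
Qed.
Lemma uin_inj : injective (@uin R A).
Proof. by move=> x y []. Qed.

Definition bnd u (c : R) := cabs u.1 <= c /\ forall y, rn (act u y) <= c * rn y.

Lemma bnd_ge0 u c : bnd u c -> 0 <= c.
Proof. by case=> h _; apply: le_trans h; exact: cabs_ge0. Qed.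

Lemma bndD u v c d : bnd u c -> bnd v d -> bnd (u + v) (c + d).
Proof.
move=> [u1 uc] [v1 vd]; split.
  by rewrite (le_trans (cabsD _ _))// lerD.
by move=> y; rewrite actDl mulrDl (le_trans (rnD _ _))// lerD.
Qed.

Lemma bndM u v c d : bnd u c -> bnd v d -> bnd (u ** v) (c * d).
Proof.
move=> /[dup] /bnd_ge0 c0 [u1 uc] [v1 vd]; split.
  by rewrite cabsM ler_pM ?cabs_ge0.
by move=> y; rewrite actM (le_trans (uc _))// -mulrA ler_wpM2l.
Qed.

Lemma bnd_sc r : 0 <= r -> bnd (sc r) r.
Proof.
by move=> /ger0_norm r0; split=> [|y]; rewrite ?act_sc ?rnZ cabs_real r0.
Qed.

Lemma bnd_le u c d : c <= d -> bnd u c -> bnd u d.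
Proof.
move=> cd [u1 uc]; split; first exact: le_trans cd.
by move=> y; rewrite (le_trans (uc y))// ler_wpM2r ?rn_ge0.
Qed.

Lemma bnd_uin x c : rn x <= c -> bnd (uin x) c.
Proof.
move=> xc; split; first by rewrite cabs0 (le_trans _ xc)// rn_ge0.
by move=> y; rewrite act_uin (le_trans (rnM _ _))// ler_wpM2r ?rn_ge0.
Qed.

Lemma hn_tri1 (x y : 'I_1 -> A) : hn (fun i => x i + y i) <= hn x + hn y.
Proof.
have hE (z : 'I_1 -> A) : hn z = rn (z ord0).
  by rewrite /hn /ip big_ord1 rn_cstar sqrtr_sqr ger0_norm ?rn_ge0.
by rewrite !hE rnD.
Qed.

Lemma hn_coord1 (x : 'I_1 -> A) i : rn (x i) <= hn x.
Proof.
by rewrite /hn /ip big_ord1 rn_cstar sqrtr_sqr ger0_norm ?rn_ge0// (ord1 i).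
Qed.

Lemma hn1 (z : 'I_1 -> A) : hn z = rn (z ord0).
Proof. by rewrite /hn /ip big_ord1 rn_cstar sqrtr_sqr ger0_norm ?rn_ge0. Qed.

Lemma quadratic_root u : bnd u 4^-1 -> star u = u ->
  exists v, [/\ v = u + v ** v, star v = v, bnd v 2^-1 &
    forall c, c ** u = u ** c -> c ** v = v ** c].
Proof.
move=> [u1 uc] u_sa; pose e w : 'M[U]_1 := const_mx w.
have eM a b : e a ** e b = e (a ** b).
  by apply/matrixP => i j; rewrite !mxE big_ord1 !mxE.
have eE (B : 'M[U]_1) : B = e (B ord0 ord0).
  by apply/matrixP => i j; rewrite !mxE !ord1.
have eactE w (y : 'I_1 -> A) : mact (e w) y = fun=> act w (y ord0).
  by apply: funext => i; rewrite /mact big_ord1 mxE.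
have [||V [VE V_sa [[l lc lE] Vc] VC]] :=
    matrix_quadratic_root hn_tri1 hn_coord1 (X := e u).
- split; first by exists u.1 => // i j; rewrite !mxE !ord1 eqxx.
  by move=> y; rewrite !hn1 eactE.
- by apply/matrixP => i j; rewrite !mxE u_sa.
rewrite (eE V) in VE V_sa Vc VC; set v := V _ _ in VE V_sa Vc VC.
exists v; split.
- by have /matrixP/(_ ord0 ord0) := VE; rewrite eM !mxE.
- by have /matrixP/(_ ord0 ord0) := V_sa; rewrite !mxE.
- split; first by rewrite lE eqxx.
  by move=> y; have := Vc (fun=> y); rewrite !hn1 eactE.
- move=> c cu; have := VC (e c); rewrite !eM cu => /(_ erefl) /matrixP/(_ ord0 ord0).
  by rewrite !mxE.
Qed.

(* Positivity, expressed without the spectrum: [|t - u| <= t] for some [t]. *)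
Definition upos u := star u = u /\ exists2 t, 0 < t & bnd (sc t - u) t.

(** Write [u = t (1 - 4 X)] with [X = (t - u) / (4 t)], of size at most [1/4]; the root is
    [sqrt t (1 - 2 V)]. It is positive because [2 V] has size at most 1. *)
Lemma upos_sqrt u : upos u -> exists d, [/\ star d = d, d ** d = u, upos d &
  forall c, c ** u = u ** c -> c ** d = d ** c].
Proof.
move=> [u_sa [t t0 ut]]; pose q := (4 * t)^-1.
have q0 : 0 < q by rewrite invr_gt0 mulr_gt0.
have sa1 : star (sc t - u) = sc t - u by rewrite starB sc_star u_sa.
have [||v [vE v_sa vb vC]] := @quadratic_root (sc q ** (sc t - u)).
- have -> : 4^-1 = q * t by rewrite /q; field; rewrite gt_eqF.
  by apply: bndM => //; apply: bnd_sc; exact: ltW.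
- by rewrite starM sa1 sc_star scC.
pose s := Num.sqrt t; have s0 : 0 < s by rewrite sqrtr_gt0.
pose d := sc s ** (sc 1 - v - v); exists d; split.
- by rewrite /d starM !starB !sc_star v_sa -scC.
- have -> : d ** d = sc t ** ((sc 1 - v - v) ** (sc 1 - v - v)).
    rewrite /d {2}[sc s ** _]scC starmulA -[sc s ** _ ** (_ - v)]starmulA -scC.
    by rewrite starmulA -scM -expr2 sqr_sqrtr// ltW.
  have -> : (sc 1 - v - v) ** (sc 1 - v - v) = sc 1 - sc 4 ** (v - v ** v).
    have -> : 4 = 1 + 1 + 1 + 1 :> R by ring.
    by rewrite !scD !starmulDl !sc1l; ncr.
  have -> : v - v ** v = sc q ** (sc t - u) by rewrite {1}vE addrK.
  rewrite starmulBr sc1r !starmulA -!scM.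
  have -> : t * 4 * q = 1 by rewrite /q; field; rewrite gt_eqF.
  by rewrite sc1l subKr.
- split; first by rewrite /d starM !starB !sc_star v_sa -scC.
  exists s => //; have -> : sc s - d = sc s ** (v + v).
    rewrite /d -{1}[sc s]sc1r -starmulBr; congr (_ ** _); ncr.
  apply: (@bnd_le _ (s * (2^-1 + 2^-1))); first by rewrite le_eqVlt; apply/orP; left; apply/eqP; field.
  by apply: bndM; [apply: bnd_sc; exact: ltW|exact: bndD].
- move=> c cu; have cv : c ** v = v ** c.
    apply: vC; rewrite starmulA -scC -!starmulA; congr (_ ** _).
    by rewrite starmulBl starmulBr cu scC.
  rewrite /d starmulA -scC -!starmulA; congr (_ ** _).
  by rewrite !starmulBr !starmulBl cv scC.
Qed.

End UnitzScalars.

(** * Positive elements *)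

Section Positivity.
Variables (R : realType) (A : cstarAlgType R).
Local Notation U := (unitz A).
Local Notation sc := (sc A).
Implicit Types (u v : U) (x y z a b k : A) (r s : R).

Lemma rn_act_adj u y : rn (act u y) ^+ 2 = rn (star y ** act (star u ** u) y).
Proof. by rewrite -rn_cstar act_adj actM. Qed.

(* [c + i e] and [c - i e] are multiples of unitaries. *)
Lemma rn_act_cos (c e : U) t y : star c = c -> star e = e ->
  c ** e = e ** c -> c ** c + e ** e = sc t -> rn (act c y) ^+ 2 <= `|t| * rn y ^+ 2.
Proof.
move=> cS eS ce cet; pose j : U := ('i, 0).
have jS : star j = - j by apply: unitzP; rewrite /= ?star0 ?oppr0// conjCi.
have jC u : j ** u = u ** j.
  by apply: unitzP; rewrite /= ?scaler0 ?starmul0l ?starmul0r ?addr0 ?add0r// mulrC.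
have jj : j ** j = - sc 1.
  by apply: unitzP; rewrite /= ?scaler0 ?starmul0l ?addr0 ?oppr0// -expr2 sqrCi.
have w2 (d : U) : star d = d -> c ** d = d ** c -> d ** d = e ** e ->
    rn (act (c + j ** d) y) ^+ 2 = `|t| * rn y ^+ 2.
  move=> dS cd de; rewrite rn_act_adj.
  have -> : star (c + j ** d) ** (c + j ** d) = sc t.
    rewrite starD starM cS dS jS starmulNr -jC -cet -de.
    rewrite starmulBl !starmulDr.
    have -> : c ** (j ** d) = j ** d ** c by rewrite !starmulA -jC -!starmulA cd.
    have -> : j ** d ** (j ** d) = - (d ** d).
      by rewrite -starmulA [d ** _]starmulA -jC !starmulA jj starmulNl sc1l starmulNl.
    by ncr.
  by rewrite act_sc starmulZr rnZ cabs_real rn_cstar.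
have p2 := w2 e eS ce erefl.
have q2 : rn (act (c - j ** e) y) ^+ 2 = `|t| * rn y ^+ 2.
  rewrite -starmulNr; apply: w2; rewrite ?starN ?eS ?starmulNr ?starmulNl ?opprK//.
  by rewrite ce.
have h : 2 * rn (act c y) <= rn (act (c + j ** e) y) + rn (act (c - j ** e) y).
  have -> : 2 * rn (act c y) = rn (act c y + act c y).
    rewrite -[act c y + _]scale1r scalerDr -scalerDl rnZ.
    by rewrite -[1 + 1]/(2%:R) -(rmorph_nat (real_complex R)) cabs_real normr_nat.
  rewrite (le_trans _ (rnD _ _))// -[in leRHS]actDl.
  rewrite (_ : c + j ** e + (c - j ** e) = c + c); last by ncr.
  by rewrite actDl.
have z0 := rn_ge0 (act c y).
have a0 := rn_ge0 (act (c + j ** e) y); have b0 := rn_ge0 (act (c - j ** e) y).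
move: h p2 q2 z0 a0 b0; set T := `|t| * _; set z := rn (act c y).
set p := rn (act (c + _) y); set q := rn (act (c - _) y) => h p2 q2 z0 p0 q0.
have : (2 * z) ^+ 2 <= (p + q) ^+ 2 by rewrite ler_pXn2r ?nnegrE ?mulr_ge0 ?addr_ge0.
have := sqr_ge0 (p - q); nra.
Qed.

Definition posA x := upos (uin x).

Lemma posA_star a : posA a -> star a = a.
Proof. by case=> + _; rewrite -uin_star => /uin_inj. Qed.

(** The root found in the unitization lies in [A]: its scalar part has square 0. *)
Lemma posA_sqrt a : posA a -> exists k, [/\ star k = k, k ** k = a, posA k &
  forall c : U, c ** uin a = uin a ** c -> c ** uin k = uin k ** c].
Proof.
move=> /upos_sqrt[d [dS dd dp dC]].
have d1 : d.1 = 0.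
  have : (d ** d).1 = 0 by rewrite dd.
  by move=> /= /eqP; rewrite mulf_eq0 orbb => /eqP.
have dE : d = uin d.2 by apply: unitzP.
exists d.2; split.
- by apply: uin_inj; rewrite uin_star -dE.
- by apply: uin_inj; rewrite uinM -dE.
- by rewrite /posA -dE.
- by rewrite -dE.
Qed.

Lemma uposZ r u : 0 < r -> upos u -> upos (sc r ** u).
Proof.
move=> r0 [uS [t t0 tu]]; split; first by rewrite starM uS sc_star scC.
exists (r * t); first by rewrite mulr_gt0.
by rewrite scM -starmulBr; apply: bndM => //; apply: bnd_sc; exact: ltW.
Qed.

Lemma uposD u v : upos u -> upos v -> upos (u + v).
Proof.
move=> [uS [t t0 tu]] [vS [s s0 sv]]; split; first by rewrite starD uS vS.
exists (t + s); first by rewrite addr_gt0.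
by rewrite scD opprD addrACA; apply: bndD.
Qed.

Lemma posA0 : posA 0.
Proof.
split; first by rewrite -uin_star star0.
by exists 1 => //; rewrite subr0; apply: bnd_sc.
Qed.

Lemma posAD a b : posA a -> posA b -> posA (a + b).
Proof. by rewrite /posA uinD; exact: uposD. Qed.

Lemma posAZ r a : 0 <= r -> posA a -> posA (r%:C%C *: a).
Proof.
rewrite le_eqVlt => /orP[/eqP <-|r0]; first by rewrite scale0r => _; exact: posA0.
by rewrite /posA uinZ; exact: uposZ.
Qed.

(** Rescale [k] to a contraction [h] and build a root [e] of [1 - h^2]. It commutes with [h] and
    [h^2 + e^2 = 1], so [rn_act_cos] bounds [e], hence also [1 - h^2 = e^2], by 1. *)
Lemma posA_sq k : star k = k -> posA (k ** k).
Proof.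
move=> kS; pose t := rn k + 1; have t0 : 0 < t by rewrite ltr_wpDl ?rn_ge0.
pose h := (t^-1)%:C%C *: k.
have hS : star h = h.
  rewrite /h starZ kS; congr (_ *: _).
  by have := congr1 fst (sc_star A t^-1).
have h1 : rn h <= 1.
  by rewrite rnZ cabs_real gtr0_norm ?invr_gt0// ler_pdivrMl// mulr1 lerDl.
have hh1 : rn (h ** h) <= 1.
  by rewrite (le_trans (rnM _ _))// mulr_ile1 ?rn_ge0.
have [||v [vE vS vb vC]] := @quadratic_root _ _ (sc 4^-1 ** uin (h ** h)).
- rewrite -[X in bnd _ X]mulr1; apply: bndM; first exact: bnd_sc.
  exact: bnd_uin.
- by rewrite starM sc_star -uin_star starM hS scC.
have v1 : v.1 = 0.
  have := congr1 fst vE; rewrite /= mulr0 add0r => v2.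
  have [//|v10] := eqVneq v.1 0.
  have v11 : v.1 = 1 by apply: (mulfI v10); rewrite -v2 mulr1.
  case: vb => + _; rewrite v11 (cabs_real 1) normr1 leNgt invf_lt1 ?ltr1n//.
pose e := sc 1 - v - v.
have eS : star e = e by rewrite /e !starB sc_star vS.
have hv : uin h ** v = v ** uin h.
  by apply: vC; rewrite uinM starmulA -scC -!starmulA.
have ee : uin h ** uin h + e ** e = sc 1.
  have -> : e ** e = sc 1 - sc 4 ** (v - v ** v).
    have -> : 4 = 1 + 1 + 1 + 1 :> R by ring.
    by rewrite /e !scD !starmulDl !sc1l; ncr.
  have -> : v - v ** v = sc 4^-1 ** uin (h ** h) by rewrite {1}vE addrK.
  by rewrite starmulA -scM mulfV// sc1l uinM addrC subrK.
have eb : bnd e 1.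
  split; first by rewrite /e /= v1 !subr0 cabs_real normr1.
  move=> y; rewrite mul1r.
  have := @rn_act_cos e (uin h) 1 y eS; rewrite -uin_star hS addrC ee normr1 mul1r.
  rewrite ler_pXn2r ?nnegrE ?rn_ge0//; apply => //.
  by rewrite /e !starmulBl !starmulBr hv sc1l sc1r.
have -> : k ** k = (t ^+ 2)%:C%C *: (h ** h).
  rewrite /h starmulZl starmulZr !scalerA -!rmorphM /= -[LHS]scale1r.
  congr (_%:C%C *: _); field; exact: lt0r_neq0.
apply: posAZ; first exact: sqr_ge0.
split; first by rewrite -uin_star starM hS.
exists 1 => //; have -> : sc 1 - uin (h ** h) = e ** e.
  by rewrite -ee uinM addrAC subrr add0r.
by rewrite -[X in bnd _ X]mulr1; apply: bndM.
Qed.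

(** For [t] above the norm of [a + b], the element [t - a] is positive. The roots [k] of [a] and [e]
    of [t - a] commute with [k^2 + e^2 = t], so [rn_act_cos] bounds the norm of [k] by [sqrt t]. *)
Lemma posA_rn_le a b : posA a -> posA b -> rn a <= rn (a + b).
Proof.
move=> ap bp; apply/ler_addgt0Pl => d d0; set t := d + _.
have t0 : 0 < t by rewrite ltr_wpDr ?rn_ge0.
have [k [kS kk _ kC]] := posA_sqrt ap.
have [|e [eS ee _ eC]] := @upos_sqrt _ _ (sc t - uin a).
  split; first by rewrite starB sc_star -uin_star (posA_star ap).
  case: bp => _ [s s0 sb]; exists (t + s); first by rewrite addr_gt0.
  have -> : sc (t + s) - (sc t - uin a) = uin (a + b) + (sc s - uin b).
    by rewrite scD uinD; ncr.
  by apply: bndD => //; apply: bnd_uin; rewrite lerDr ltW.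
have ke : uin k ** e = e ** uin k.
  apply: eC; rewrite starmulBl starmulBr scC; congr (_ - _).
  by rewrite -!uinM -kk starmulA.
have kb y : rn (k ** y) <= Num.sqrt t * rn y.
  have := @rn_act_cos (uin k) e t y _ eS ke; rewrite -uin_star kS act_uin.
  rewrite -uinM kk ee addrC subrK gtr0_norm// => /(_ erefl erefl).
  rewrite -{1}(sqr_sqrtr (ltW t0)) -exprMn ler_pXn2r ?nnegrE ?rn_ge0//.
  by rewrite mulr_ge0 ?rn_ge0 ?sqrtr_ge0.
have {}kb : rn k <= Num.sqrt t by apply: rn_le_mul => //; exact: sqrtr_ge0.
rewrite -kk (le_trans (rnM _ _))// -(sqr_sqrtr (ltW t0)) expr2 ler_pM ?rn_ge0//.
Qed.

Lemma posA_anti a : posA a -> posA (- a) -> a = 0.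
Proof.
move=> ap an; apply: rn_eq0; apply/eqP; rewrite eq_le rn_ge0 andbT.
by have := posA_rn_le ap an; rewrite subrr rn0.
Qed.

Lemma posA_half a : posA (a + a) -> posA a.
Proof.
move=> /(@posAZ 2^-1 _ _); have -> : (2^-1)%:C%C *: (a + a) = a.
  rewrite -[a in a + a]scale1r -scalerDl scalerA -[X in _ *: X]scale1r scalerA.
  rewrite mulr1 -(rmorph1 (real_complex R)) -rmorphD -rmorphM.
  by rewrite (_ : 2^-1 * (1 + 1) = 1) ?scale1r//; field.
by apply; rewrite invr_ge0.
Qed.

(** With the self-adjoint [p = z + star z] and [q = i (z - star z)] one has
    [z ** star z = (p^2 + q^2) / 2 + k^2], a combination of squares. *)
Lemma posA_flip z k : star k = k -> star z ** z = - (k ** k) ->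
  posA (z ** star z).
Proof.
move=> kS zk; pose p := z + star z; pose q := 'i *: (z - star z).
have pS : star p = p by rewrite /p starD starK addrC.
have qS : star q = q by rewrite /q starZ conjCi starB starK scaleNr -scalerN opprB.
apply: posA_half.
have -> : z ** star z + z ** star z =
    2^-1%:C%C *: (p ** p + q ** q + p ** p + q ** q) + (k ** k + k ** k).
  have -> : k ** k = - (star z ** z) by rewrite zk opprK.
  rewrite /q starmulZl starmulZr scalerA -expr2 sqrCi scaleN1r.
  have -> : p ** p - (z - star z) ** (z - star z) + p ** p
      - (z - star z) ** (z - star z) =
      (z ** star z + star z ** z + z ** star z + star z ** z) + 
      (z ** star z + star z ** z + z ** star z + star z ** z).
    by apply: uin_inj; rewrite /p !(uinD, uinN, uinM); ncr.
  rewrite -[X in _ *: X]scale1r scalerDr -scalerDl scalerA.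
  have -> : (2^-1)%:C%C * (1 + 1) = 1 :> R[i].
    rewrite -(rmorph1 (real_complex R)) -rmorphD -rmorphM.
    by rewrite (_ : 2^-1 * (1 + 1) = 1)//; field.
  by rewrite scale1r; apply: uin_inj; rewrite !(uinD, uinN, uinM); ncr.
apply: posAD; last by apply: posAD; exact: posA_sq.
apply: posAZ; first by rewrite invr_ge0.
by do ?apply: posAD; exact: posA_sq.
Qed.

(** Applied to [z k] with root [k^2], [posA_flip] shows that [z k^2 z^* = - (z ** star z)^2] is
    positive. So is its negative, being the opposite square, hence both vanish. *)
Lemma star_sq_neg0 z k : star k = k -> star z ** z = - (k ** k) -> z = 0.
Proof.
move=> kS zk; have zzS : star (z ** star z) = z ** star z by rewrite starM starK.
have p2 : posA (z ** star z ** (z ** star z)) by exact: posA_sq.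
have q2 : posA (z ** k ** star (z ** k)).
  apply: (@posA_flip _ (k ** k)); first by rewrite starM kS.
  rewrite starM kS -starmulA [star z ** _]starmulA zk.
  by rewrite starmulNl starmulNr !starmulA.
have z2 : z ** star z ** (z ** star z) = 0.
  apply: posA_anti => //; rewrite starmulA -[_ ** star z ** z]starmulA zk.
  by rewrite starmulNr starmulNl opprK; rewrite starM kS !starmulA in q2 *.
have z1 : z ** star z = 0.
  apply: rn_eq0; apply/eqP; rewrite -sqrf_eq0 -rn_cstar zzS z2 rn0//.
apply: rn_eq0; apply/eqP; rewrite -sqrf_eq0 -rn_star -rn_cstar starK z1 rn0//.
Qed.

(* With [m = |h|] and [p = m - h], [x p] satisfies the hypothesis of
   [star_sq_neg0], since [p h p = - m p^2]. *)
Lemma posA_star_mul x : posA (star x ** x).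
Proof.
set h := star x ** x; have hS : star h = h by rewrite starM starK.
have [m [mS mm mp mC]] := posA_sqrt (posA_sq hS).
have [r [rS rr _ rC]] := posA_sqrt mp.
have mh : m ** h = h ** m.
  by apply: uin_inj; rewrite !uinM -mC// -!uinM starmulA.
have rh : r ** h = h ** r by apply: uin_inj; rewrite !uinM -rC// -!uinM mh.
have rm : r ** m = m ** r by rewrite -rr starmulA.
pose p := m - h; have pS : star p = p by rewrite starB mS hS.
have rp : r ** p = p ** r by rewrite starmulBr starmulBl rh rm.
have mp0 : m ** p = - (h ** p).
  by apply/eqP; rewrite -subr_eq0 opprK /p !starmulBr mm mh addrA subrK subrr.
have xp0 : x ** p = 0.
  apply: (@star_sq_neg0 _ (r ** p)); first by rewrite starM pS rS rp.
  rewrite starM pS -starmulA [star x ** _]starmulA -/h.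
  have -> : h ** p = - (m ** p) by rewrite mp0 opprK.
  by rewrite starmulNr -rr {1}rp -!starmulA.
have hp0 : h ** p = 0 by rewrite -starmulA xp0 starmul0r.
have pp : p ** p = 0 by rewrite {1}/p starmulBl mp0 hp0 oppr0 addr0.
have : p = 0.
  by apply: rn_eq0; apply/eqP; rewrite -sqrf_eq0 -rn_cstar pS pp rn0.
by move/eqP; rewrite subr_eq0 => /eqP <-.
Qed.

Lemma positiveP x : positive x <-> posA x.
Proof.
split=> [[b ->]|/posA_sqrt[k [kS <- _ _]]]; first exact: posA_star_mul.
by exists k; rewrite kS.
Qed.

End Positivity.

(** * The order of [A] and the Cauchy-Schwarz inequality *)

Section Order.
Variables (R : realType) (A : cstarAlgType R).
Implicit Types (x y z a b k : A) (r s t : R).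

Lemma conj_real r : (r%:C%C : R[i])^* = r%:C%C.
Proof. by rewrite conj_Creal// complex_real. Qed.

Lemma starZr r x : star (r%:C%C *: x) = r%:C%C *: star x.
Proof. by rewrite starZ conj_real. Qed.

Lemma scaler_realM r s x : r%:C%C *: (s%:C%C *: x) = (r * s)%:C%C *: x.
Proof. by rewrite scalerA -rmorphM. Qed.

Lemma rnZr r x : 0 <= r -> rn (r%:C%C *: x) = r * rn x.
Proof. by move=> r0; rewrite rnZ cabs_real ger0_norm. Qed.

Lemma pos0 : positive (0 : A).
Proof. by exists 0; rewrite starmul0r. Qed.

Lemma posD a b : positive a -> positive b -> positive (a + b).
Proof. by move=> /positiveP ? /positiveP ?; apply/positiveP; exact: posAD. Qed.

Lemma pos_sum I (q : seq I) (P : pred I) (F : I -> A) :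
  (forall i, P i -> positive (F i)) -> positive (\sum_(i <- q | P i) F i).
Proof. by move=> FP; elim/big_ind: _ => //; [exact: pos0|exact: posD]. Qed.

Lemma posZ r a : 0 <= r -> positive a -> positive (r%:C%C *: a).
Proof. by move=> ? /positiveP ?; apply/positiveP; exact: posAZ. Qed.

Lemma pos_star a : positive a -> star a = a.
Proof. by case=> b ->; rewrite starM starK. Qed.

Lemma pos_mul x : positive (star x ** x). Proof. by exists x. Qed.

Lemma pos_mulr x : positive (x ** star x).
Proof. by exists (star x); rewrite starK. Qed.

Lemma pos_conj a z : positive a -> positive (star z ** a ** z).
Proof. by case=> b ->; exists (b ** z); rewrite starM !starmulA. Qed.

Lemma pos_rn_le a b : positive a -> positive (b - a) -> rn a <= rn b.
Proof.
move=> /positiveP ap /positiveP bp.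
by have := posA_rn_le ap bp; rewrite addrC subrK.
Qed.

Lemma pos_sqrt a : positive a -> exists k, [/\ star k = k, k ** k = a &
  forall c, c ** a = a ** c -> c ** k = k ** c].
Proof.
move=> /positiveP/posA_sqrt[k [kS kk _ kC]]; exists k; split => // c ca.
by apply: uin_inj; rewrite !uinM kC// -!uinM ca.
Qed.

(** The root [d] of [t - a] exists only in the unitization, but [act d z] lies in [A] and its square
    is the wanted difference. *)
Lemma pos_sandwich a z t : star a = a -> rn a <= t ->
  positive (t%:C%C *: (star z ** z) - star z ** a ** z).
Proof.
move=> aS at_; have [t0|t0] := eqVneq t 0.
  have -> : a = 0 by apply: rn_eq0; apply/eqP; rewrite eq_le rn_ge0 -t0 at_.
  by rewrite t0 scale0r starmul0r starmul0l subr0; exact: pos0.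
have {}t0 : 0 < t by rewrite lt_def t0 (le_trans (rn_ge0 a)).
have [|d [dS dd _ _]] := @upos_sqrt _ _ (sc A t - uin a).
  split; first by rewrite starB sc_star -uin_star aS.
  by exists t => //; rewrite subKr; apply: bnd_uin.
exists (act d z).
by rewrite act_adj dS -actM dd actDl actNl act_sc act_uin starmulBr starmulZr starmulA.
Qed.

Section CauchySchwarz.
Variable I : finType.
Implicit Types X Y : I -> A.

Lemma ip_star X Y : star (ip X Y) = ip Y X.
Proof. by rewrite star_sum; apply: eq_bigr => i _; rewrite starM starK. Qed.

Lemma pos_ip X : positive (ip X X).
Proof. by apply: pos_sum => i _; exact: pos_mul. Qed.

(** Expand the positive [ip Z Z] for [Z = X s - t Y], add the positive gap between [t s^* s] and
    [s^* (ip X X) s], and divide by [t]. *)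
Lemma cauchy_schwarz_pos X Y t : 0 < t -> rn (ip X X) <= t ->
  positive (t%:C%C *: ip Y Y - star (ip X Y) ** ip X Y).
Proof.
move=> t0 Xt; set s := ip X Y.
pose Z i := X i ** s - t%:C%C *: Y i.
have ZE : ip Z Z = star s ** ip X X ** s - t%:C%C *: (star s ** s)
    - t%:C%C *: (star s ** s) + (t * t)%:C%C *: ip Y Y.
  have sE : star s ** s = \sum_i star s ** (star (X i) ** Y i).
    by rewrite -starmul_sumr.
  have sE' : star s ** s = \sum_i star (Y i) ** X i ** s.
    by rewrite [star s]ip_star /ip starmul_suml.
  rewrite {1}sE {1}sE' !scaler_sumr -!starmulA starmul_suml starmul_sumr.
  rewrite -!sumrB -big_split /=; apply: eq_bigr => i _.
  rewrite /Z starB starM starZr starmulBl !starmulBr !starmulZl !starmulZr scaler_realM.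
  by rewrite -!starmulA opprB addrA addrAC.
have : positive (t^-1%:C%C *:
    (ip Z Z + (t%:C%C *: (star s ** s) - star s ** ip X X ** s))).
  apply: posZ; first by rewrite invr_ge0 ltW.
  by apply: posD; [exact: pos_ip|apply: pos_sandwich => //; rewrite ip_star].
rewrite ZE; set p := star s ** ip X X ** s; set q := _ *: (star s ** s).
have -> : p - q - q + (t * t)%:C%C *: ip Y Y + (q - p) = (t * t)%:C%C *: ip Y Y - q.
  by apply: uin_inj; rewrite !(uinD, uinN); ncr.
rewrite scalerBr !scaler_realM mulrA mulVf ?gt_eqF// mul1r.
by rewrite scale1r.
Qed.

Lemma cauchy_schwarz X Y : rn (ip X Y) ^+ 2 <= rn (ip X X) * rn (ip Y Y).
Proof.
rewrite -subr_le0; apply: (@le0_small _ _ (rn (ip Y Y))) => e e0.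
have t0 : 0 < rn (ip X X) + e by rewrite ltr_wpDl ?rn_ge0.
have te : rn (ip X X) <= rn (ip X X) + e by rewrite lerDl ltW.
have /(pos_rn_le (pos_mul _)) := cauchy_schwarz_pos Y t0 te.
rewrite rn_cstar rnZr ?(ltW t0)// mulrDl.
by rewrite lerBlDr addrC [e * _]mulrC.
Qed.

Lemma hn_tri X Y : hn (fun i => X i + Y i) <= hn X + hn Y.
Proof.
rewrite -(@ler_pXn2r _ 2)// ?nnegrE ?addr_ge0 ?hn_ge0// -hnE.
have -> : ip (fun i => X i + Y i) (fun i => X i + Y i) =
    ip X X + ip X Y + (ip Y X + ip Y Y).
  rewrite -!big_split /=; apply: eq_bigr => i _.
  by rewrite starD starmulDl !starmulDr.
rewrite (le_trans (rnD _ _))// (le_trans (lerD (rnD _ _) (rnD _ _)))//.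
have XY : rn (ip X Y) <= hn X * hn Y.
  rewrite -(@ler_pXn2r _ 2)// ?nnegrE ?mulr_ge0 ?hn_ge0 ?rn_ge0//.
  by rewrite exprMn -!hnE cauchy_schwarz.
rewrite -(ip_star X Y) rn_star !hnE.
by move: XY; set p := rn _; set q := hn X; set r := hn Y; lra.
Qed.

Lemma hn_coord X i : rn (X i) <= hn X.
Proof.
rewrite -(@ler_pXn2r _ 2)// ?nnegrE ?hn_ge0 ?rn_ge0// -hnE -rn_cstar.
apply: pos_rn_le; first exact: pos_mul.
rewrite /ip (bigD1 i)//= addrAC subrr add0r.
by apply: pos_sum => j _; exact: pos_mul.
Qed.

End CauchySchwarz.
End Order.

Section MatrixUnit.
Variables (R : realType) (A : cstarAlgType R) (m : nat).

Definition mx1 : 'M[unitz A]_m := \matrix_(i, j) if i == j then sc A 1 else 0.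

Lemma mx1l (P : 'M[unitz A]_m) : mx1 ** P = P.
Proof.
apply/matrixP => i j; rewrite mxE (bigD1 i)//= big1 => [|k /negPf ki].
  by rewrite !mxE eqxx sc1l addr0.
by rewrite !mxE eq_sym ki starmul0l.
Qed.

Lemma mx1r (P : 'M[unitz A]_m) : P ** mx1 = P.
Proof.
apply/matrixP => i j; rewrite mxE (bigD1 j)//= big1 => [|k /negPf kj].
  by rewrite !mxE eqxx sc1r addr0.
by rewrite !mxE kj starmul0r.
Qed.

End MatrixUnit.

#[global] Instance unitz_mx_ops (R : realType) (A : cstarAlgType R) m :
  @Ncring.Ring_ops 'M[unitz A]_m 0 (mx1 A m) +%R (@starmul _)
    (fun x y => x - y) -%R eq := {}.
#[global] Instance unitz_mx_ring (R : realType) (A : cstarAlgType R) m :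
  @Ncring.Ring 'M[unitz A]_m _ _ _ _ _ _ _ (unitz_mx_ops A m).
Proof.
split; try exact _; try (by move=> ? ? -> ? ? ->); try (by move=> ? ? ->).
- exact: add0r.
- exact: addrC.
- exact: addrA.
- exact: mx1l.
- exact: mx1r.
- exact: starmulA.
- exact: starmulDl.
- by move=> x y z; exact: starmulDr.
- by [].
- exact: subrr.
Qed.

(** * Gram matrices are squares in [M_m(A)] *)

Section Gram.
Variables (R : realType) (A : cstarAlgType R) (m : nat) (I : finType).
Variable Y : I -> 'I_m -> A.

Let h p q : A := \sum_i star (Y i p) ** Y i q.
Let eta (x : 'I_m -> A) i : A := \sum_q Y i q ** x q.
Let z (x : 'I_m -> A) p : A := \sum_q h p q ** x q.
Let K : R := \sum_p rn (h p p) + 1.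

Let K_gt0 : 0 < K.
Proof. by rewrite ltr_wpDl// sumr_ge0// => p _; exact: rn_ge0. Qed.

Let zE x p : z x p = ip (Y ^~ p) (eta x).
Proof.
rewrite /z /ip /h /eta; under eq_bigr do rewrite starmul_suml.
under [RHS]eq_bigr do rewrite starmul_sumr.
rewrite exchange_big; apply: eq_bigr => i _; apply: eq_bigr => q _.
by rewrite starmulA.
Qed.

Let ip_z x : ip x (z x) = ip (eta x) (eta x).
Proof.
rewrite /ip; under eq_bigr do rewrite zE /ip starmul_sumr.
rewrite exchange_big; apply: eq_bigr => i _; rewrite {2}/eta star_sum starmul_suml.
by apply: eq_bigr => p _; rewrite starM starmulA.
Qed.

(** Coordinate [p] of [z] is the inner product of column [p] of [Y] with [eta x], so Cauchy-Schwarz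
    bounds it with the constant [rn (h p p)]; [K] is the sum of these constants, plus 1 to be
    nonzero. *)
Let z_le x : positive (K%:C%C *: ip (eta x) (eta x) - ip (z x) (z x)).
Proof.
have -> : K%:C%C *: ip (eta x) (eta x) - ip (z x) (z x) =
    \sum_p ((rn (h p p))%:C%C *: ip (eta x) (eta x) - star (z x p) ** z x p)
    + ip (eta x) (eta x).
  rewrite sumrB -scaler_suml addrAC -[X in _ + X + _]scale1r -scalerDl.
  by rewrite /K rmorphD rmorph_sum.
apply: posD; last exact: pos_ip.
apply: pos_sum => p _; rewrite zE.
have [h0|h0] := eqVneq (rn (h p p)) 0.
  have Y0 i : Y i p = 0.
    apply: rn_eq0; apply/eqP; rewrite eq_le rn_ge0 andbT.
    by rewrite (le_trans (hn_coord (Y^~ p) i))// /hn /ip [X in rn X]/= -/(h p p) h0 sqrtr0.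
  have -> : ip (Y^~ p) (eta x) = 0 by rewrite /ip big1// => i _; rewrite Y0 star0 starmul0l.
  by rewrite h0 scale0r starmul0r subr0; exact: pos0.
apply: cauchy_schwarz_pos => //.
by rewrite lt_def h0 rn_ge0.
Qed.

(** The matrix [X = 1/4 - q h] satisfies [1 - 4 X = h / K], whose root [W = 1 - 2 V] gives the
    square. It has size at most [1/4], since by [z_le] the quadratic term [q^2 ip z z] is at most
    [q/4] times [ip eta eta], while the cross terms remove [q/2] times it. *)
Lemma gram_positive : positive (\matrix_(p, q) h p q : 'M[A]_m).
Proof.
pose q : R := (4 * K)^-1.
have q0 : 0 < q by rewrite invr_gt0 mulr_gt0.
pose X : 'M[unitz A]_m := \matrix_(i, j)
  ((if i == j then sc A 4^-1 else 0) - sc A q ** uin (h i j)).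
have XE x : mact X x = fun i => 4^-1%:C%C *: x i - q%:C%C *: z x i.
  apply: funext => i; rewrite /mact /z scaler_sumr.
  under eq_bigr do rewrite mxE actDl actNl actM act_sc act_uin.
  rewrite sumrB; congr (_ - _); rewrite (bigD1 i)//= eqxx act_sc big1 ?addr0//.
  by move=> j; rewrite eq_sym => /negPf ->; rewrite /act scale0r starmul0l addr0.
have hS i j : star (h i j) = h j i.
  by rewrite star_sum; apply: eq_bigr => k _; rewrite starM starK.
have X_sa : star X = X.
  apply/matrixP => i j; rewrite !mxE starB starM -uin_star hS sc_star scC eq_sym.
  by case: eqP; rewrite ?sc_star ?star0.
have X_opn : opn X 4^-1.
  split.
    exists (4^-1)%:C%C; first by rewrite cabs_real ger0_norm.
    by move=> i j; rewrite mxE /=; case: eqP => _ /=; rewrite mulr0 subr0.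
  move=> x; rewrite -(@ler_pXn2r _ 2)// ?nnegrE ?mulr_ge0 ?hn_ge0//.
  rewrite exprMn -!hnE -rnZr ?sqr_ge0//; apply: pos_rn_le; first exact: pos_ip.
  have -> : ip (mact X x) (mact X x) = (4^-1 ^+ 2)%:C%C *: ip x x
      - (4^-1 * q)%:C%C *: ip (eta x) (eta x) - (4^-1 * q)%:C%C *: ip (eta x) (eta x)
      + (q * q)%:C%C *: ip (z x) (z x).
    rewrite -{1}ip_z -(pos_star (pos_ip (eta x))) -ip_z ip_star XE.
    rewrite /ip !scaler_sumr -!sumrB -big_split; apply: eq_bigr => i _ /=.
    rewrite starB !starZr starmulBl !starmulBr !starmulZl !starmulZr !scaler_realM.
    by rewrite opprB addrA addrAC [q * 4^-1]mulrC expr2.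
  set e := ip (eta x) (eta x); set w := ip (z x) (z x); set y := _ *: ip x x.
  have -> : y - (y - (4^-1 * q)%:C%C *: e - (4^-1 * q)%:C%C *: e + (q * q)%:C%C *: w)
     = (q * q)%:C%C *: (K%:C%C *: e - w) + (2^-1 * q - q * q * K)%:C%C *: e.
    rewrite rmorphB scalerBl scalerBr scaler_realM.
    have -> : 2^-1 * q = 4^-1 * q + 4^-1 * q by field.
    rewrite rmorphD scalerDl.
    by apply: uin_inj; rewrite !(uinD, uinN); ncr.
  apply: posD; apply: posZ; rewrite ?mulr_ge0 ?(ltW q0)//; first exact: z_le.
    have -> : q * q * K = 4^-1 * q by rewrite /q; field; rewrite gt_eqF.
    by rewrite -mulrBl mulr_ge0 ?(ltW q0)// subr_ge0 lef_pV2 ?posrE// ler_nat.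
  exact: pos_ip.
have [V [VE V_sa [[l lc Vl] _] _]] :=
  matrix_quadratic_root (@hn_tri _ _ _) (@hn_coord _ _ _) X_opn X_sa.
pose W := mx1 A m - V - V.
have W2 i j : (W ** W) i j = sc A K^-1 ** uin (h i j).
  have -> : W ** W = mx1 A m - (X + X + X + X).
    by have -> : X = V - V ** V; [rewrite {1}VE addrK|rewrite /W; ncr].
  rewrite !mxE; set d := sc A q ** _.
  have -> : sc A K^-1 ** uin (h i j) = d + d + d + d.
    rewrite -!starmulDl -!scD; congr (sc A _ ** _); rewrite /q; field.
    by rewrite gt_eqF.
  have -> : (if i == j then sc A 1 else 0) = (if i == j then sc A 4^-1 else 0) +
      (if i == j then sc A 4^-1 else 0) + (if i == j then sc A 4^-1 else 0) +
      (if i == j then sc A 4^-1 else 0).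
    case: eqP => _; rewrite ?addr0// -!scD; congr (sc A _); by field.

  ncr.
have W_sa i j : star (W i j) = W j i.
  have : star W = W.
    rewrite /W !starB V_sa; congr (_ - _ - _); apply/matrixP => a b.
    by rewrite !mxE eq_sym; case: eqP; rewrite ?star0 ?sc_star.
  by move=> /matrixP/(_ j i) <-; rewrite [RHS]mxE.
(* The scalar part of [W] is a multiple of the identity with square 0, so [W] has its entries in
   [A]. *)
have W1 i j : (W i j).1 = 0.
  have WE a b : (W a b).1 = if a == b then 1 - l - l else 0.
    by rewrite !mxE /= Vl; case: eqP => _ //=; rewrite !subr0.
  have [ij|ij] := eqVneq i j; last by rewrite WE (negPf ij).
  subst j; have := congr1 fst (W2 i i).
  rewrite mxE unitz_sum1 (bigD1 i)//= big1 ?addr0 => [|k ki].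
    by move=> /eqP; rewrite mulr0 mulf_eq0 orbb => /eqP.
  by rewrite WE eq_sym (negPf ki) mul0r.
have WA i j : W i j = uin (W i j).2 by apply: unitzP => //; rewrite W1.
clearbody W; pose s := Num.sqrt K.
exists (\matrix_(i, j) (s%:C%C *: (W i j).2)); apply/matrixP => i j; rewrite !mxE.
have -> : h i j = K%:C%C *: \sum_k (W i k).2 ** (W k j).2.
  have -> : \sum_k (W i k).2 ** (W k j).2 = (K^-1)%:C%C *: h i j.
    apply: uin_inj; rewrite uinZ -W2 mxE (big_morph _ (@uinD _ _) (erefl _)).
    by apply: eq_bigr => k _; rewrite uinM -!WA.
  by rewrite scaler_realM mulfV ?gt_eqF// scale1r.
rewrite scaler_sumr; apply: eq_bigr => k _; rewrite !mxE starZr starmulZl starmulZr.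
rewrite scaler_realM -expr2 sqr_sqrtr ?(ltW K_gt0)//; congr (_ *: (_ ** _)).
by apply: uin_inj; rewrite uin_star -!WA W_sa.
Qed.

End Gram.

(** * Approximate units *)

Section Damping.
Variables (R : realType) (A : cstarAlgType R) (k : A).
Implicit Types (x y z c : A) (i j n : nat).

(* [iter n damp y = (1 - k)^n y]. *)
Definition damp y : A := y - k ** y.
Definition damp_sum n : A := \sum_(i < n) iter i damp k.

Lemma dampM j y z : iter j damp (y ** z) = iter j damp y ** z.
Proof. by elim: j => //= j ->; rewrite /damp starmulBl starmulA. Qed.

Lemma dampD j y z : iter j damp (y + z) = iter j damp y + iter j damp z.
Proof. by elim: j => //= j ->; rewrite /damp starmulDr opprD addrACA. Qed.

Lemma dampZ j (r : R[i]) y : iter j damp (r *: y) = r *: iter j damp y.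
Proof. by elim: j => //= j ->; rewrite /damp starmulZr scalerBr. Qed.

Lemma dampB j y z : iter j damp (y - z) = iter j damp y - iter j damp z.
Proof. by rewrite dampD -scaleN1r dampZ scaleN1r. Qed.

Lemma damp_comm j c y : c ** k = k ** c -> iter j damp (c ** y) = c ** iter j damp y.
Proof.
by move=> ck; elim: j => //= j ->; rewrite /damp starmulBr !starmulA ck.
Qed.

Lemma damp_kl j y : k ** iter j damp y = iter j damp k ** y.
Proof. by rewrite -damp_comm// dampM. Qed.

(** Thus [damp_sum n] acts as [1 - (1 - k)^n], yet it is an element of [A]. *)
Lemma damp_sumE n y : iter n damp y = y - damp_sum n ** y.
Proof.
elim: n => [|n IH]; first by rewrite /damp_sum big_ord0 starmul0l subr0.
rewrite iterS {1}/damp damp_kl {1}IH /damp_sum big_ord_recr /= starmulDl opprD.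
by rewrite addrA.
Qed.

Hypothesis k_sa : star k = k.

Lemma damp_adj j y z : star (iter j damp y) ** z = star y ** iter j damp z.
Proof.
elim: j y z => // j IH y z; rewrite iterSr IH iterS /damp.
by rewrite starB starM k_sa starmulBl starmulBr starmulA.
Qed.

Lemma damp_comm_k j : iter j damp k ** k = k ** iter j damp k.
Proof. by rewrite damp_kl. Qed.

Lemma damp_star j : star (iter j damp k) = iter j damp k.
Proof.
elim: j => //= j IH; rewrite /damp starB starM IH k_sa.
by rewrite damp_comm_k.
Qed.

Lemma damp_sum_star n : star (damp_sum n) = damp_sum n.
Proof. by rewrite star_sum; apply: eq_bigr => i _; rewrite damp_star. Qed.

Hypothesis k_pos : positive k.
Hypothesis k_le1 : rn k <= 1.

Lemma pos_damp_conj y : positive (star y ** k ** y - star y ** k ** k ** y).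
Proof.
have [c [cS cc _]] := pos_sqrt k_pos.
have := pos_sandwich (c ** y) k_sa k_le1; rewrite scale1r !starM cS -!starmulA.
by congr positive; rewrite -cc !starmulA.
Qed.

(** Because [1 - (1 - k)^2 = k + (k - k^2)] is positive. *)
Lemma rn_damp j y : rn (iter j damp y) <= rn y.
Proof.
elim: j => //= j IH; apply: le_trans IH; move: (iter _ _ _) => {}y.
rewrite -(@ler_pXn2r _ 2)// ?nnegrE ?rn_ge0// -!rn_cstar.
apply: pos_rn_le; first exact: pos_mul.
have -> : star y ** y - star (damp y) ** damp y =
    star y ** k ** y + (star y ** k ** y - star y ** k ** k ** y).
  rewrite /damp starB starM k_sa; apply: uin_inj.
  by rewrite !(uinD, uinN, uinM); ncr.
by apply: posD; [exact: pos_conj|exact: pos_damp_conj].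
Qed.

(** Two factors [1 - k] can be put on both sides of a square commuting with [k]; induction in steps
    of two then starts from [k] and [k - k^2]. *)
Lemma pos_damp j : positive (iter j damp k).
Proof.
have step z : positive z -> z ** k = k ** z -> positive (iter 2 damp z).
  case=> b -> bk; exists (b - b ** k).
  have -> : star (b - b ** k) ** (b - b ** k) = star b ** b - star b ** b ** k
      - k ** (star b ** b) + k ** (star b ** b ** k).
    rewrite starB starM k_sa.
    by apply: uin_inj; rewrite !(uinD, uinN, uinM); ncr.
  rewrite bk /= /damp; set w := star b ** b.
  by apply: uin_inj; rewrite !(uinD, uinN, uinM); ncr.
have h : positive (iter j damp k) /\ positive (iter j.+1 damp k).
  elim: j => [|j [IH1 IH2]]; split => //=.
    have [c [cS cc _]] := pos_sqrt k_pos.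
    have := pos_sandwich c k_sa k_le1; rewrite scale1r cS cc.
    have -> : c ** k ** c = k ** k by rewrite -{2 3}cc -{1}cc !starmulA.
    by [].
  by apply: (step _ IH1); exact: damp_comm_k.
by case: h.
Qed.

Lemma pos_damp_sum n : positive (damp_sum n).
Proof. by apply: pos_sum => i _; exact: pos_damp. Qed.

Lemma pos_damp_decr j : positive (iter j damp k - iter j.+1 damp k).
Proof.
rewrite /= {2}/damp subKr; have [c [cS cc cC]] := pos_sqrt k_pos.
have ck : c ** k = k ** c by rewrite -cc starmulA.
have -> : k ** iter j damp k = star c ** iter j damp k ** c.
  by rewrite cS -!damp_comm// -dampM ck -[X in k ** X]cc starmulA.
by apply: pos_conj; exact: pos_damp.
Qed.

Lemma pos_damp_le i j : (i <= j)%N -> positive (iter i damp k - iter j damp k).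
Proof.
move=> ij; rewrite -(subnKC ij); elim: (j - i)%N => [|d IH].
  by rewrite addn0 subrr; exact: pos0.
have -> : iter i damp k - iter (i + d.+1) damp k =
   (iter i damp k - iter (i + d) damp k) +
   (iter (i + d) damp k - iter (i + d).+1 damp k) by rewrite addrA subrK addnS.
by apply: posD => //; exact: pos_damp_decr.
Qed.

(** The elements [(1 - k)^i k] decrease in [i], so [j + 1] copies of the last lie below their sum
    [1 - (1 - k)^(j+1)], whose norm is at most 2. *)
Lemma rn_damp_k j : rn (iter j damp k) <= 2 / j.+1%:R.
Proof.
rewrite ler_pdivlMr// mulrC.
have -> : j.+1%:R * rn (iter j damp k) = rn (j.+1%:R%:C%C *: iter j damp k).
  by rewrite rnZr.
apply: (@le_trans _ _ (rn (damp_sum j.+1))).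
  apply: pos_rn_le; first by apply: posZ => //; exact: pos_damp.
  have -> : j.+1%:R%:C%C *: iter j damp k = \sum_(i < j.+1) iter j damp k.
    by rewrite sumr_const card_ord rmorph_nat scaler_nat.
  rewrite /damp_sum -sumrB; by apply: pos_sum => i _; apply: pos_damp_le; rewrite -ltnS.
apply: rn_le_mul => // y.
have -> : damp_sum j.+1 ** y = y - iter j.+1 damp y by rewrite damp_sumE subKr.
by rewrite (le_trans (rnB _ _))// mulr2n mulrDl mul1r lerD2l rn_damp.
Qed.

End Damping.

Section ApproximateUnit.
Variables (R : realType) (A : cstarAlgType R).

(** For [k] the rescaled sum of all [Z_i^* Z_i] and [u = 1 - (1 - k)^n], the squares of the errors
    [Z_i (1 - u)] add up to [t (1 - k)^(2 n) k], which [rn_damp_k] makes small for all [i] at once.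
    The unit is [u = v v^*] with [v] its root. *)
Lemma approximate_unit (I : finType) (Z : I -> A) (e : R) : 0 < e ->
  exists v, [/\ star v = v, rn v <= 1 &
    forall i, rn (Z i - Z i ** (v ** star v)) <= e].
Proof.
move=> e0; pose k0 := ip Z Z; pose t := rn k0 + 1.
have t0 : 0 < t by rewrite ltr_wpDl ?rn_ge0.
pose k : A := (t^-1)%:C%C *: k0.
have kp : positive k by apply: posZ; [rewrite invr_ge0 ltW|exact: pos_ip].
have kS := pos_star kp.
have k1 : rn k <= 1.
  by rewrite rnZr ?invr_ge0 ?(ltW t0)// ler_pdivrMl// mulr1 /t lerDl.
pose l := Num.bound (t * 2 / e ^+ 2).
have lE : t * 2 / e ^+ 2 < l%:R.
  apply: archi_boundP; apply: divr_ge0; rewrite ?sqr_ge0 ?mulr_ge0 ?(ltW t0)//.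
(* An even exponent makes [1 - u] the square of [(1 - k)^l], whence [v] is a contraction. *)
set n := (l + l)%N.
pose u := damp_sum k n.
have [v [vS vv _]] := pos_sqrt (pos_damp_sum kS kp k1 n).
exists v; split => //.
  apply: rn_le_mul => // y; rewrite mul1r.
  rewrite -(@ler_pXn2r _ 2)// ?nnegrE ?rn_ge0// -!rn_cstar.
  apply: pos_rn_le; first exact: pos_mul.
  exists (iter l (damp k) y); rewrite damp_adj// -iterD -/n damp_sumE.
  by rewrite starmulBr -vv starM vS !starmulA.
move=> i; rewrite vS vv -/u.
have uS : star u = u by apply: damp_sum_star.
have ku : k ** u = u ** k.
  have : star (iter n (damp k) k) = iter n (damp k) k by exact: damp_star.
  by rewrite damp_sumE -/u starB starM kS uS => /addrI/oppr_inj.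
rewrite -(@ler_pXn2r _ 2)// ?nnegrE ?rn_ge0 ?(ltW e0)// -rn_cstar.
have sumE : ip (fun i => Z i - Z i ** u) (fun i => Z i - Z i ** u) =
    t%:C%C *: iter n (damp k) (iter n (damp k) k).
  have -> : t%:C%C *: iter n (damp k) (iter n (damp k) k) =
      k0 - u ** k0 - k0 ** u + u ** k0 ** u.
    rewrite -!dampZ /k scaler_realM mulfV ?gt_eqF// scale1r !damp_sumE -/u -[u ** k0 ** u]starmulA.
    have -> : k0 ** u = u ** k0.
      have -> : k0 = t%:C%C *: k by rewrite scaler_realM mulfV ?gt_eqF// scale1r.
      by rewrite starmulZl starmulZr ku.
    by apply: uin_inj; rewrite !(uinD, uinN, uinM); ncr.
  rewrite /k0 /ip starmul_suml starmul_sumr starmul_suml -!sumrB -big_split.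
  apply: eq_bigr => j _ /=; rewrite starB starM uS.
  by apply: uin_inj; rewrite !(uinD, uinN, uinM); ncr.
apply: (@le_trans _ _ (rn (ip (fun i => Z i - Z i ** u) (fun i => Z i - Z i ** u)))).
  apply: pos_rn_le; first exact: pos_mul.
  rewrite /ip [X in X - _](bigD1 i)//= addrAC subrr add0r.
  by apply: pos_sum => j _; exact: pos_mul.
rewrite sumE rnZr ?(ltW t0)// -iterD.
rewrite (le_trans (ler_wpM2l (ltW t0) (rn_damp_k kS kp k1 _)))// mulrA.
rewrite ler_pdivrMr// -ler_pdivrMl ?exprn_gt0// mulrC (le_trans (ltW lE))//.
by rewrite ler_nat; rewrite /n -!addnA leqW// leq_addr.
Qed.

End ApproximateUnit.

(** * Maps of order zero *)

Section CompletelyPositiveMaps.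
Variables (R : realType) (F A : cstarAlgType R) (phi : F -> A).
Hypothesis phi_cp : completely_positive phi.

(** Positivity of [phi] on 2 by 2 matrices, applied to the square of the row with entries [x] and
    [star c], turns these values into inner products of vectors over [A]. This does the work of a
    Stinespring dilation. *)
Lemma cp_gram2 (c x : F) : exists b1 b2 : 'I_2 -> A,
  [/\ phi (star x ** x) = ip b1 b1, phi (c ** x) = ip b2 b1 &
      phi (star x ** star c) = ip b1 b2].
Proof.
pose b : 'M[F]_2 := \matrix_(i, j)
  if i == ord0 then (if j == ord0 then x else star c) else 0.
have bE p q : (star b ** b) p q = star (b ord0 p) ** b ord0 q.
  by rewrite mxE big_ord_recl big_ord1 !mxE /= starmul0r addr0.
have [|y yE] := phi_cp.2 2%N (star b ** b); first by exists b.
have yP p q : phi (star (b ord0 p) ** b ord0 q) = ip (y ^~ p) (y ^~ q).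
  have /matrixP/(_ p q) := yE; rewrite mxE bE => ->.
  by rewrite mxE; apply: eq_bigr => i _; rewrite mxE.
have b0 : b ord0 ord0 = x by rewrite mxE.
have b1 : b ord0 (lift ord0 ord0) = star c by rewrite mxE.
exists (y ^~ ord0), (y ^~ (lift ord0 ord0)); rewrite -!yP b0 b1 starK.
by split.
Qed.

Lemma cp_starM (c x : F) : phi (star (c ** x)) = star (phi (c ** x)).
Proof.
by have [b1 [b2 [_ -> ]]] := cp_gram2 c x; rewrite starM ip_star => ->.
Qed.

(** The hypothesis makes the inner square of [b1 y] vanish, so [b1 y = 0], and [phi (c ** x) ** y]
    is the inner product of [b2] with [b1 y]. *)
Lemma cp_vanish (c x : F) (y : A) :
  phi (star x ** x) ** y = 0 -> phi (c ** x) ** y = 0.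
Proof.
have [b1 [b2 [-> -> _]]] := cp_gram2 c x => b0.
have b1y i : b1 i ** y = 0.
  apply: rn_eq0; apply/eqP; rewrite eq_le rn_ge0 andbT.
  rewrite (le_trans (hn_coord (fun i => b1 i ** y) i))// /hn.
  have -> : ip (fun i => b1 i ** y) (fun i => b1 i ** y) = star y ** (ip b1 b1 ** y).
    rewrite /ip starmul_suml starmul_sumr; apply: eq_bigr => k _.
    by rewrite starM !starmulA.
  by rewrite b0 starmul0r rn0 sqrtr0.
rewrite /ip starmul_suml big1// => i _.
by rewrite -starmulA b1y starmul0r.
Qed.

Lemma cp_pos (x : F) : positive x -> positive (phi x).
Proof.
case=> b ->; have [b1 [_ [-> _ _]]] := cp_gram2 b b; exact: pos_ip.
Qed.

End CompletelyPositiveMaps.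

Section MinimalProjections.
Variables (R : realType) (r : nat).
Local Notation C := R[i].
Local Notation M := 'M[C]_r.

(** Here [n.+1] is the squared length of [v]; lengths 1 and 2 occur below. If [p q = q], adjoints
    give [q p = q], so [q = p q p] is a multiple [a p] with [a^2 = a]. *)
Lemma rank_one_minimal (v : 'cV[C]_r) (w : 'rV[C]_r) (n : nat) :
  (forall i, w ord0 i = (v i ord0)^*) -> w *m v = n.+1%:R%:M ->
  minimal_projection (n.+1%:R^-1 *: (v *m w) : M).
Proof.
move=> wv wvn; set p : M := _ *: _.
have n0 : n.+1%:R != 0 :> C by rewrite pnatr_eq0.
have pS : star p = p.
  apply/matrixP => i j; rewrite !mxE !big_ord1 !wv.
  rewrite /star /= rmorphM /= fmorphV rmorph_nat rmorphM /= conjCK.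
  by congr (_ * _); rewrite mulrC.
have pp : p *m p = p.
  rewrite /p -scalemxAl -scalemxAr mulmxA -[v *m w *m v]mulmxA wvn.
  rewrite -scalemx1 -scalemxAr mulmx1 -scalemxAl scalerA mulVf// scale1r.
  by [].
have p0 : p <> 0.
  move=> p0; have : w *m p *m v = n.+1%:R%:M.
    rewrite /p -scalemxAr -scalemxAl !mulmxA wvn -mulmxA wvn.
    by rewrite mul_scalar_mx scale_scalar_mx scale_scalar_mx mulrA mulVf// mul1r.
  rewrite p0 mulmx0 mul0mx => /matrixP/(_ ord0 ord0).
  by rewrite !mxE eqxx mulr1n => /esym/eqP; rewrite (negPf n0).
split; first by split=> //; rewrite mx_starmulE.
  exact: p0.
move=> q [qS qq]; rewrite !mx_starmulE => pq.
have qp : q *m p = q.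
  have : star (p ** q) = star q by rewrite mx_starmulE pq.
  by rewrite starM qS pS mx_starmulE.
pose l := (w *m q *m v) ord0 ord0.
have qE : q = (l * n.+1%:R^-1) *: p.
  rewrite -{1}pq -{1}qp /p -!scalemxAl -!scalemxAr scalerA.
  rewrite !mulmxA -[v *m w *m q]mulmxA -[v *m (w *m q) *m v]mulmxA.
  have -> : w *m q *m v = l%:M by rewrite [LHS]mx11_scalar.
  rewrite mul_mx_scalar -scalemxAl !scalerA; congr (_ *: _).
  by rewrite -!mulrA [in RHS]mulrCA mulrA [RHS]mulrC.
set a := _ * _ in qE; have : (a * a - a) *: p = 0.
  rewrite scalerBl -qE -[X in _ - X]qq mx_starmulE qE.
  by rewrite -scalemxAl -scalemxAr pp [a *: (a *: p)]scalerA subrr.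
move/eqP; rewrite scaler_eq0 => /orP[|/eqP//].
rewrite -{3}[a]mulr1 -mulrBr mulf_eq0 subr_eq0 => /orP[]/eqP a0.
  by left; rewrite qE a0 scale0r.
by right; rewrite qE a0 scale1r.
Qed.

End MinimalProjections.

Section OrderZero.
Variables (R : realType) (F A : cstarAlgType R) (phi : F -> A).
Hypothesis phi_cp : completely_positive phi.
Variables (r : nat) (j : 'M[R[i]]_r -> F).
Hypotheses (j_lin : linear j) (jM : forall x y, j (x ** y) = j x ** j y)
  (j_star : forall x, j (star x) = star (j x)).
Local Notation M := 'M[R[i]]_r.
Local Notation E := (@delta_mx R[i] r r).
Let g (x : M) : A := phi (j x).
Hypothesis g_oz : strict_order_le g 0.

Let gL (k : R[i]) x y : g (k *: x + y) = k *: g x + g y.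
Proof. by rewrite /g j_lin phi_cp.1. Qed.
Let g0 : g 0 = 0.
Proof. by apply: (addIr (g 0)); rewrite add0r -{3}[0]addr0 -[X in X + 0]scale1r gL scale1r. Qed.
Let gD x y : g (x + y) = g x + g y.
Proof. by rewrite -[x]scale1r gL !scale1r. Qed.
Let gZ k x : g (k *: x) = k *: g x.
Proof. by rewrite -[_ *: _]addr0 gL g0 addr0. Qed.
Let gN x : g (- x) = - g x.
Proof. by rewrite -scaleN1r gZ scaleN1r. Qed.

Lemma oz_star x : g (star x) = star (g x).
Proof.
have jx : j x = j x ** j 1%:M by rewrite -jM mx_starmulE mulmx1.
by rewrite /g j_star jx cp_starM.
Qed.

Lemma oz_minimal (p q : M) : minimal_projection p -> minimal_projection q ->
  p ** q = 0 -> q ** p = 0 -> g p ** g q = 0.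
Proof.
move=> pm qm pq qp; pose e (i : 'I_2) := if i == ord0 then p else q.
have [|a [b [ab gab]]] := g_oz (e := e).
  split=> [i|a b]; first by rewrite /e; case: eqP.
  by rewrite /e; case: a b => [[|[|//]] ?] [[|[|//]] ?].
have pS : star (g p) = g p by rewrite -oz_star; case: pm => -[-> _].
have qS : star (g q) = g q by rewrite -oz_star; case: qm => -[-> _].
have h : g q ** g p = 0 -> g p ** g q = 0.
  by move=> /(congr1 (@star _)); rewrite starM pS qS star0.
move: ab gab; rewrite /e; case: a b => [[|[|//]] ?] [[|[|//]] ?] //= _ //.
Qed.

(** As projections are their own squares, [cp_vanish] extends orthogonality from [g p], [g q] to
    one-sided multiples, on one side directly and on the other through adjoints. *)
Lemma oz_orth (p q c d : M) : minimal_projection p -> minimal_projection q ->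
  p ** q = 0 -> q ** p = 0 -> g (c ** p) ** g (q ** d) = 0.
Proof.
move=> pm qm pq qp.
have proj x : minimal_projection x -> star (j x) ** j x = j x.
  by case=> -[xS xx] _ _; rewrite -j_star -jM xS xx.
have h1 y : g (y ** q) ** g p = 0.
  by rewrite /g jM; apply: cp_vanish => //; rewrite proj//; exact: oz_minimal.
have h2 y : g p ** g (q ** y) = 0.
  have pS : star (g p) = g p by rewrite -oz_star; case: pm => -[-> _].
  have qS : star q = q by case: qm => -[].
  have := congr1 (@star _) (h1 (star y)).
  by rewrite starM pS -oz_star starM starK qS star0.
by rewrite /g jM; apply: cp_vanish => //; rewrite proj//; exact: h2.
Qed.

Let EE a b c d : E a b ** E c d = if b == c then E a d else 0.
Proof. by rewrite mx_starmulE mul_delta_mx_cond; case: eqP. Qed.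

Let ketbra (a : 'I_r) := (delta_mx a ord0 : 'cV[R[i]]_r, delta_mx ord0 a : 'rV[R[i]]_r).

Let E_min a : minimal_projection (E a a).
Proof.
have := @rank_one_minimal R r (ketbra a).1 (ketbra a).2 0.
rewrite /= invr1 scale1r !mul_delta_mx; apply.
  by move=> i; rewrite !mxE eqxx /= andbT; case: eqP => _; rewrite ?conjC1 ?conjC0.
by apply/matrixP => x y; rewrite !mxE !ord1.
Qed.

Lemma oz_units_neq a b c d : b != c -> g (E a b) ** g (E c d) = 0.
Proof.
move=> bc; have := @oz_orth (E b b) (E c c) (E a b) (E c d) (E_min b) (E_min c).
by rewrite !EE !eqxx (negPf bc) eq_sym (negPf bc); apply.
Qed.

(* Apply [oz_orth] to the rank one projections onto [e_b + e_c], [e_b - e_c]. *)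
Lemma oz_units_eq a b c d : g (E a b) ** g (E b d) = g (E a c) ** g (E c d).
Proof.
have [->//|bc] := eqVneq b c.
pose p (s : R[i]) : M := 2%:R^-1 *: (E b b + s *: E b c + (s *: E c b + E c c)).
pose v (s : R[i]) : 'cV[R[i]]_r := delta_mx b ord0 + s *: delta_mx c ord0.
pose w (s : R[i]) : 'rV[R[i]]_r := delta_mx ord0 b + s *: delta_mx ord0 c.
have pvw (s : R[i]) : s * s = 1 -> p s = 1.+1%:R^-1 *: (v s *m w s).
  move=> ss; rewrite /p /v /w mulmxDl !mulmxDr -!scalemxAr -!scalemxAl.
  by rewrite !mul_delta_mx scalerA ss scale1r.
have wv (s t : R[i]) : w s *m v t = (1 + s * t)%:M.
  rewrite /v /w mulmxDl !mulmxDr -!scalemxAr -!scalemxAl !mul_delta_mx_cond.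
  rewrite !eqxx (negPf bc) eq_sym (negPf bc) !mulr0n !scaler0 addr0 add0r.
  rewrite !mulr1n scalerA; apply/matrixP => x y; rewrite !mxE !ord1 /=.
  by rewrite mulr1n mulr1 mulrC.
have sg (s : R[i]) : s = 1 \/ s = -1 -> s * s = 1.
  by case=> ->; rewrite ?mulr1 ?mulrNN ?mulr1.
have p_min (s : R[i]) : s = 1 \/ s = -1 -> minimal_projection (p s).
  move=> s1; have ss := sg s s1.
  have sC : s^* = s by case: s1 => ->; rewrite ?rmorphN ?rmorph1.
  rewrite (pvw _ ss); apply: rank_one_minimal => [i|].
    rewrite !mxE !andbT rmorphD rmorphM /= sC.
    by do 2!case: eqP => _; rewrite ?conjC1 ?conjC0.
  by rewrite wv ss.
have pq (s : R[i]) : s = 1 \/ s = -1 -> p s ** p (- s) = 0.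
  move=> s1; have ss := sg s s1; have sN : - s * - s = 1 by rewrite mulrNN.
  rewrite mx_starmulE !pvw// -scalemxAl -scalemxAr mulmxA -[v s *m w s *m _]mulmxA.
  by rewrite wv mulrN ss subrr raddf0 mulmx0 mul0mx !scaler0.
have h : g (E a b ** p 1) ** g (p (-1) ** E b d) = 0.
  apply: oz_orth; first (by apply: p_min; left); first by apply: p_min; right.
    by apply: pq; left.
  by have := pq (-1) (or_intror erefl); rewrite opprK.
have Ep : E a b ** p 1 = 2%:R^-1 *: (E a b + E a c).
  rewrite mx_starmulE /p !scale1r -scalemxAr !mulmxDr !mul_delta_mx_cond.
  by rewrite !eqxx (negPf bc) !mulr0n !addr0 !mulr1n.
have pE : p (-1) ** E b d = 2%:R^-1 *: (E b d - E c d).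
  rewrite mx_starmulE /p !scaleN1r -scalemxAl !mulmxDl !mulNmx !mul_delta_mx_cond.
  by rewrite !eqxx eq_sym (negPf bc) !mulr0n oppr0 !addr0 !mulr1n.
rewrite Ep pE in h; move: h.
rewrite !gZ starmulZl starmulZr scalerA => /eqP; rewrite scaler_eq0 => /orP[|/eqP].
  by rewrite mulf_eq0 orbb invr_eq0 pnatr_eq0.
rewrite !gD gN starmulDl !starmulBr.
rewrite (oz_units_neq _ _ bc) [X in _ + (X - _)]oz_units_neq 1?eq_sym//.
by rewrite subr0 sub0r => /eqP; rewrite subr_eq0 => /eqP.
Qed.

End OrderZero.

(** * Approximate inverse square roots for images of matrix units *)

Section MatrixUnitRoots.
Variables (R : realType) (A : cstarAlgType R) (r : nat) (M : 'I_r -> 'I_r -> A).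
Implicit Types a b c d : 'I_r.
Hypothesis M_star : forall a b, star (M a b) = M b a.
Hypothesis M_neq : forall a b c d, b != c -> M a b ** M c d = 0.
Hypothesis M_eq : forall a b c d, M a b ** M b d = M a c ** M c d.
Let h : A := \sum_a M a a.
Hypothesis h_pos : positive h.
Hypothesis h_le1 : rn h <= 1.

Let h_sa : star h = h. Proof. exact: pos_star. Qed.

(** In terms of the decomposition of an order zero map into a homomorphism and a commuting positive
    [h], [M a b] is [h] times the image of a matrix unit. *)
Let hM a b c : h ** M a b = M a c ** M c b.
Proof.
rewrite starmul_suml (bigD1 a)//= big1 ?addr0 => [|i ia].
  exact: M_eq.
by rewrite M_neq.
Qed.

Let Mh a b : M a b ** h = h ** M a b.
Proof.
rewrite (hM a b b) starmul_sumr (bigD1 b)//= big1 ?addr0// => i ib.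
by rewrite M_neq// eq_sym.
Qed.

Local Notation E := (damp h).

(** By [hM] the square of [(1 - h)^n M a b] equals [(1 - h)^(2 n) h M b b], to which [rn_damp_k]
    applies. *)
Lemma rn_damp_unit n a b :
  rn (iter n E (M a b)) ^+ 2 <= 2 / (n + n).+1%:R * rn (M b b).
Proof.
rewrite -rn_cstar damp_adj// -iterD M_star -damp_comm// -(hM b b a) dampM.
rewrite (le_trans (rnM _ _))// ler_wpM2r ?rn_ge0// rn_damp_k//.
Qed.

Let D n y : A := \sum_(i < n) iter i E y.

Let DM n y z : D n (y ** z) = D n y ** z.
Proof. by rewrite starmul_suml; apply: eq_bigr => i _; rewrite dampM. Qed.

Let D_comm n (c y : A) : c ** h = h ** c -> D n (c ** y) = c ** D n y.
Proof.
by move=> ch; rewrite starmul_sumr; apply: eq_bigr => i _; rewrite damp_comm.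
Qed.

Let D_adj n y z : star (D n y) ** z = star y ** D n z.
Proof.
rewrite star_sum starmul_suml starmul_sumr; apply: eq_bigr => i _.
by rewrite damp_adj.
Qed.

Let hD n y : h ** D n y = y - iter n E y.
Proof.
rewrite damp_sumE subKr [LHS]starmul_sumr [RHS]starmul_suml.
by apply: eq_bigr => i _; rewrite damp_kl.
Qed.

Let star_damp n y : star y ** h = h ** star y -> star (iter n E y) = iter n E (star y).
Proof.
elim: n y => // n IH y yh; rewrite iterSr IH; last first.
  by rewrite /damp starB starM h_sa starmulBl starmulBr starmulA -yh.
by rewrite iterSr /damp starB starM h_sa yh.
Qed.

(* [t a] approximates [h^(-1/2) M a o], by way of [h^(1/2) p_n(h) M a o] with
   [p_n(h) = (1 - (1 - h)^n) / h]. *)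
Lemma unit_roots (o : 'I_r) (e : R) : 0 < e -> exists t : 'I_r -> A,
  [/\ forall a b, star (t a) ** t b = if a == b then star (t o) ** t o else 0,
      forall y, y ** h = 0 -> forall a, y ** t a = 0,
      positive (h - \sum_a t a ** star (t a)) &
      forall a b, rn (t a ** star (t b) - M a b) <= e].
Proof.
move=> e0; have [w [wS ww wC]] := pos_sqrt h_pos.
pose K : R := \sum_b rn (M b b) + 1.
have K0 : 0 < K by rewrite ltr_wpDl// sumr_ge0// => b _; exact: rn_ge0.
(* Chosen so that [(1 - h)^n M a b] has norm at most [e / 3] by [rn_damp_unit]. *)
pose n := Num.bound (9 * K / e ^+ 2).
have nE : 9 * K / e ^+ 2 < n%:R.
  by apply: archi_boundP; apply: divr_ge0; rewrite ?sqr_ge0// mulr_ge0// ltW.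
pose t a := w ** D n (M a o); exists t.
(* The value depends on [a] and [b] only through [M o a ** M b o], so [M_neq] and [M_eq] yield exact
   relations, whatever [n] is. *)
have tt a b : star (t a) ** t b = D n (M o a ** M b o - iter n E (M o a ** M b o)).
  rewrite /t starM wS -starmulA [w ** (w ** _)]starmulA ww hD D_adj M_star.
  by rewrite -D_comm// starmulBr damp_comm.
have wh : w ** h = h ** w by rewrite -ww starmulA.
(* This is [(1 - (1 - h)^n)^2 M a b]. With [z = (1 - h)^n M a b] the error is
   [z + (z - (1 - h)^n z)], at most three times the norm of [z]. *)
have Q a b : t a ** star (t b) = M a b - iter n E (M a b) - iter n E (M a b - iter n E (M a b)).
  have q : M a o ** star (D n (M b o)) = M a b - iter n E (M a b).
    rewrite -[M a o]M_star -starM -DM -(hM b a o) D_comm// hD starB star_damp ?M_star//.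
  have -> : t a ** star (t b) = w ** D n (M a b - iter n E (M a b)) ** w.
    by rewrite /t starM wS -q DM !starmulA.
  set z := M a b - _; have zh : z ** h = h ** z.
    rewrite /z starmulBl starmulBr Mh -dampM Mh damp_comm//.
  have zw : z ** w = w ** z by rewrite wC.
  by rewrite -starmulA -DM zw D_comm// starmulA ww hD.
split.
- have d0 : D n (0 - iter n E 0) = 0.
    have i0 i : iter i E 0 = 0 by have := dampZ h i 0 0; rewrite !scale0r.
    by rewrite i0 subr0 /D big1.
  move=> a b; case: eqP => [<-|/eqP ab]; last by rewrite tt M_neq// d0.
  by rewrite !tt (M_eq o a o).
- move=> y yh a; have yw : y ** w = 0.
    apply: rn_eq0; apply/eqP; rewrite -sqrf_eq0 -rn_star -rn_cstar starK starM wS.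
    by rewrite starmulA -[_ ** w ** w]starmulA ww yh starmul0l rn0.
  by rewrite /t starmulA yw starmul0l.
- have -> : \sum_a t a ** star (t a) = h - iter n E h - iter n E (h - iter n E h).
    under eq_bigr do rewrite Q.
    have iS (f : 'I_r -> A) : \sum_a iter n E (f a) = iter n E (\sum_a f a).
      rewrite (big_morph (iter n E) (dampD h n) (_ : iter n E 0 = 0))//.
      by have := dampZ h n 0 0; rewrite !scale0r.
    by rewrite sumrB iS sumrB iS.
  rewrite dampB -iterD.
  have -> : h - (h - iter n E h - (iter n E h - iter (n + n) E h)) =
      iter n E h + (iter n E h - iter (n + n) E h).
    by apply: uin_inj; rewrite !(uinD, uinN); ncr.
  apply: posD; first exact: pos_damp.
  by apply: pos_damp_le => //; exact: leq_addr.
- move=> a b; have xe : rn (iter n E (M a b)) <= e / 3.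
    rewrite -(@ler_pXn2r _ 2)// ?nnegrE ?rn_ge0 ?divr_ge0 ?(ltW e0)//.
    rewrite (le_trans (rn_damp_unit _ _ _))// mulrAC ler_pdivrMr//.
    have MK : rn (M b b) <= K.
      rewrite /K (bigD1 b)//= -addrA lerDl addr_ge0// sumr_ge0// => i _.
      exact: rn_ge0.
    have n2 : (n + n).+1%:R = 2 * n%:R + 1 :> R by rewrite -natr1 natrD; ring.
    rewrite n2 expr_div_n; move: nE; rewrite ltr_pdivrMr ?exprn_gt0// => nE.
    have e2 : 0 < e ^+ 2 by rewrite exprn_gt0.
    move: MK nE e2; move: (rn _) (K) (n%:R) (e ^+ 2) => m k N q mk kN q0.
    have -> : q / 3 ^+ 2 * (2 * N + 1) = (2 * (N * q) + q) / 9 by field.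
    rewrite ler_pdivlMr//; lra.
  set z := iter n E _ in xe; rewrite Q.
  have -> : M a b - z - iter n E (M a b - z) - M a b = - (z + (z - iter n E z)).
    by rewrite dampB -/z; apply: uin_inj; rewrite !(uinD, uinN); ncr.
  rewrite rnN (le_trans (rnD _ _))// (le_trans (lerD (lexx _) (rnB _ _)))//.
  by have := rn_damp h_sa h_pos h_le1 n z; lra.
Qed.

End MatrixUnitRoots.

(** * Coordinates of [F] and the maps [x |-> T x T^*] *)

Section Coordinates.
Variables (R : realType) (F : cstarAlgType R) (s : nat) (r : 'I_s -> nat).
Variable j : forall i, 'M[R[i]]_(r i) -> F.
Hypothesis dj : matrix_decomposition j.
Local Notation X := (forall i, 'M[R[i]]_(r i)).

Definition assemble (x : X) : F := \sum_i @j i (x i).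

Lemma block_exists : exists G : F -> X, cancel assemble G /\ cancel G assemble.
Proof. by case: (decomp_bij dj) => G GK KG; exists G. Qed.

Definition block : F -> X := projT1 (cid block_exists).

Lemma assembleK : cancel assemble block.
Proof. by case: (projT2 (cid block_exists)). Qed.
Lemma blockK : cancel block assemble.
Proof. by case: (projT2 (cid block_exists)). Qed.

Lemma block_eq x (y : X) : assemble y = x -> block x = y.
Proof. by move=> <-; rewrite assembleK. Qed.

Let j0 i : @j i 0 = 0.
Proof.
have e : @j i (1 *: 0 + 0) = 1 *: @j i 0 + @j i 0 by rewrite (decomp_linear dj).
rewrite !scale1r addr0 in e.
by apply: (addIr (@j i 0)); rewrite add0r -e.
Qed.
Let jD i : {morph @j i : x y / x + y}.
Proof. by move=> x y; rewrite -[x]scale1r (decomp_linear dj) !scale1r. Qed.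
Let jZ i k x : @j i (k *: x) = k *: @j i x.
Proof. by rewrite -[_ *: _]addr0 (decomp_linear dj) j0 addr0. Qed.

Lemma block_linear k x y i : block (k *: x + y) i = k *: block x i + block y i.
Proof.
have -> // : block (k *: x + y) = fun i => k *: block x i + block y i.
apply: block_eq; rewrite -{2}[x]blockK -{2}[y]blockK /assemble scaler_sumr -big_split.
by apply: eq_bigr => l _; rewrite (decomp_linear dj).
Qed.

Lemma blockM x y i : block (x ** y) i = block x i ** block y i.
Proof.
have -> // : block (x ** y) = fun i => block x i ** block y i.
apply: block_eq; rewrite -{2}[x]blockK -{2}[y]blockK /assemble starmul_suml.
apply: eq_bigr => l _; rewrite starmul_sumr (bigD1 l)//= big1 ?addr0.
  by rewrite (decompM dj).
by move=> k kl; rewrite (decomp_orth dj)// eq_sym.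
Qed.

Lemma block_star x i : block (star x) i = star (block x i).
Proof.
have -> // : block (star x) = fun i => star (block x i).
apply: block_eq; rewrite -{2}[x]blockK /assemble star_sum.
by apply: eq_bigr => l _; rewrite (decomp_star dj).
Qed.

Definition unitF : F := assemble (fun=> 1%:M).

Lemma block_unitF i : block unitF i = 1%:M.
Proof. by rewrite /unitF assembleK. Qed.

Lemma unitF_mull x : unitF ** x = x.
Proof.
rewrite -[LHS]blockK -[RHS]blockK; apply: eq_bigr => i _.
by rewrite blockM block_unitF mx_starmulE mul1mx.
Qed.

Lemma unitF_star : star unitF = unitF.
Proof. by rewrite -[star _]unitF_mull -{1}[unitF]starK -starM unitF_mull starK. Qed.

Lemma unitF_le1 : rn unitF <= 1.
Proof.
have := rn_cstar unitF; rewrite unitF_star unitF_mull.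
by have := rn_ge0 unitF; nra.
Qed.

Definition single i (p : 'M[R[i]]_(r i)) : X := fun l =>
  match i =P l with
  | ReflectT e => ecast l ('M[R[i]]_(r l)) e p
  | _ => 0
  end.

Lemma block_j i (p : 'M[R[i]]_(r i)) : block (@j i p) = single p.
Proof.
apply: block_eq; rewrite /assemble (bigD1 i)//= big1 ?addr0 => [|k ki]; rewrite /single.
  by case: eqP => // e; rewrite eq_axiomK.
by case: eqP => [e|_]; [exfalso; move: ki; rewrite e eqxx|rewrite j0].
Qed.

Lemma block_jE i (p : 'M[R[i]]_(r i)) : block (@j i p) i = p.
Proof. by rewrite block_j /single; case: eqP => // e; rewrite eq_axiomK. Qed.

Lemma coord_j_neq i (p : 'M[R[i]]_(r i)) l : l != i -> block (@j i p) l = 0.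
Proof.
by move=> li; rewrite block_j /single; case: eqP => // e; exfalso; move: li; rewrite e eqxx.
Qed.

Section Cut.
Variables (B : cstarAlgType R) (w : forall i, 'I_(r i) -> B).

(* [cut_map] is the map [x |-> T x T^*], where the row [T] has the entries [w i a]. *)
Definition cut_map (x : F) : B :=
  \sum_i \sum_a \sum_b block x i a b *: (@w i a ** star (@w i b)).

(** The column [x T^*], indexed by a summand together with a row of it; it makes
    [cut_map (star x ** y)] an inner product. *)
Definition cut_row (x : F) (k : {i : 'I_s & 'I_(r i)}) : B :=
  \sum_a block x (tag k) (tagged k) a *: star (@w (tag k) a).

Lemma cut_linear : linear cut_map.
Proof.
move=> k x y; rewrite /cut_map scaler_sumr -big_split; apply: eq_bigr => i _.
rewrite scaler_sumr -big_split; apply: eq_bigr => a _.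
rewrite scaler_sumr -big_split; apply: eq_bigr => b _ /=.
by rewrite block_linear !mxE scalerDl scalerA.
Qed.

Lemma cutD x y : cut_map (x + y) = cut_map x + cut_map y.
Proof. by rewrite -[x]scale1r cut_linear !scale1r. Qed.

Lemma cutZ k x : cut_map (k *: x) = k *: cut_map x.
Proof.
have c0 : cut_map 0 = 0.
  have e := cutD 0 0; rewrite addr0 in e.
  by apply: (addIr (cut_map 0)); rewrite add0r -e.
by rewrite -[k *: x]addr0 cut_linear c0 addr0.
Qed.

Lemma cut_star_mul x y : cut_map (star x ** y) = ip (cut_row x) (cut_row y).
Proof.
rewrite /ip /cut_row.
pose T i c : B := star (\sum_a block x i c a *: star (@w i a)) **
  (\sum_b block y i c b *: star (@w i b)).
transitivity (\sum_i \sum_c T i c); last first.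
  by rewrite (@sig_big_dep _ _ _ _ _ xpredT (fun=> xpredT) T).
rewrite /cut_map; apply: eq_bigr => i _; rewrite /T.
under eq_bigr => a _ do under eq_bigr => b _ do
  rewrite blockM block_star mxE scaler_suml.
under eq_bigr => a _ do rewrite exchange_big.
rewrite exchange_big; apply: eq_bigr => c _ /=.
rewrite star_sum starmul_suml; apply: eq_bigr => a _.
rewrite starmul_sumr; apply: eq_bigr => b _.
by rewrite mxE starZ starK starmulZl starmulZr scalerA.
Qed.

Lemma cut_unitF : cut_map unitF = \sum_i \sum_a @w i a ** star (@w i a).
Proof.
apply: eq_bigr => i _; apply: eq_bigr => a _; rewrite (bigD1 a)//= big1 ?addr0.
  by rewrite block_unitF mxE eqxx scale1r.
by move=> b ba; rewrite block_unitF mxE eq_sym (negPf ba) scale0r.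
Qed.

Lemma cut_j i (p : 'M[R[i]]_(r i)) :
  cut_map (@j i p) = \sum_a \sum_b p a b *: (@w i a ** star (@w i b)).
Proof.
rewrite /cut_map (bigD1 i)//= [X in _ + X]big1 ?addr0 => [|l li].
  by apply: eq_bigr => a _; apply: eq_bigr => b _; rewrite block_jE.
rewrite big1// => a _; rewrite big1// => b _.
by rewrite coord_j_neq// mxE scale0r.
Qed.

(** The image of [star b ** b] is a Gram matrix, with one row for each row of [b] and each index of
    [cut_row]. It need not be given by a square matrix, which is why [gram_positive] is called. *)
Lemma cut_cp : completely_positive cut_map.
Proof.
split=> [|k X0 [b ->]]; first exact: cut_linear.
pose Y (p : ('I_k * {i : 'I_s & 'I_(r i)})%type) q : B := cut_row (b p.1 q) p.2.
have -> : map_mx cut_map (star b ** b) = \matrix_(p, q) \sum_i star (Y i p) ** Y i q.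
  apply/matrixP => p q; rewrite !mxE.
  rewrite (big_morph cut_map (id1 := 0) (op1 := +%R)).
  - under eq_bigr => l _ do rewrite mxE cut_star_mul.
    by rewrite pair_bigA.
  - exact: cutD.
  - by rewrite -[0 in LHS](scale0r (0 : F)) cutZ scale0r.
exact: gram_positive.
Qed.

(** Cauchy-Schwarz for the columns [T^*] and [x T^*], together with [T x^* x T^* <= |x|^2 T T^*];
    the gap in the latter is the value at a square [y^* y] in [F]. *)
Lemma cut_contractive : rn (cut_map unitF) <= 1 -> contractive cut_map.
Proof.
move=> c1 x; rewrite !rnE lecR.
have u2 y : cut_map y = ip (cut_row unitF) (cut_row y).
  by rewrite -cut_star_mul unitF_star unitF_mull.
have [y yE] := pos_sandwich unitF (pos_star (pos_mul x)) (lexx (rn (star x ** x))).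
have xu : x ** unitF = x.
  by rewrite -[LHS]starK starM unitF_star unitF_mull starK.
rewrite unitF_star !unitF_mull -[star x ** x ** unitF]starmulA xu in yE.
have c0 : rn (cut_map (star x ** x)) <= rn x ^+ 2 * rn (cut_map unitF).
  rewrite -rn_cstar -rnZr ?rn_ge0//; apply: pos_rn_le.
    by rewrite cut_star_mul; exact: pos_ip.
  have -> : (rn (star x ** x))%:C%C *: cut_map unitF - cut_map (star x ** x) =
      cut_map (star y ** y).
    by rewrite -yE -[- (star x ** x)]scaleN1r cutD !cutZ scaleN1r.
  by rewrite cut_star_mul; exact: pos_ip.
rewrite -(@ler_pXn2r _ 2)// ?nnegrE ?rn_ge0// u2.
rewrite (le_trans (cauchy_schwarz _ _))// -!cut_star_mul unitF_star unitF_mull.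
rewrite -[leRHS]mul1r ler_pM ?rn_ge0// (le_trans c0)//.
by rewrite ler_piMr ?sqr_ge0.
Qed.

Lemma cut_orth i l : (forall a b, star (@w i a) ** @w l b = 0) ->
  cut_map (@j i 1%:M) ** cut_map (@j l 1%:M) = 0.
Proof.
move=> h; rewrite !cut_j starmul_suml big1// => a _; rewrite starmul_suml big1// => b _.
rewrite starmul_sumr big1// => c _; rewrite starmul_sumr big1// => d _.
rewrite starmulZl starmulZr -starmulA.
have -> : star (@w i b) ** (@w l c ** star (@w l d)) = 0.
  by rewrite starmulA h starmul0l.
by rewrite starmul0r !scaler0.
Qed.

Variable C : 'I_s -> B.
Hypothesis wC : forall i a b,
  star (@w i a) ** @w i b = if a == b then C i else 0.

(** By [wC] the inner product [T^* T] of summand [i] is diagonal with constant entry [C i], so the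
    two images multiply to an expression linear in the entries of the matrix product [p q = 0]. *)
Lemma cut_order_zero i : strict_order_le (cut_map \o @j i) 0.
Proof.
move=> e [_ e0]; exists ord0, (lift ord0 ord0); split => //=.
have := e0 ord0 (lift ord0 ord0) erefl; rewrite mx_starmulE.
set p := e _; set q := e _ => pq; rewrite !cut_j starmul_suml big1// => a _.
have E b c d : p a b *: (@w i a ** star (@w i b)) **
      (q c d *: (@w i c ** star (@w i d))) =
    if b == c then (p a b * q b d) *: (@w i a ** C i ** star (@w i d)) else 0.
  have -> : p a b *: (@w i a ** star (@w i b)) ** (q c d *: (@w i c ** star (@w i d)))
      = (p a b * q c d) *: (@w i a ** (star (@w i b) ** @w i c) ** star (@w i d)).
    by rewrite starmulZl starmulZr scalerA !starmulA.
  rewrite wC.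
  by case: eqP => [->|_]; rewrite ?starmul0r ?starmul0l ?scaler0.
transitivity (\sum_d (p *m q) a d *: (@w i a ** C i ** star (@w i d))); last first.
  by rewrite pq big1// => d _; rewrite mxE scale0r.
under [RHS]eq_bigr => d _ do rewrite mxE scaler_suml.
rewrite [RHS]exchange_big starmul_suml; apply: eq_bigr => b _.
rewrite starmul_sumr [LHS](bigD1 b)//= [X in _ + X = _]big1 ?addr0 => [|c cb].
  by rewrite starmul_sumr; apply: eq_bigr => d _; rewrite E eqxx.
by rewrite starmul_sumr big1// => d _; rewrite E eq_sym (negPf cb).
Qed.

End Cut.
End Coordinates.

Section PiecewiseHomogeneousRoots.
Variables (R : realType) (F A : cstarAlgType R) (phi : F -> A).
Variables (s : nat) (r : 'I_s -> nat) (j : forall i, 'M[R[i]]_(r i) -> F).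
Hypothesis dj : matrix_decomposition j.
Hypothesis phi_cpc : cpc phi.
Hypothesis phi_oz : forall i, strict_order_le (phi \o @j i) 0.

Let phi_cp := phi_cpc.1.

Let phiD x y : phi (x + y) = phi x + phi y.
Proof. by rewrite -[x]scale1r phi_cp.1 !scale1r. Qed.
Let phi0 : phi 0 = 0.
Proof.
have e := phiD 0 0; rewrite addr0 in e.
by apply: (addIr (phi 0)); rewrite add0r -e.
Qed.
Let phiZ k x : phi (k *: x) = k *: phi x.
Proof. by rewrite -[k *: x]addr0 phi_cp.1 phi0 addr0. Qed.
Let phi_sum I (q : seq I) (P : pred I) (G : I -> F) :
  phi (\sum_(i <- q | P i) G i) = \sum_(i <- q | P i) phi (G i).
Proof. exact: (big_morph phi phiD phi0). Qed.

Let unit_mx i a b : A := phi (@j i (delta_mx a b)).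

Let jmx i (p : 'M[R[i]]_(r i)) :
  phi (@j i p) = \sum_a \sum_b p a b *: unit_mx a b.
Proof.
have jL k x y : @j i (k *: x + y) = k *: @j i x + @j i y by rewrite (decomp_linear dj).
have jD x y : @j i (x + y) = @j i x + @j i y by rewrite -[x]scale1r jL !scale1r.
have j0 : @j i 0 = 0.
  have e := jD 0 0; rewrite addr0 in e.
  by apply: (addIr (@j i 0)); rewrite add0r -e.
have jZ k x : @j i (k *: x) = k *: @j i x by rewrite -[k *: x]addr0 jL j0 addr0.
rewrite {1}[p]matrix_sum_delta (big_morph (@j i) jD j0) phi_sum.
apply: eq_bigr => a _; rewrite (big_morph (@j i) jD j0) phi_sum.
by apply: eq_bigr => b _; rewrite jZ phiZ.
Qed.

Let sum_unit i : phi (@j i 1%:M) = \sum_a unit_mx (i := i) a a.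
Proof.
rewrite jmx; apply: eq_bigr => a _; rewrite (bigD1 a)//= big1 ?addr0.
  by rewrite mxE eqxx scale1r.
by move=> b ba; rewrite mxE eq_sym (negPf ba) scale0r.
Qed.

Let j1 i : star (@j i 1%:M) ** @j i 1%:M = @j i 1%:M.
Proof.
have S1 : star (1%:M : 'M[R[i]]_(r i)) = 1%:M.
  apply/matrixP => a b; rewrite !mxE eq_sym /star /=.
  by case: eqP => _; rewrite ?conjC1 ?conjC0.
by rewrite -(decomp_star dj) S1 -(decompM dj) mx_starmulE mul1mx.
Qed.

Let h_pos i : positive (\sum_a unit_mx (i := i) a a).
Proof. by rewrite -sum_unit -j1; apply: cp_pos => //; exact: pos_mul. Qed.

Let phi_rn x : rn (phi x) <= rn x.
Proof. by rewrite -lecR -!rnE; exact: phi_cpc.2. Qed.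

Let h_le1 i : rn (\sum_a unit_mx (i := i) a a) <= 1.
Proof.
rewrite -sum_unit (le_trans (phi_rn _))//.
have := rn_cstar (@j i 1%:M); rewrite j1.
by have := rn_ge0 (@j i 1%:M); nra.
Qed.

(** [unit_roots] is applied in every summand; the positive gap [h_i - sum t t^*] bounds the value at
    the unit by [phi] of the unit. *)
Lemma ph_roots (e : R) : 0 < e -> exists (t : forall i, 'I_(r i) -> A) (C : 'I_s -> A),
  [/\ forall i a b, star (t i a) ** t i b = if a == b then C i else 0,
      forall i l, phi (@j i 1%:M) ** phi (@j l 1%:M) = 0 ->
        forall a b, star (t i a) ** t l b = 0,
      rn (cut_map dj t (unitF j)) <= 1 &
      forall x, rn (cut_map dj t x - phi x) <=
        (\sum_i \sum_a \sum_b cabs (block dj x i a b)) * e].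
Proof.
move=> e0.
have H i : exists t : 'I_(r i) -> A, [/\ exists C, forall a b, star (t a) ** t b = if a == b then C else 0,
    forall y, y ** phi (@j i 1%:M) = 0 -> forall a, y ** t a = 0,
    positive (phi (@j i 1%:M) - \sum_a t a ** star (t a)) &
    forall a b, rn (t a ** star (t b) - unit_mx a b) <= e].
  have Ms a b : star (unit_mx (i := i) a b) = unit_mx b a.
    rewrite -(oz_star phi_cp (decompM dj (i := i)) (decomp_star dj (i := i))).
    congr (phi (j _)); apply/matrixP => p q; rewrite !mxE andbC /star /=.
    by case: andP => _; rewrite ?conjC1 ?conjC0.
  (* Nonempty summands provide the base index [o] of [unit_roots]. *)
  have ri := decomp_gt0 dj i.
  have [t [t1 t2 t3 t4]] := unit_roots Ms
    (fun a b c d => oz_units_neq phi_cp (decompM dj (i := i))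
        (decomp_star dj (i := i)) (@phi_oz i) a d)
    (oz_units_eq phi_cp (decomp_linear dj (i := i)) (decompM dj (i := i))
        (decomp_star dj (i := i)) (@phi_oz i))
    (h_pos i) (h_le1 i) (Ordinal ri) e0.
  exists t; rewrite sum_unit; split => //.
  by exists (star (t (Ordinal ri)) ** t (Ordinal ri)).
pose t i := projT1 (cid (H i)).
have tP i := projT2 (cid (H i)); rewrite -/(t _) in tP.
have C1 i : exists C, forall a b, star (t i a) ** t i b = if a == b then C else 0.
  by case: (tP i).
exists t, (fun i => projT1 (cid (C1 i))); split.
- by move=> i; exact: (projT2 (cid (C1 i))).
- move=> i l il a b; have [_ ti _ _] := tP i; have [_ tl _ _] := tP l.
  have hS k : star (phi (@j k 1%:M)) = phi (@j k 1%:M).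
    by apply: pos_star; rewrite sum_unit; exact: h_pos.
  (* From [h_i h_l = 0] follows [h_i t_l = 0], then [t_l^* h_i = 0] by adjoints, then
     [t_l^* t_i = 0]. *)
  have h1 := tl _ il b.
  have : star (t l b) ** phi (@j i 1%:M) = 0 by rewrite -(hS i) -starM h1 star0.
  by move=> /ti /(_ a) /(congr1 (@star _)); rewrite starM starK star0.
- rewrite cut_unitF; apply: (@le_trans _ _ (rn (phi (unitF j)))); last first.
    by rewrite (le_trans (phi_rn _))// (unitF_le1 dj).
  apply: pos_rn_le.
    by apply: pos_sum => i _; apply: pos_sum => a _; exact: pos_mulr.
  rewrite /unitF /assemble phi_sum -sumrB; apply: pos_sum => i _.
  by case: (tP i).
- move=> x; rewrite -{2}[x](blockK dj) /assemble phi_sum /cut_map -sumrB.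
  rewrite (le_trans (rn_sum _ _ _))// mulr_suml ler_sum// => i _.
  rewrite jmx -sumrB (le_trans (rn_sum _ _ _))// mulr_suml ler_sum// => a _.
  rewrite -sumrB (le_trans (rn_sum _ _ _))// mulr_suml ler_sum// => b _.
  rewrite -scalerBr rnZ ler_wpM2l ?cabs_ge0//.
  by case: (tP i) => _ _ _; exact.
Qed.

End PiecewiseHomogeneousRoots.

(** * Compression to the ideal *)

Section IdealCompression.
Variables (R : realType) (A : cstarAlgType R) (J : set A) (hJ : closed_ideal J).
Local Notation Jt := (subalg_type (ideal_subalg hJ)).
Implicit Types (x y z v b : Jt).

Lemma rn_val x : rn (val x) = rn x. Proof. by []. Qed.

Lemma val_starmul x y : val (x ** y) = val x ** val y. Proof. by []. Qed.

Lemma val_star x : val (star x) = star (val x). Proof. by []. Qed.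

Lemma val_scale (k : R[i]) x : val (k *: x) = k *: val x. Proof. by []. Qed.

Lemma val_sum I (q : seq I) (P : pred I) (G : I -> Jt) :
  val (\sum_(i <- q | P i) G i) = \sum_(i <- q | P i) val (G i).
Proof. exact: (big_morph (fun x : Jt => val x) (id1 := 0) (op1 := +%R)). Qed.

Definition ideal_mul (a : A) x : Jt :=
  exist _ (a ** val x) (mem_set (ideal_mull hJ a (set_mem (valP x)))).

Lemma val_ideal_mul a x : val (ideal_mul a x) = a ** val x. Proof. by []. Qed.

Lemma val_cut (F : cstarAlgType R) s (r : 'I_s -> nat)
    (j : forall i, 'M[R[i]]_(r i) -> F) (dj : matrix_decomposition j)
    (w : forall i, 'I_(r i) -> Jt) (x : F) :
  val (cut_map dj w x) = cut_map dj (fun i a => val (w i a)) x.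
Proof.
rewrite /cut_map val_sum; apply: eq_bigr => i _.
rewrite val_sum; apply: eq_bigr => a _; rewrite val_sum; apply: eq_bigr => b _.
by rewrite val_scale.
Qed.

Lemma hn_mul_le (I : finType) (X : I -> A) (u : A) : rn u <= 1 ->
  hn (fun k => u ** X k) <= hn X.
Proof.
move=> u1; rewrite -(@ler_pXn2r _ 2)// ?nnegrE ?hn_ge0// -!hnE.
apply: pos_rn_le; first exact: pos_ip.
rewrite /ip -sumrB; apply: pos_sum => k _.
have uS : star (star u ** u) = star u ** u by rewrite starM starK.
have u2 : rn (star u ** u) <= 1 by rewrite rn_cstar expr_le1// rn_ge0.
by have := pos_sandwich (X k) uS u2; rewrite scale1r starM !starmulA.
Qed.

Lemma rn_ip_le (I : finType) (X Y : I -> A) : rn (ip X Y) <= hn X * hn Y.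
Proof.
rewrite -(@ler_pXn2r _ 2)// ?nnegrE ?mulr_ge0 ?hn_ge0 ?rn_ge0//.
by rewrite exprMn -!hnE cauchy_schwarz.
Qed.

(* Write [x = y^* y] and [rho] for the column [y T^*], so that
   [T x T^* = rho^* rho] is close to [b^* b].  Splitting [rho^*] as
   [c rho^* + (1 - c) rho^*] with [c] in [J] almost a unit for [b^* b], the
   second part is small, and the first one has entries in [J], which are
   almost fixed by [v v^*]. *)
Lemma cut_error b (d : R) : 0 < d -> exists2 e : R, 0 < e &
  forall (F : cstarAlgType R) s (r : 'I_s -> nat)
    (j : forall i, 'M[R[i]]_(r i) -> F) (dj : matrix_decomposition j)
    (t : forall i, 'I_(r i) -> A) (x : F), positive x ->
  rn (cut_map dj t x - val (star b ** b)) <= e ->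
  exists (zs : seq Jt), exists2 d' : R, 0 < d' &
  forall v : Jt, star v = v -> rn v <= 1 ->
    (forall z, z \in zs -> rn (z - z ** (v ** star v)) <= d') ->
    rn (cut_map dj (fun i a => t i a ** val v) x - val (star b ** b)) <= d.
Proof.
move=> d0; set a := star b ** b.
(* The term [ip X Y] below has square at most [6 e * 4 (|a| + e)]; requiring
   [24 e (|a| + 1) <= (d / 2)^2] gives 96. Two more errors, of size [e <= d / 4] each, complete
   [d]. *)
pose e := Num.min (Num.min 1 (d / 4)) (d ^+ 2 / (96 * (rn a + 1))).
have a1 : 0 < 96 * (rn a + 1) by rewrite mulr_gt0// ltr_wpDl ?rn_ge0.
have e0 : 0 < e.
  by rewrite !lt_min ltr01 !divr_gt0//= exprn_gt0.
have e1 : e <= 1 by rewrite !ge_min lexx.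
have e4 : e <= d / 4 by rewrite !ge_min lexx orbT.
have e96 : 96 * (rn a + 1) * e <= d ^+ 2.
  by rewrite mulrC -ler_pdivlMr// ge_min lexx orbT.
exists e => // F s r j dj t x [y xE] xa.
have [c [cS c1 ca]] := @approximate_unit _ Jt 'I_1 (fun=> a) e e0.
pose f := val (c ** star c).
have fS : star f = f by rewrite -val_star starM starK.
have f1 : rn f <= 1.
  by rewrite rn_val (le_trans (rnM _ _))// rn_star mulr_ile1 ?rn_ge0.
have {ca} fa : rn (val a - val a ** f) <= e by exact: ca ord0.
pose rho := cut_row dj t y.
have xrho : cut_map dj t x = ip rho rho by rewrite xE cut_star_mul.
have valaS : star (val a) = val a by rewrite -val_star starM starK.
pose X k := rho k - rho k ** f.
(* [ip X X = (1 - f)(a + beta)(1 - f)], where [a] contributes [2 e], as [f] is almost a unit for it,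
   and [beta] contributes [4 e]. *)
have XX : rn (ip X X) <= 6 * e.
  set beta := ip rho rho - val a.
  have bE : rn beta <= e by rewrite /beta -xrho.
  have -> : ip X X = (val a - f ** val a) - (val a - f ** val a) ** f
     + (beta - f ** beta - (beta - f ** beta) ** f).
    have -> : ip X X = ip rho rho - f ** ip rho rho
        - (ip rho rho - f ** ip rho rho) ** f.
      rewrite /ip /X !starmul_sumr -!sumrB starmul_suml -!sumrB.
      apply: eq_bigr => k _; rewrite starB starM fS starmulBl !starmulBr.
      by apply: uin_inj; rewrite !(uinD, uinN, uinM); ncr.
    have -> : ip rho rho = val a + beta by rewrite addrC subrK.
    by apply: uin_inj; rewrite !(uinD, uinN, uinM); ncr.
  have fa' : rn (val a - f ** val a) <= e.
    by rewrite -rn_star starB starM fS valaS.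
  have g1 (z : A) : rn (z ** f) <= rn z.
    by rewrite (le_trans (rnM _ _))// ler_piMr ?rn_ge0.
  have g2 (z : A) : rn (f ** z) <= rn z.
    by rewrite (le_trans (rnM _ _))// ler_piMl ?rn_ge0.
  have g3 (z : A) : rn (z - z ** f) <= rn z + rn z.
    by rewrite (le_trans (rnB _ _))// lerD2l.
  have g4 (z : A) : rn (z - f ** z) <= rn z + rn z.
    by rewrite (le_trans (rnB _ _))// lerD2l.
  rewrite (le_trans (rnD _ _))//.
  have := g3 (beta - f ** beta); have := g4 beta.
  have := rnB (val a - f ** val a) ((val a - f ** val a) ** f).
  have := g1 (val a - f ** val a); lra.
pose S : R := \sum_k rn (rho k) + 1.
have S0 : 0 < S by rewrite ltr_wpDl// sumr_ge0// => k _; exact: rn_ge0.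
(* These are the entries [f rho_k^*], which lie in J. Dividing [e] by [S] makes their errors,
   weighted by the norms of the [rho k], sum to at most [e]. *)
pose zeta k : Jt := star (ideal_mul (rho k) (c ** star c)).
exists [seq zeta k | k <- enum {: {i : 'I_s & 'I_(r i)}}], (e / S).
  by rewrite divr_gt0.
move=> v vS v1 vz; pose U := val (v ** star v).
have U1 : rn U <= 1.
  by rewrite rn_val (le_trans (rnM _ _))// rn_star mulr_ile1 ?rn_ge0.
have US : star U = U by rewrite -val_star starM starK.
have cutE : cut_map dj (fun i a0 => t i a0 ** val v) x = ip rho (fun k => U ** rho k).
  rewrite xE cut_star_mul; apply: eq_bigr => k _.
  have -> : cut_row dj (fun i a0 => t i a0 ** val v) y k = val v ** rho k.
    rewrite /cut_row /rho /cut_row starmul_sumr; apply: eq_bigr => a0 _.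
    by rewrite starM -val_star vS starmulZr.
  by rewrite starM -val_star vS /U vS val_starmul !starmulA.
pose Y k := rho k - U ** rho k.
have decomp : cut_map dj t x - cut_map dj (fun i a0 => t i a0 ** val v) x =
    ip X Y + \sum_k (val (zeta k) - val (zeta k) ** U) ** rho k.
  rewrite xrho cutE /ip -sumrB -big_split; apply: eq_bigr => k _ /=.
  rewrite starM fS starB starM fS; move: (star (rho k)) => p.
  by rewrite /Y; apply: uin_inj; rewrite !(uinD, uinN, uinM); ncr.
have XY : rn (ip X Y) <= d / 2.
  have rr : hn rho ^+ 2 <= rn a + e.
    rewrite -hnE -xrho -[cut_map _ _ _](subrK (val a)) addrC.
    by rewrite (le_trans (rnD _ _))// lerD2l.
  have Y2 : hn Y <= 2 * hn rho.
    have -> : Y = fun k => rho k + (- U) ** rho k.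
      by apply: funext => k; rewrite starmulNl.
    rewrite (le_trans (hn_tri _ _))// mulrDl mul1r lerD2l.
    by apply: hn_mul_le; rewrite rnN.
  have X2 : hn X ^+ 2 <= 6 * e by rewrite -hnE.
  have := rn_ip_le X Y; have := hn_ge0 X; have := hn_ge0 Y; have := hn_ge0 rho.
  move: rr Y2 X2; move: (hn rho) (hn X) (hn Y) (rn (ip X Y)) => h p q m rr Y2 X2 h0 q0 p0 mpq.
  have pq2 : p * q <= p * (2 * h) by rewrite ler_wpM2l.
  apply: (le_trans mpq); apply: (le_trans pq2).
  rewrite -(@ler_pXn2r _ 2)// ?nnegrE ?mulr_ge0 ?divr_ge0 ?(ltW d0)//.
  have -> : (p * (2 * h)) ^+ 2 = 4 * (p ^+ 2 * h ^+ 2) by ring.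
  have ph : p ^+ 2 * h ^+ 2 <= 6 * e * (rn a + e) by rewrite ler_pM ?sqr_ge0.
  have ae : e * (rn a + e) <= e * (rn a + 1) by rewrite ler_wpM2l ?(ltW e0)// lerD2l.
  rewrite expr_div_n; move: e96 ph ae; move: (rn a) (d ^+ 2) (p ^+ 2 * h ^+ 2) => w1 w2 w3.
  lra.
have Zr : rn (\sum_k (val (zeta k) - val (zeta k) ** U) ** rho k) <= e.
  apply: (@le_trans _ _ (\sum_k e / S * rn (rho k))).
    rewrite (le_trans (rn_sum _ _ _))// ler_sum// => k _.
    rewrite (le_trans (rnM _ _))// ler_wpM2r ?rn_ge0//.
    by apply: (vz (zeta k)); apply: map_f; rewrite mem_enum.
  by rewrite -mulr_sumr mulrAC ler_pdivrMr// ler_wpM2l ?(ltW e0)// lerDl.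
have -> : cut_map dj (fun i a0 => t i a0 ** val v) x - val a =
   (cut_map dj t x - val a) -
   (cut_map dj t x - cut_map dj (fun i a0 => t i a0 ** val v) x).
  by apply: uin_inj; rewrite !(uinD, uinN); ncr.
rewrite (le_trans (rnB _ _))// decomp (le_trans (lerD xa (rnD _ _)))//.
by move: XY Zr e4; lra.
Qed.

End IdealCompression.

(** * Nets, finite choices and minimal projections of [C^s] *)

Section Nets.
Variables (R : realType) (A : cstarAlgType R).

Lemma nbhs_rn (a : A) (U : set A) : nbhs a U <->
  exists2 e : R, 0 < e & forall x, rn (x - a) < e -> U x.
Proof.
split=> [/nbhs_normP[d /= d0 dU]|[e e0 eU]].
  have dR : d \is Num.real by apply: gtr0_real.
  exists (complex.Re d); first by rewrite -ltcR RRe_real.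
  by move=> x xd; apply: dU => /=; rewrite rnE -rnN opprB -(RRe_real dR) ltcR.
apply/nbhs_normP; exists e%:C%C => /=; first by rewrite ltcR.
by move=> x /=; rewrite rnE ltcR -rnN opprB; exact: eU.
Qed.

Lemma net_cvgP (L : Type) (le : L -> L -> Prop) (f : L -> A) (a : A) :
  f l @[l --> net_filter le] --> a <->
  forall e : R, 0 < e -> exists l0, forall l, le l0 l -> rn (f l - a) < e.
Proof.
split=> [fa e e0|fa U /nbhs_rn[e /fa[l0 l0e] eU]].
  have /fa[l0 l0e] : nbhs a [set x | rn (x - a) < e] by apply/nbhs_rn; exists e.
  by exists l0.
by exists l0 => l /l0e/eU.
Qed.

Lemma directed_seq (L : Type) (le : L -> L -> Prop) (T : eqType) (S : seq T)
    (P : T -> L -> Prop) : directed le ->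
  (forall b, exists l0, forall l, le l0 l -> P b l) ->
  exists l, forall b, b \in S -> P b l.
Proof.
move=> [[l1] lerr letr leub] H.
suff [l0 l0P] : exists l0, forall l, le l0 l -> forall b, b \in S -> P b l.
  by exists l0; exact: (l0P l0 (lerr l0)).
elim: S => [|b S [l0 IH]]; first by exists l1.
have [lb lbP] := H b; have [m [m0 mb]] := leub l0 lb.
exists m => l ml c; rewrite inE => /orP[/eqP ->|cS].
  exact: (lbP l (letr _ _ _ mb ml)).
exact: (IH l (letr _ _ _ m0 ml)).
Qed.

Lemma seq_min (T : eqType) (S : seq T) (P : T -> R -> Prop) :
  (forall b e e', 0 < e' <= e -> P b e -> P b e') ->
  (forall b, exists2 e, 0 < e & P b e) ->
  exists2 e, 0 < e & forall b, b \in S -> P b e.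
Proof.
move=> Pm H; elim: S => [|b S [e e0 IH]]; first by exists 1.
have [d d0 db] := H b; have m0 : 0 < Num.min d e by rewrite lt_min d0.
exists (Num.min d e) => // c; rewrite inE => /orP[/eqP ->|cS].
  by apply: Pm db; rewrite m0 ge_min lexx.
by apply: Pm (IH c cS); rewrite m0 ge_min lexx orbT.
Qed.

(** The order condition on [phi \o center_embedding j] thereby concerns products of the elements
    [phi (j i 1)] only. The indicator of a point where [c] is nonzero is a subprojection of [c]. *)
Lemma ffun_minimal_projection s (c : {ffun 'I_s -> R[i]}) :
  minimal_projection c -> exists i, c = [ffun l => (l == i)%:R].
Proof.
move=> [[cS cc] c0 cmin].
have [i ci] : exists i, c i != 0.
  apply/existsP; apply: contra_notT c0; rewrite negb_exists => /forallP h.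
  by apply/ffunP => i; rewrite ffunE; apply/eqP; have := h i; rewrite negbK.
exists i; set q : {ffun 'I_s -> R[i]} := [ffun l => _].
have c1 : c i = 1.
  apply: (mulfI ci); rewrite mulr1.
  by have /ffunP/(_ i) := cc; rewrite ffunE.
have qp : projection q.
  split; apply/ffunP => l; rewrite !ffunE /star /=; first by case: eqP => _; rewrite ?conjC1 ?conjC0.
  by rewrite /starmul /=; case: eqP => _; rewrite ?mulr1 ?mulr0.
have cq : c ** q = q.
  apply/ffunP => l; rewrite !ffunE /starmul /=.
  by case: eqP => [->|_]; rewrite ?mulr0// c1 mulr1.
have [q0|//] := cmin q qp cq.
by have /ffunP/(_ i) := q0; rewrite !ffunE eqxx => /eqP; rewrite oner_eq0.
Qed.

End Nets.

(** * The approximating net for the ideal *)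

Section IdealRank.
Variables (R : realType) (A : cstarAlgType R) (J : set A) (hJ : closed_ideal J).
Local Notation Jt := (subalg_type (ideal_subalg hJ)).

(** Concatenating the test lists and taking the least tolerance, a single approximate unit serves
    all of [S]. *)
Lemma seq_almost_unit (T : eqType) (S : seq T) (Q : T -> Jt -> Prop) :
  (forall b, b \in S -> exists (zs : seq Jt), exists2 d : R, 0 < d &
    forall v, star v = v -> rn v <= 1 ->
      (forall z, z \in zs -> rn (z - z ** (v ** star v)) <= d) -> Q b v) ->
  exists v, [/\ star v = v, rn v <= 1 & forall b, b \in S -> Q b v].
Proof.
move=> H; have [zs [d d0 zsP]] : exists (zs : seq Jt), exists2 d : R, 0 < d &
    forall v, star v = v -> rn v <= 1 ->
      (forall z, z \in zs -> rn (z - z ** (v ** star v)) <= d) ->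
      forall b, b \in S -> Q b v.
  elim: S H => [|b S IH] H; first by exists [::], 1.
  have [|zs [d d0 zsP]] := IH; first by move=> c cS; apply: H; rewrite inE cS orbT.
  have [|zs' [d' d'0 zsP']] := H b; first exact: mem_head.
  exists (zs ++ zs'), (Num.min d d'); first by rewrite lt_min d0.
  move=> v vS v1 vz c; rewrite inE => /orP[/eqP ->|cS].
    apply: zsP' => // z zz; rewrite (le_trans (vz z _)) ?mem_cat ?zz ?orbT//.
    by rewrite ge_min lexx orbT.
  apply: zsP => // z zz; rewrite (le_trans (vz z _)) ?mem_cat ?zz//.
  by rewrite ge_min lexx.
have [v [vS v1 vz]] := @approximate_unit _ Jt 'I_(size zs) (fun i => nth 0 zs i) d d0.
exists v; split=> //; apply: zsP => // z /(nthP 0)[i izs <-].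
exact: (vz (Ordinal izs)).
Qed.

(** The products [star w ** w] are [v^* t^* t v], so they vanish where those of [t] do, and [C i]
    becomes [v^* C i v]. The pair with zero product found for [phi] works again, and [v v^* <= 1]
    keeps the map contractive. *)
Lemma compress_ph (F : cstarAlgType R) (phi : F -> A) n s (r : 'I_s -> nat)
    (j : forall i, 'M[R[i]]_(r i) -> F) (dj : matrix_decomposition j)
    (t : forall i, 'I_(r i) -> A) (C : 'I_s -> A) (v : Jt) :
  rn v <= 1 ->
  strict_order_le (phi \o center_embedding j) n ->
  (forall i a b, star (t i a) ** t i b = if a == b then C i else 0) ->
  (forall i l, phi (@j i 1%:M) ** phi (@j l 1%:M) = 0 ->
    forall a b, star (t i a) ** t l b = 0) ->
  rn (cut_map dj t (unitF j)) <= 1 ->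
  let w i a := ideal_mul (t i a) v in
  cpc (cut_map dj w) /\ ph_strict_order_le (cut_map dj w) n.
Proof.
move=> v1 so tC tcross t1 w.
have wcpc : cpc (cut_map dj w).
  split; first exact: cut_cp.
  apply: cut_contractive; rewrite -rn_val val_cut (le_trans _ t1)// !cut_unitF.
  apply: pos_rn_le; first by do 2!apply: pos_sum => ? _; exact: pos_mulr.
  rewrite -sumrB; apply: pos_sum => i _; rewrite -sumrB; apply: pos_sum => a _.
  have uS : star (val v ** star (val v)) = val v ** star (val v) by rewrite starM starK.
  have u1 : rn (val v ** star (val v)) <= 1.
    by rewrite (le_trans (rnM _ _))// rn_star mulr_ile1 ?rn_ge0.
  have := pos_sandwich (star (t i a)) uS u1; rewrite scale1r starK.
  by rewrite val_ideal_mul starM !starmulA.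
split => //; exists s, r, j; split => //.
- move=> i; pose C' i : Jt := ideal_mul (star (val v) ** C i) v.
  apply: (@cut_order_zero _ _ _ _ _ _ _ _ C') => {}i a b; apply: val_inj.
  rewrite val_starmul val_star !val_ideal_mul starM starmulA -[_ ** t i b]starmulA tC.
  by case: eqP => _; rewrite ?starmul0r ?starmul0l.
- move=> e eel; have [p [q [pq epq]]] := so e eel.
  exists p, q; split => //.
  have [i ei] := ffun_minimal_projection (eel.1 p).
  have [l el] := ffun_minimal_projection (eel.1 q).
  have emb k : center_embedding j [ffun m => (m == k)%:R] = @j k 1%:M.
    rewrite /center_embedding (bigD1 k)//= ffunE eqxx big1 ?addr0// => m mk.
    have jD x y : @j m (x + y) = @j m x + @j m y.
      by rewrite -[x]scale1r (decomp_linear dj) !scale1r.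
    have e0 := jD 0 0; rewrite addr0 in e0.
    rewrite ffunE (negPf mk) raddf0.
    by apply: (addIr (@j m 0)); rewrite add0r -e0.
  move: epq; rewrite /= ei el !emb => epq; apply: cut_orth => a b.
  apply: val_inj; rewrite val_starmul val_star !val_ideal_mul starM.
  by rewrite starmulA -[_ ** t l b]starmulA (tcross _ _ epq) starmul0r starmul0l.
Qed.

Lemma positive_val k (x : 'M[Jt]_k) :
  positive x -> positive (map_mx (fun y : Jt => val y) x).
Proof.
move=> [b ->]; exists (map_mx (fun y : Jt => val y) b).
apply/matrixP => p q; rewrite !mxE val_sum; apply: eq_bigr => l _.
by rewrite !mxE.
Qed.

(** The new maps are restrictions of the [psi l] followed by compressions of the [phi l], adjusted
    to a finite list of test elements and a precision. They are compared with the identity at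
    squares first. *)
Lemma hr_le_ideal n : hr_le A n -> hr_le Jt n.
Proof.
move=> [L [le [F [psi [phi [Ld cpA ph cv]]]]]].
have key (S : seq Jt) (d : R) : 0 < d -> exists l, exists phi' : F l -> Jt,
    [/\ cpc phi', ph_strict_order_le phi' n & forall b, b \in S ->
      rn (phi' (psi l (val (star b ** b))) - star b ** b) <= d].
  move=> d0.
  pose good (b : Jt) (e : R) := forall (F : cstarAlgType R) s
      (r : 'I_s -> nat) (j : forall i, 'M[R[i]]_(r i) -> F)
      (dj : matrix_decomposition j) (t : forall i, 'I_(r i) -> A) (x : F),
      positive x -> rn (cut_map dj t x - val (star b ** b)) <= e ->
      exists (zs : seq Jt), exists2 d' : R, 0 < d' &
      forall v : Jt, star v = v -> rn v <= 1 ->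
      (forall z, z \in zs -> rn (z - z ** (v ** star v)) <= d') ->
      rn (cut_map dj (fun i a => t i a ** val v) x - val (star b ** b)) <= d.
  have good_ex b : exists e, 0 < e /\ good b e.
    by have [e e0 eP] := cut_error b d0; exists e.
  have [ef efP] := choice good_ex.
  have [b|l lS] := @directed_seq _ _ _ S
      (fun (b : Jt) l => rn (phi l (psi l (val (star b ** b))) - val (star b ** b)) < ef b / 2) Ld.
    have /net_cvgP/(_ (ef b / 2)) := cv (val (star b ** b)).
    by apply; rewrite divr_gt0//; case: (efP b).
  have [s [r [j [dj phi_cpc phi_oz phi_so]]]] := ph l.
  (* The root error [e] enters multiplied by [N b]; keeping [N b * e] below half of [ef b] leaves
     the other half for the error of the original net. *)
  pose N (b : Jt) : R := \sum_i \sum_a \sum_c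
    cabs (block dj (psi l (val (star b ** b))) i a c).
  have N0 b : 0 <= N b.
    by do 3!apply: sumr_ge0 => ? _; exact: cabs_ge0.
  have [b e e' /andP[e'0 ee'] h|b|e e0 eS] :=
      @seq_min _ _ S (fun (b : Jt) e => N b * e <= ef b / 2).
  - by rewrite (le_trans _ h)// ler_wpM2l.
  - have [eb0 _] := efP b; have N1 : 0 < N b + 1 by rewrite ltr_wpDl.
    exists (ef b / 2 / (N b + 1)); first by rewrite !divr_gt0.
    by rewrite mulrCA ler_piMr ?divr_ge0 ?(ltW eb0)// ler_pdivrMr// mul1r lerDl.
  have [t [C [tC tcross t1 tphi]]] := ph_roots dj phi_cpc phi_oz e0.
  have psi_cpc : cpc (psi l) by case: (cpA l).
  have [b bS|v [vS v1 vP]] := @seq_almost_unit _ S (fun (b : Jt) v =>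
      rn (cut_map dj (fun i a => t i a ** val v) (psi l (val (star b ** b)))
        - val (star b ** b)) <= d).
    have [eb0 ebP] := efP b; apply: ebP.
      by apply: (cp_pos psi_cpc.1); exists (val b).
    rewrite -[X in rn X](subrKA (phi l (psi l (val (star b ** b))))).
    rewrite (le_trans (rnD _ _))// [ef b]splitr lerD//; last exact: ltW (lS b bS).
    by rewrite (le_trans (tphi _))// eS.
  exists l, (cut_map dj (fun i a => ideal_mul (t i a) v)).
  have [wcpc wph] := compress_ph v1 phi_so tC tcross t1.
  by split => // b /vP; rewrite -rn_val raddfB /= val_cut.
have e_gt0 (m : nat) : 0 < m.+1%:R^-1 :> R by rewrite invr_gt0.
(* Lists ordered by inclusion of their members, with a precision [1 / (m + 1)]. *)
pose L' := (seq Jt * nat)%type.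
pose le' (p q : L') := {subset p.1 <= q.1} /\ (p.2 <= q.2)%N.
pose K (p : L') := cid (key p.1 _ (e_gt0 p.2)).
pose lam p := projT1 (K p).
pose phi' p : F (lam p) -> Jt := projT1 (cid (projT2 (K p))).
have phiP p : [/\ cpc (@phi' p), ph_strict_order_le (@phi' p) n & forall b, b \in p.1 ->
      rn (@phi' p (psi (lam p) (val (star b ** b))) - star b ** b) <= p.2.+1%:R^-1].
  exact: (projT2 (cid (projT2 (K p)))).
pose psi' p (x : Jt) := psi (lam p) (val x).
have psiP p : cpc (@psi' p).
  have [_ [[psiL psiC] psi1] _] := cpA (lam p); split; first split.
  - by move=> k x y; rewrite /psi' -psiL.
  - move=> k x /positive_val/psiC.
    by rewrite -map_mx_comp.
  - by move=> x; rewrite /psi' (le_trans (psi1 _)).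
exists L', le', (fun p => F (lam p)), psi', phi'; split.
- split.
  + by constructor; exact: ([::], 0%N).
  + by move=> p; split.
  + move=> p q o [pq1 pq2] [qo1 qo2]; split; last exact: leq_trans qo2.
    by move=> b /pq1/qo1.
  + move=> p q; exists (p.1 ++ q.1, maxn p.2 q.2); split; split => /=.
    * by move=> b bp; rewrite mem_cat bp.
    * exact: leq_maxl.
    * by move=> b bq; rewrite mem_cat bq orbT.
    * exact: leq_maxr.
- by move=> p; have [fF _ _] := cpA (lam p); have [? _ _] := phiP p; split.
- by move=> p; have [] := phiP p.
- move=> a; apply/net_cvgP => e e0.
  (* [T], the new approximation minus the identity, has norm at most 2, so replacing [a] by [a u]
     costs [2 (e / 4)]; the value at [a u] adds less than [e / 4]. *)
  have e4 : 0 < e / 4 by rewrite divr_gt0.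
  have [v [vS v1 va]] := @approximate_unit _ Jt 'I_1 (fun=> a) _ e4.
  set u := v ** star v in va; have {}va := va ord0.
  (* Polarization gives [4 y^* x], which is [4 a u], from the squares of the four elements of
     [S]. *)
  pose y := star a; pose x := u.
  pose S := [:: x + y; x - y; x + 'i *: y; x - 'i *: y].
  pose m := Num.bound (4 / e).
  have mE : m.+1%:R^-1 < e / 4.
    rewrite invf_plt ?posrE// invf_div; apply: (@lt_le_trans _ _ m%:R).
      by apply: archi_boundP; rewrite divr_ge0// ltW.
    by rewrite ler_nat.
  exists (S, m) => p [Sp mp]; have [phi_cpc _ phi_err] := phiP p.
  pose T z : Jt := @phi' p (psi' p z) - z.
  have TL k z z' : T (k *: z + z') = k *: T z + T z'.
    rewrite /T (psiP p).1.1 phi_cpc.1.1 scalerBr opprD addrACA //.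
  have TD z z' : T (z + z') = T z + T z' by rewrite -[z]scale1r TL !scale1r.
  have T0 : T 0 = 0.
    by have e' := TD 0 0; rewrite addr0 in e'; apply: (addIr (T 0)); rewrite add0r -e'.
  have TZ k z : T (k *: z) = k *: T z by rewrite -[k *: z]addr0 TL T0 addr0.
  have TN z : T (- z) = - T z by rewrite -scaleN1r TZ scaleN1r.
  have T2 z : rn (T z) <= rn z + rn z.
    rewrite (le_trans (rnB _ _))// lerD2r -lecR -!rnE.
    by rewrite (le_trans (phi_cpc.2 _))// (psiP p).2.
  have TS b : b \in S -> rn (T (star b ** b)) <= m.+1%:R^-1.
    move=> /Sp/phi_err h; apply: (le_trans h).
    by rewrite lef_pV2 ?posrE// ler_nat ltnS.
  pose P (z : Jt) := star z ** z.
  have pol : 4%:R *: (a ** u) =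
      P (x + y) - P (x - y) + 'i *: (P (x + 'i *: y) - P (x - 'i *: y)).
    have Pd (z : Jt) : P (x + z) - P (x - z) =
        (star x ** z + star z ** x) + (star x ** z + star z ** x).
      rewrite /P starB starD; apply: uin_inj.
      by rewrite !(uinD, uinN, uinM); ncr.
    rewrite !Pd starZ conjCi !starmulZr !starmulZl /y starK.
    rewrite !scalerDr !scalerA mulrN -expr2 sqrCi opprK scaleN1r scale1r.
    rewrite -/y -/x scaler_nat; set q1 := star x ** y; set q2 := a ** x.
    have -> : q2 *+ 4 = q2 + q2 + q2 + q2 by rewrite !mulrS mulr0n addr0 !addrA.
    by apply: uin_inj; rewrite !(uinD, uinN); ncr.
  have Tau : rn (T (a ** u)) <= m.+1%:R^-1.
    have := congr1 (fun z => rn (T z)) pol; rewrite /= TZ rnZ.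
    have -> : cabs (4%:R : R[i]) = 4%:R.
      by rewrite -(rmorph_nat (real_complex R)) cabs_real ger0_norm.
    rewrite !TD TZ TD !TN => h4.
    have ci : cabs ('i : R[i]) = 1 by rewrite /cabs normCi.
    have b1 : rn (T (P (x + y))) <= m.+1%:R^-1 by apply: TS; exact: mem_head.
    have b2 : rn (T (P (x - y))) <= m.+1%:R^-1 by apply: TS; rewrite !inE eqxx orbT.
    have b3 : rn (T (P (x + 'i *: y))) <= m.+1%:R^-1.
      by apply: TS; rewrite !inE eqxx !orbT.
    have b4 : rn (T (P (x - 'i *: y))) <= m.+1%:R^-1.
      by apply: TS; rewrite !inE eqxx !orbT.
    have : 4 * rn (T (a ** u)) <= m.+1%:R^-1 + m.+1%:R^-1 + (m.+1%:R^-1 + m.+1%:R^-1).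
      rewrite h4 (le_trans (rnD _ _))// rnZ ci mul1r.
      by apply: lerD; rewrite (le_trans (rnB _ _))// lerD.
    by rewrite -!mulr2n -mulrnA -[leRHS]mulr_natl ler_pM2l.
  have -> : @phi' p (psi' p a) - a = T (a - a ** u) + T (a ** u).
    by rewrite -TD subrK.
  rewrite (le_lt_trans (rnD _ _))//.
  have {}va : rn (a - a ** u) <= e / 4 := va.
  have := T2 (a - a ** u); move: va Tau mE.
  move: (rn (T _)) (rn (T _)) (rn _) (m.+1%:R^-1) => X1 X2 X3 M.
  by clear - X1 X2 X3 M e e0; lra.
Qed.

End IdealRank.

Local Open Scope ereal_scope.

Theorem mainTheorem2 (R : realType) (A : cstarAlgType R) (J : set A)
  (hA : separable_space A) (hJ : closed_ideal J) :
  hr (subalg_type (ideal_subalg hJ)) <= hr A.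
Proof.
apply: ereal_inf_le_tmp => _ [n An <-]; exists n => //.
exact: hr_le_ideal.
Qed.
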